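(* If $K$ is unramified over $\mathbb{Q}_p$, then every solvable differential module over $\mathcal{R}_K$ of rank one is isomorphic to a moderate module. In other words, $$\mathrm{Pic}^{\mathrm{sol}}(\mathcal{R}_K)=\begin{cases}\mathbb{Z}_p/\mathbb{Z}&\text{if }p>2,\\[2mm]\mathbb{Z}_p/\mathbb{Z}\ \oplus\ k(\!(t)\!)/(\bar{\mathrm F}-1)\,k(\!(t)\!)&\text{if }p=2.\end{cases}$$
   Context: $p$ is a prime, $(K,|.|)$ a complete ultrametric field containing $(\mathbb{Q}_p,|.|)$, with residue field $k$; unramified over $\mathbb{Q}_p$ means discretely valued with $p$ a uniformizer of the ring of integers of $K$. $\bar{\mathrm F}$ is the $p$-th power map. $\omega=|p|^{1/(p-1)}$, $\partial_T=T\frac{d}{dT}$. $\mathcal{A}_K(I)=\{\sum_{i\in\mathbb{Z}}a_iT^i:a_i\in K,\ \sup_i|a_i|\rho^i<\infty\ \forall\rho\in I\}$, $|f|_\rho=\sup_i|a_i|\rho^i$, $\mathcal{R}_K=\bigcup_{\varepsilon>0}\mathcal{A}_K(]1-\varepsilon,1[)$ (Robba ring). The rank one differential module defined by $\partial_T-g(T)$, $g\in\mathcal{R}_K$, is free with basis $\mathbf e$ and $\partial_T(\mathbf e)=g\mathbf e$. With $g_{[0]}=1$, $g_{[1]}=g/T$, $g_{[i+1]}=\frac{d}{dT}g_{[i]}+g_{[i]}g_{[1]}$, put $Ray(M,\rho)=\min(\rho,\omega[\limsup_i|g_{[i]}|_\rho^{1/i}]^{-1})$; $M$ is solvable if $\lim_{\rho\to1^-}Ray(M,\rho)=1$.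 $\mathrm{Pic}^{\mathrm{sol}}(\mathcal{R}_K)$ is the group, under tensor product, of isomorphism classes of solvable rank one differential modules over $\mathcal{R}_K$. A moderate module is a solvable module defined by an operator $\partial_T-a_0$ with $a_0\in K$ constant; solvability is then equivalent to $a_0\in\mathbb{Z}_p$, the module is trivial if and only if $a_0\in\mathbb{Z}$, and the group of moderate modules is thus $\mathbb{Z}_p/\mathbb{Z}$.
   Formalization: The first sentence (every solvable rank one module is isomorphic to a moderate one) is stated only for p > 2, since for p = 2 it is false (e.g. exp(2/T)) and contradicts the displayed formula; for p = 2 only the formula, as a group isomorphism extending the moderate map on Z_p/Z, is stated. *)

(* Defs.v *)
From HB Require Import structures.
From mathcomp Require Import all_boot all_order all_algebra finmap.
From mathcomp Require Import all_classical all_reals all_analysis.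
From mathcomp Require Import ring lra zify.

Set Implicit Arguments.
Unset Strict Implicit.
Unset Printing Implicit Defensive.

Import Order.TTheory GRing.Theory Num.Theory.
Import numFieldNormedType.Exports.

Local Open Scope classical_set_scope.
Local Open Scope ring_scope.
Local Open Scope quotient_scope.

HB.mixin Record hasCompleteUltrametricNorm (R : realType) K of GRing.Field K := {
  unorm : K -> R;
  unorm_ge0 : forall x, 0 <= unorm x;
  unorm_eq0 : forall x, (unorm x == 0) = (x == 0);
  unormM : forall x y, unorm (x * y) = unorm x * unorm y;
  unorm_leD : forall x y, unorm (x + y) <= Num.max (unorm x) (unorm y);
  unorm_complete : forall u : nat -> K,
    (forall e : R, 0 < e -> exists N, forall m n,
       (N <= m)%N -> (N <= n)%N -> unorm (u m - u n) < e) ->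
    exists l, forall e : R, 0 < e -> exists N, forall n,
      (N <= n)%N -> unorm (u n - l) < e
}.

#[short(type="completeUltrametricFieldType")]
HB.structure Definition CompleteUltrametricField (R : realType) :=
  {K of GRing.Field K & hasCompleteUltrametricNorm R K}.

Section UltrametricTheory.
Context {R : realType} {K : completeUltrametricFieldType R}.
Implicit Types (x y : K) (e : R).

Lemma unorm0 : unorm (0 : K) = 0. Proof. by apply/eqP; rewrite unorm_eq0. Qed.

Lemma unorm1 : unorm (1 : K) = 1.
Proof.
have n1 : unorm (1 : K) != 0 by rewrite unorm_eq0 oner_neq0.
by apply: (mulfI n1); rewrite -unormM !mulr1.
Qed.

Lemma unormN x : unorm (- x) = unorm x.
Proof.
suff n1 : unorm (-1 : K) = 1 by rewrite -mulN1r unormM n1 mul1r.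
have : unorm (-1 : K) ^+ 2 = 1 by rewrite expr2 -unormM mulrNN mulr1 unorm1.
by move/eqP; rewrite sqrp_eq1 ?unorm_ge0// => /eqP.
Qed.

Lemma unorm_leB x y : unorm (x - y) <= Num.max (unorm x) (unorm y).
Proof. by rewrite -(unormN y) unorm_leD. Qed.

Lemma unormB x y : unorm (x - y) = unorm (y - x).
Proof. by rewrite -unormN opprB. Qed.

Lemma unormV x : unorm x^-1 = (unorm x)^-1.
Proof.
have [->|x0] := eqVneq x 0; first by rewrite invr0 unorm0 invr0.
have n0 : unorm x != 0 by rewrite unorm_eq0.
by apply: (mulfI n0); rewrite -unormM !mulfV// unorm1.
Qed.

Lemma unormD_le x y e : unorm x <= e -> unorm y <= e -> unorm (x + y) <= e.
Proof. by move=> xe ye; rewrite (le_trans (unorm_leD _ _))// ge_max xe ye. Qed.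

Lemma unormB_le x y e : unorm x <= e -> unorm y <= e -> unorm (x - y) <= e.
Proof. by move=> xe ye; rewrite unormD_le ?unormN. Qed.

Lemma unorm_sum_le (I : eqType) (r : seq I) (P : pred I) (u : I -> K) e :
  0 <= e -> (forall i, i \in r -> P i -> unorm (u i) <= e) ->
  unorm (\sum_(i <- r | P i) u i) <= e.
Proof.
move=> e0 ue; rewrite big_seq_cond.
apply: (big_ind (fun x => unorm x <= e)); first by rewrite unorm0.
  by move=> x y; apply: unormD_le.
by move=> i /andP[]; exact: ue.
Qed.

Section Sums.
Variable I : choiceType.
Implicit Types (u v : I -> K) (F G : {fset I}).

(* Unconditional convergence: s is the limit of the finite partial sums along
   the directed set of finite subsets of I. *)
Definition has_sum u (s : K) := forall e, 0 < e ->
  exists F0 : {fset I}, forall F, (F0 `<=` F)%fset ->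
    unorm (s - \sum_(i <- F) u i) <= e.

(* The value 0 for divergent families is never used: every family summed below
   satisfies `vanishing`, hence converges by `usumP`. *)
Definition usum u : K := xget 0 (has_sum u).

Definition vanishing u := forall e, 0 < e ->
  exists F0 : {fset I}, forall i, i \notin F0 -> unorm (u i) <= e.

Lemma le_small (a b : R) : (forall e, 0 < e -> a <= Num.max e b) -> 0 <= b -> a <= b.
Proof.
move=> h b0; rewrite leNgt; apply/negP => ba.
have d0 : 0 < (a + b) / 2 by lra.
by have := h _ d0; rewrite le_max => /orP[]; lra.
Qed.

Lemma unorm_small x : (forall e, 0 < e -> unorm x <= e) -> x = 0.
Proof.
move=> h; apply/eqP; rewrite -unorm_eq0 eq_le unorm_ge0 andbT.
by apply: le_small => // e e0; rewrite le_max h.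
Qed.

Lemma has_sum_uniq u s t : has_sum u s -> has_sum u t -> s = t.
Proof.
move=> hs ht; apply/eqP; rewrite -subr_eq0; apply/eqP/unorm_small => e e0.
have [F0 h0] := hs e e0; have [F1 h1] := ht e e0.
set G := (F0 `|` F1)%fset.
rewrite (_ : s - t = (s - \sum_(i <- G) u i) - (t - \sum_(i <- G) u i)); last by ring.
by rewrite unormB_le// ?h0 ?h1// ?fsubsetUl ?fsubsetUr.
Qed.

Lemma usumE u s : has_sum u s -> usum u = s.
Proof. by move=> h; apply: has_sum_uniq (h); exact: (@xgetPex _ 0 (has_sum u) (ex_intro _ s h)). Qed.

Lemma sum_diff_le u F G e : 0 <= e ->
  (forall i, i \in F -> i \notin G -> unorm (u i) <= e) ->
  (forall i, i \in G -> i \notin F -> unorm (u i) <= e) ->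
  unorm (\sum_(i <- F) u i - \sum_(i <- G) u i) <= e.
Proof.
move=> e0 hF hG.
rewrite (big_fsetID _ (mem G) F)/= (big_fsetID _ (mem F) G)/=.
have -> : \sum_(i <- [fset i | i in F & i \in G]%fset) u i =
          \sum_(i <- [fset i | i in G & i \in F]%fset) u i.
  by congr bigop; congr enum_fset; apply/fsetP => i; rewrite !inE andbC.
rewrite opprD addrACA subrr add0r unormB_le//.
- by apply: unorm_sum_le => // i; rewrite !inE/= => /andP[iF iG] _; exact: hF.
- by apply: unorm_sum_le => // i; rewrite !inE/= => /andP[iF iG] _; exact: hG.
Qed.

Lemma vanishing_has_sum u : vanishing u -> exists s, has_sum u s.
Proof.
move=> hu.
have /choice[F hF] : forall n : nat, exists F0 : {fset I},
    forall i, i \notin F0 -> unorm (u i) <= n.+1%:R^-1 by move=> n; apply: hu.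
have inv_le m n : (m <= n)%N -> n.+1%:R^-1 <= m.+1%:R^-1 :> R.
  by move=> mn; rewrite lef_pV2 ?posrE ?ltr0Sn// ler_nat.
have small e : 0 < e -> exists N, (N.+1%:R^-1 < e :> R).
  move=> e0; exists (Num.truncn e^-1).
  by rewrite -[ltRHS]invrK ltf_pV2 ?posrE ?invr_gt0 ?ltr0Sn// truncnS_gt.
have [] := unorm_complete (fun n => \sum_(i <- F n) u i).
  move=> e e0; have [N hN] := small e e0; exists N => m n Nm Nn.
  apply: le_lt_trans hN; apply: sum_diff_le; rewrite ?invr_ge0 ?ler0n// => i _ iF.
    by rewrite (le_trans (hF _ _ iF))// inv_le.
  by rewrite (le_trans (hF _ _ iF))// inv_le.
move=> s hs; exists s => e e0.
have [N1 h1] := small e e0; have [N2 h2] := hs e e0.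
pose n := maxn N1 N2; exists (F n) => G FG.
rewrite -[_ - _](subrKA (\sum_(i <- F n) u i)) unormD_le//.
  by rewrite unormB ltW// h2// leq_maxr.
have e1 : n.+1%:R^-1 <= e by rewrite (le_trans _ (ltW h1))// inv_le// leq_maxl.
apply: sum_diff_le; rewrite ?(ltW e0)// => i.
  by move=> /(fsubsetP FG) ->.
by move=> _ /hF /le_trans; apply.
Qed.

Lemma usumP u : vanishing u -> has_sum u (usum u).
Proof. by move=> /vanishing_has_sum[s hs]; rewrite (usumE hs). Qed.

Lemma has_sum_tail u s F0 e : 0 <= e -> has_sum u s ->
  (forall i, i \notin F0 -> unorm (u i) <= e) ->
  forall F, (F0 `<=` F)%fset -> unorm (s - \sum_(i <- F) u i) <= e.
Proof.
move=> e0 hs h F F0F; apply: le_small => // d d0.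
have [F1 h1] := hs d d0.
have := h1 (F `|` F1)%fset (fsubsetUr _ _).
set G := (F `|` F1)%fset => hG.
rewrite -[_ - _](subrKA (\sum_(i <- G) u i)) unormD_le ?le_max ?hG//.
apply/orP; right; apply: sum_diff_le => // i.
  by move=> _ iF; apply: h; apply: contra iF; apply: fsubsetP.
by rewrite !inE => ->.
Qed.

Lemma has_sum_le u s e : 0 <= e -> has_sum u s -> (forall i, unorm (u i) <= e) ->
  unorm s <= e.
Proof.
move=> e0 hs h; have := has_sum_tail (F0 := fset0) e0 hs (fun i _ => h i) (fsubset_refl _).
by rewrite big_seq_fset0 subr0.
Qed.

Lemma has_sumD u v s t : has_sum u s -> has_sum v t -> has_sum (fun i => u i + v i) (s + t).
Proof.
move=> hs ht e e0; have [F0 h0] := hs e e0; have [F1 h1] := ht e e0.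
exists (F0 `|` F1)%fset => F; rewrite fsubUset => /andP[F0F F1F].
by rewrite big_split/= opprD addrACA unormD_le ?h0 ?h1.
Qed.

Lemma has_sumM u s c : has_sum u s -> has_sum (fun i => c * u i) (c * s).
Proof.
have [->|c0] := eqVneq c 0.
  move=> _ e e0; exists fset0 => F _.
  by rewrite mul0r big1 ?subr0 ?unorm0 ?ltW// => i _; rewrite mul0r.
have nc : 0 < unorm c by rewrite lt_def unorm_eq0 c0 unorm_ge0.
move=> hs e e0; have [F0 h0] := hs (e / unorm c) (divr_gt0 e0 nc).
by exists F0 => F F0F; rewrite -mulr_sumr -mulrBr unormM -ler_pdivlMl// mulrC h0.
Qed.

Lemma has_sum1 (i0 : I) u : (forall i, i != i0 -> u i = 0) -> has_sum u (u i0).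
Proof.
move=> h e e0; exists [fset i0]%fset => F; rewrite fsub1set => iF.
rewrite (big_fsetD1 i0)//= big1_seq ?addr0 ?subrr ?unorm0 ?ltW//.
by move=> i /=; rewrite !inE => /andP[/h].
Qed.

End Sums.

Lemma has_sum_reindex (I J : choiceType) (h : J -> I) (h' : I -> J) (u : I -> K) s :
  cancel h h' -> cancel h' h -> has_sum u s -> has_sum (u \o h) s.
Proof.
move=> hK h'K hs e e0; have [F0 h0] := hs e e0.
exists [fset h' i | i in F0]%fset => F F0F.
have := h0 [fset h j | j in F]%fset.
rewrite big_imfset/=; last by move=> ? ? _ _; exact: (can_inj hK).
apply; apply/fsubsetP => i iF0; apply/imfsetP; exists (h' i) => //.
by apply: (fsubsetP F0F); apply/imfsetP; exists i.
Qed.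

Lemma usum_reindex (I J : choiceType) (h : J -> I) (h' : I -> J) (u : I -> K) :
  cancel h h' -> cancel h' h -> vanishing u -> usum (u \o h) = usum u.
Proof. by move=> hK h'K /usumP hu; apply/usumE/has_sum_reindex. Qed.

Lemma vanishing_reindex (I J : choiceType) (h : J -> I) (h' : I -> J) (u : I -> K) :
  cancel h h' -> cancel h' h -> vanishing u -> vanishing (u \o h).
Proof.
move=> hK h'K hu e e0; have [F0 h0] := hu e e0.
exists [fset h' i | i in F0]%fset => j jF /=; apply: h0; apply: contra jF => jF.
by apply/imfsetP; exists (h j).
Qed.

Lemma vanishing_row (I J : choiceType) (u : I * J -> K) i :
  vanishing u -> vanishing (fun j => u (i, j)).
Proof.
move=> hu e e0; have [F0 h0] := hu e e0.
exists [fset x.2 | x in F0]%fset => j jF; apply: h0; apply: contra jF => jF.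
by apply/imfsetP; exists (i, j).
Qed.

Lemma fubini1 (I J : choiceType) (u : I * J -> K) : vanishing u ->
  has_sum (fun i => usum (fun j => u (i, j))) (usum u).
Proof.
move=> hu e e0; have [F0 h0] := hu e e0.
pose E1 := [fset x.1 | x in F0]%fset; pose E2 := [fset x.2 | x in F0]%fset.
exists E1 => F E1F.
pose r := [seq (i, j) | i <- F, j <- E2].
have ur : uniq r.
  by apply: allpairs_uniq; rewrite ?fset_uniq// => -[? ?] [? ?] _ _ [-> ->].
pose G := [fset x | x in r]%fset.
have GE : \sum_(x <- G) u x = \sum_(i <- F) \sum_(j <- E2) u (i, j).
  rewrite -big_allpairs_dep/=; apply: perm_big; apply: uniq_perm; rewrite ?fset_uniq//.
  by move=> x; rewrite !inE.
rewrite -[_ - _](subrKA (\sum_(x <- G) u x)) unormD_le//.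
  apply: (has_sum_tail (ltW e0) (usumP hu) h0); apply/fsubsetP => -[i j] ij.
  rewrite !inE; apply/allpairsP; exists (i, j); split=> //=.
    by apply: (fsubsetP E1F); apply/imfsetP; exists (i, j).
  by apply/imfsetP; exists (i, j).
rewrite GE -sumrB unorm_sum_le// ?ltW// => i _ _; rewrite unormB.
apply: (has_sum_tail (F0 := E2) (ltW e0) (usumP (vanishing_row i hu))) => // j jE.
by apply: h0; apply: contra jE => jE; apply/imfsetP; exists (i, j).
Qed.

Lemma fubini (I J : choiceType) (u : I * J -> K) : vanishing u ->
  usum (fun i => usum (fun j => u (i, j))) = usum (fun j => usum (fun i => u (i, j))).
Proof.
move=> hu; rewrite (usumE (fubini1 hu)).
pose sw (x : J * I) := (x.2, x.1); pose ws (x : I * J) := (x.2, x.1).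
have swK : cancel sw ws by case. have wsK : cancel ws sw by case.
by rewrite -(usum_reindex swK wsK hu) (usumE (fubini1 (vanishing_reindex swK wsK hu))).
Qed.

End UltrametricTheory.

Section LaurentExpansions.
Context {R : realType} {K : completeUltrametricFieldType R}.
Implicit Types (f g h : int -> K) (r rho e C : R).

(* An f : int -> K stands for the formal Laurent expansion of general term
   f i * T^i. *)
Definition gauss_norm f rho : \bar R :=
  ereal_sup [set (unorm (f i) * rho ^ i)%:E | i in [set: int]].

Definition analytic_on (I : set R) f :=
  forall rho, I rho -> (gauss_norm f rho < +oo)%E.

(* The union over eps > 0 is increasing as eps decreases, so it is taken over
   eps < 1, which keeps every radius positive. *)
Definition is_robba f := exists2 e : R, 0 < e < 1 & analytic_on `]1 - e, 1[ f.

Lemma gauss_norm_finP f rho :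
  (gauss_norm f rho < +oo)%E <-> exists C, forall i, unorm (f i) * rho ^ i <= C.
Proof.
split=> [foo|[C hC]]; last first.
  apply: (@le_lt_trans _ _ C%:E); last exact: ltry.
  by apply: ge_ereal_sup => _ [i _ <-]; rewrite lee_fin.
exists (fine (gauss_norm f rho)) => i.
have le_sup j : ((unorm (f j) * rho ^ j)%:E <= gauss_norm f rho)%E.
  by apply: ereal_sup_ubound; exists j.
rewrite -lee_fin fineK// fin_numElt foo andbT.
by apply: lt_le_trans (le_sup 0); rewrite ltNyr.
Qed.

Lemma is_robbaP f : is_robba f <-> exists2 e : R, 0 < e < 1 &
  forall rho, 1 - e < rho < 1 -> exists C, forall i, unorm (f i) * rho ^ i <= C.
Proof.
split=> -[e e01 he]; exists e => // rho.
  by move=> rho1; apply/gauss_norm_finP/he; rewrite /= in_itv.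
by rewrite /= in_itv/= => rho1; apply/gauss_norm_finP/he.
Qed.

Lemma is_robba_geo f e : 0 < e < 1 ->
  (forall rho, 1 - e < rho < 1 -> exists C, forall i, unorm (f i) * rho ^ i <= C) ->
  forall rho, 1 - e < rho < 1 -> exists C th,
    [/\ 0 <= C, 0 < th < 1 & forall i, unorm (f i) * rho ^ i <= C * th ^+ `|i|].
Proof.
move=> e01 he rho rho1.
pose r1 := (1 - e + rho) / 2; pose r2 := (rho + 1) / 2.
have r1P : 1 - e < r1 < rho by rewrite /r1; lra.
have r2P : rho < r2 < 1 by rewrite /r2; lra.
clearbody r1 r2.
have [|C1 hC1] := he r1; first lra.
have [|C2 hC2] := he r2; first lra.
have rho0 : 0 < rho by lra.
have r10 : 0 < r1 by lra.
have r20 : 0 < r2 by lra.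
pose th := Num.max (r1 / rho) (rho / r2).
have thl : r1 / rho <= th by rewrite le_max lexx.
have thr : rho / r2 <= th by rewrite le_max lexx orbT.
have q1 : 0 < r1 / rho by rewrite divr_gt0.
have q2 : 0 < rho / r2 by rewrite divr_gt0.
have th0 : 0 < th by apply: lt_le_trans thl.
exists (`|C1| + `|C2|), th; split; first by rewrite addr_ge0.
  by rewrite th0/= gt_max !ltr_pdivrMr// !mul1r; apply/andP; split; lra.
case=> n.
- have -> : unorm (f n) * rho ^ n%:Z = unorm (f n) * r2 ^ n%:Z * (rho / r2) ^+ n.
    by rewrite -!exprnP expr_div_n mulrACA mulfV ?mulr1// expf_neq0 ?gt_eqF.
  apply: ler_pM.
  + by rewrite mulr_ge0 ?unorm_ge0 ?exprz_ge0 ?ltW.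
  + by rewrite exprn_ge0 ?ltW.
  + by rewrite (le_trans (hC2 _))// (le_trans (ler_norm _))// lerDr.
  + by rewrite lerXn2r ?nnegrE// ltW.
- have -> : unorm (f (Negz n)) * rho ^ Negz n =
     unorm (f (Negz n)) * r1 ^ Negz n * (r1 / rho) ^+ n.+1.
    rewrite !NegzE -!exprnN expr_div_n -!mulrA; congr (_ * _).
    by rewrite mulKf// expf_neq0 ?gt_eqF.
  have -> : `|Negz n|%N = n.+1 by [].
  apply: ler_pM.
  + by rewrite mulr_ge0 ?unorm_ge0 ?exprz_ge0 ?ltW.
  + by rewrite exprn_ge0 ?ltW.
  + by rewrite (le_trans (hC1 _))// (le_trans (ler_norm _))// lerDl.
  + by rewrite lerXn2r ?nnegrE// ltW.
Qed.

Lemma is_robba2 f g : is_robba f -> is_robba g -> exists2 e : R, 0 < e < 1 &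
  forall rho, 1 - e < rho < 1 -> exists C th,
    [/\ 0 <= C, 0 < th < 1, forall i, unorm (f i) * rho ^ i <= C * th ^+ `|i|
      & forall i, unorm (g i) * rho ^ i <= C * th ^+ `|i|].
Proof.
move=> /is_robbaP[e1 e11 h1] /is_robbaP[e2 e21 h2].
have m1 : Num.min e1 e2 <= e1 by rewrite ge_min lexx.
have m2 : Num.min e1 e2 <= e2 by rewrite ge_min lexx orbT.
exists (Num.min e1 e2) => [|rho rhoP].
  apply/andP; split; last lra.
  by rewrite lt_min; apply/andP; split; lra.
have [|C1 [t1 [C10 t11 H1]]] := is_robba_geo e11 h1 (rho := rho); first lra.
have [|C2 [t2 [C20 t21 H2]]] := is_robba_geo e21 h2 (rho := rho); first lra.
have tm1 : t1 <= Num.max t1 t2 by rewrite le_max lexx.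
have tm2 : t2 <= Num.max t1 t2 by rewrite le_max lexx orbT.
exists (C1 + C2), (Num.max t1 t2); split; first by rewrite addr_ge0.
- by rewrite lt_max gt_max; apply/andP; split; [apply/orP; left|apply/andP; split]; lra.
- move=> i; apply: le_trans (H1 i) _; apply: ler_pM; rewrite ?exprn_ge0 ?lerDl//; first lra.
  by rewrite lerXn2r ?nnegrE//; lra.
- move=> i; apply: le_trans (H2 i) _; apply: ler_pM; rewrite ?exprn_ge0 ?lerDr//; first lra.
  by rewrite lerXn2r ?nnegrE//; lra.
Qed.

Lemma geo_small (C th e : R) : 0 <= C -> 0 < th < 1 -> 0 < e ->
  exists N, forall n, (N <= n)%N -> C * th ^+ n <= e.
Proof.
move=> C0 th01 e0.
have th0 : 0 <= th <= 1 by lra.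
have : th ^+ n @[n --> \oo] --> (0 : R).
  by apply: cvg_expr; rewrite ger0_norm; lra.
have C1 : 0 < e / (C + 1) by rewrite divr_gt0//; lra.
move=> /cvgrPdist_lt /(_ _ C1)[N _ hN]; exists N => n /hN /=.
have tn : 0 <= th ^+ n by rewrite exprn_ge0//; lra.
rewrite sub0r normrN ger0_norm// ltr_pdivlMr; last lra.
by move=> h; rewrite mulrC; lra.
Qed.

Definition int_ball (N : nat) : {fset int} :=
  [fset (nat_of_ord i)%:Z - N%:Z | i : 'I_(N.*2.+1)]%fset.

Lemma in_int_ball N (i : int) : (i \in int_ball N) = (`|i| <= N)%N.
Proof.
apply/imfsetP/idP => [[j _ ->]|iN]; first by have := ltn_ord j; lia.
have jN : (absz (i + N%:Z)%R < N.*2.+1)%N by lia.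
by exists (Ordinal jN) => //=; lia.
Qed.

Lemma vanishing_geo (u : int -> K) (C th : R) : 0 <= C -> 0 < th < 1 ->
  (forall i, unorm (u i) <= C * th ^+ `|i|) -> vanishing u.
Proof.
move=> C0 th01 hu e e0; have [N hN] := geo_small C0 th01 e0.
exists (int_ball N) => i; rewrite in_int_ball -ltnNge => Ni.
by apply: le_trans (hu i) (hN _ (ltnW Ni)).
Qed.

Lemma vanishing_geo2 (u : int * int -> K) (C th : R) : 0 <= C -> 0 < th < 1 ->
  (forall i j, unorm (u (i, j)) <= C * th ^+ (`|i| + `|j - i|)) -> vanishing u.
Proof.
move=> C0 th01 hu e e0; have [N hN] := geo_small C0 th01 e0.
exists (int_ball N `*` int_ball N.*2)%fset => -[i j] hij.
apply: le_trans (hu i j) (hN _ _).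
rewrite leqNgt; apply: contra hij => hij; rewrite in_fsetM !in_int_ball/=.
by lia.
Qed.

(* Cauchy product; an infinite sum in K for each coefficient. *)
Definition conv f g (n : int) : K := usum (fun i => f i * g (n - i)).

Lemma geo_mul f g (C th rho : R) (n : int) : 0 < rho -> 0 <= C -> 0 < th < 1 ->
  (forall i, unorm (f i) * rho ^ i <= C * th ^+ `|i|) ->
  (forall i, unorm (g i) * rho ^ i <= C * th ^+ `|i|) ->
  forall i, unorm (f i * g (n - i)) * rho ^ n <= C * C * th ^+ (`|i| + `|n - i|).
Proof.
move=> rho0 C0 th01 hf hg i; rewrite unormM.
have -> : rho ^ n = rho ^ i * rho ^ (n - i).
  by rewrite -expfzDr ?gt_eqF// addrC subrK.
rewrite mulrACA exprD [leRHS]mulrACA.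
have p0 j (a : K) : 0 <= unorm a * rho ^ j by rewrite mulr_ge0 ?unorm_ge0 ?exprz_ge0 ?ltW.
exact: ler_pM.
Qed.

Lemma vanishing_conv f g n : is_robba f -> is_robba g ->
  vanishing (fun i => f i * g (n - i)).
Proof.
move=> hf hg; have [e e01 he] := is_robba2 hf hg.
have [|C [th [C0 th01 hC hC']]] := he (1 - e / 2); first lra.
have rho0 : 0 < 1 - e / 2 by lra.
have H := geo_mul n rho0 C0 th01 hC hC'.
have n0 : 0 < (1 - e / 2) ^ n by rewrite exprz_gt0.
apply: (@vanishing_geo _ (C * C / (1 - e / 2) ^ n) th) => //.
  by rewrite divr_ge0 ?mulr_ge0// ltW.
move=> i; rewrite mulrAC ler_pdivlMr//; apply: le_trans (H i) _.
rewrite ler_wpM2l ?mulr_ge0// exprD ler_piMr ?exprn_ge0 ?exprn_ile1//; lra.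
Qed.

Lemma is_robba_conv f g : is_robba f -> is_robba g -> is_robba (conv f g).
Proof.
move=> hf hg; have [e e01 he] := is_robba2 hf hg.
apply/is_robbaP; exists e => // rho rho1.
have rho0 : 0 < rho by lra.
have [C [th [C0 th01 hC hC']]] := he _ rho1.
exists (C * C) => n.
have n0 : 0 < rho ^ n by rewrite exprz_gt0.
rewrite -ler_pdivlMr//; apply: has_sum_le (usumP (vanishing_conv n hf hg)) _.
  by rewrite divr_ge0 ?mulr_ge0// ltW.
move=> i; rewrite ler_pdivlMr//.
apply: le_trans (geo_mul n rho0 C0 th01 hC hC' i) _.
by rewrite ler_piMr ?mulr_ge0// exprn_ile1//; lra.
Qed.

Lemma is_robbaB f g : is_robba f -> is_robba g -> is_robba (fun i => f i - g i).
Proof.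
move=> hf hg; have [e e01 he] := is_robba2 hf hg.
apply/is_robbaP; exists e => // rho rho1.
have rho0 : 0 < rho by lra.
have [C [th [C0 th01 hC hC']]] := he _ rho1.
exists C => i; have n0 : 0 < rho ^ i by rewrite exprz_gt0.
have thi : C * th ^+ `|i| <= C by rewrite ler_piMr// exprn_ile1//; lra.
rewrite -ler_pdivlMr// unormB_le// ler_pdivlMr//.
  exact: le_trans (hC i) thi.
exact: le_trans (hC' i) thi.
Qed.

Lemma convC f g : is_robba f -> is_robba g -> conv f g = conv g f.
Proof.
move=> hf hg; apply/funext => n; rewrite /conv.
rewrite -(@usum_reindex _ _ _ _ (fun i => n - i) (fun i => n - i)).
- by congr usum; apply/funext => i /=; rewrite subKr mulrC.
- by move=> i; rewrite subKr.
- by move=> i; rewrite subKr.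
- exact: vanishing_conv.
Qed.

Lemma convA f g h : is_robba f -> is_robba g -> is_robba h ->
  conv f (conv g h) = conv (conv f g) h.
Proof.
move=> hf hg hh; apply/funext => n.
pose u (x : int * int) := f x.1 * g (x.2 - x.1) * h (n - x.2).
have hfg := is_robba2 hf hg.
have hu : vanishing u.
  have [e1 e11 he1] := is_robba2 hf hg; have [e2 e21 he2] := is_robba2 hg hh.
  pose m := Num.min e1 e2.
  have m1 : m <= e1 by rewrite ge_min lexx.
  have m2 : m <= e2 by rewrite ge_min lexx orbT.
  have m0 : 0 < m by rewrite lt_min; apply/andP; split; lra.
  pose rho := 1 - m / 2.
  have rho0 : 0 < rho by rewrite /rho; lra.
  have [|C1 [t1 [C10 t11 H1 H1']]] := he1 rho; first by rewrite /rho; lra.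
  have [|C2 [t2 [C20 t21 _ H2]]] := he2 rho; first by rewrite /rho; lra.
  have n0 : 0 < rho ^ n by rewrite exprz_gt0.
  apply: (@vanishing_geo2 _ (C1 * C1 * C2 / rho ^ n) t1) => //.
    by rewrite divr_ge0 ?mulr_ge0// ltW.
  move=> i j; rewrite /u/= [leRHS]mulrAC ler_pdivlMr// unormM.
  have -> : rho ^ n = rho ^ j * rho ^ (n - j).
    by rewrite -expfzDr ?gt_eqF// addrC subrK.
  rewrite mulrACA [leRHS]mulrAC; apply: ler_pM.
  - by rewrite mulr_ge0 ?unorm_ge0 ?exprz_ge0 ?ltW.
  - by rewrite mulr_ge0 ?unorm_ge0 ?exprz_ge0 ?ltW.
  - exact: geo_mul.
  - by apply: le_trans (H2 _) _; rewrite ler_piMr// exprn_ile1//; lra.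
transitivity (usum (fun i => usum (fun j => u (i, j)))); last first.
  rewrite (fubini hu); congr usum; apply/funext => j.
  rewrite /u/= mulrC; apply: usumE; rewrite /conv.
  under eq_fun do rewrite mulrC.
  by apply: has_sumM; apply/usumP/vanishing_conv.
congr usum; apply/funext => i; apply/esym/usumE.
rewrite /u/=; under eq_fun do rewrite -mulrA.
apply: has_sumM.
have := has_sum_reindex (h := fun j => j - i) (h' := fun j => j + i)
  (subrK i) (addrK i) (usumP (vanishing_conv (n - i) hg hh)).
by congr has_sum; apply/funext => j /=; congr (_ * h _); rewrite opprB addrA subrK.
Qed.

Lemma convDl f g h : is_robba f -> is_robba g -> is_robba h ->
  conv (fun i => f i + g i) h = (fun i => conv f h i + conv g h i).
Proof.
move=> hf hg hh; apply/funext => n; apply: usumE.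
under eq_fun do rewrite mulrDl.
by apply: has_sumD; apply/usumP/vanishing_conv.
Qed.

Definition monom_coef (c : K) (n i : int) : K := if i == n then c else 0.

Lemma is_robba_monom c n : is_robba (monom_coef c n).
Proof.
apply/is_robbaP; exists (1 / 2); first lra.
move=> rho rho1; exists (unorm c * rho ^ n) => i; rewrite /monom_coef.
have [->//|_] := eqVneq; rewrite unorm0 mul0r mulr_ge0 ?unorm_ge0 ?exprz_ge0//; lra.
Qed.

Lemma conv_monom c m g n : conv (monom_coef c m) g n = c * g (n - m).
Proof.
have -> : c * g (n - m) = monom_coef c m m * g (n - m) by rewrite /monom_coef eqxx.
apply/usumE/(@has_sum1 _ _ _ m (fun i => monom_coef c m i * g (n - i))).
by move=> i /negPf im; rewrite /monom_coef im mul0r.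
Qed.

Definition deriv_coef f (i : int) : K := (i + 1)%:~R * f (i + 1).

Lemma unorm_nat_le1 n : unorm (n%:R : K) <= 1.
Proof.
elim: n => [|n IHn]; first by rewrite unorm0 ler01.
by rewrite -addn1 natrD unormD_le ?unorm1.
Qed.

Lemma unorm_int_le1 (n : int) : unorm (n%:~R : K) <= 1.
Proof.
by case: n => n; rewrite ?NegzE ?mulrNz ?unormN; exact: unorm_nat_le1.
Qed.

Lemma is_robba_deriv f : is_robba f -> is_robba (deriv_coef f).
Proof.
move=> /is_robbaP[e e01 he]; apply/is_robbaP; exists e => // rho rho1.
have rho0 : 0 < rho by lra.
have [C hC] := he _ rho1; exists (C / rho) => i.
rewrite ler_pdivlMr// -mulrA -[X in _ * (_ * X)]expr1z -expfzDr ?gt_eqF// unormM.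
apply: le_trans (hC (i + 1)); apply: ler_wpM2r; first by rewrite exprz_ge0// ltW.
by rewrite ler_piMl ?unorm_ge0 ?unorm_int_le1.
Qed.

Lemma deriv_conv f g : is_robba f -> is_robba g ->
  deriv_coef (conv f g) = (fun i => conv (deriv_coef f) g i + conv f (deriv_coef g) i).
Proof.
move=> hf hg; apply/funext => n; rewrite /deriv_coef.
pose u (i : int) := i%:~R * f i * g (n + 1 - i).
pose v (i : int) := f i * ((n + 1 - i)%:~R * g (n + 1 - i)).
have hv : has_sum v (conv f (deriv_coef g) n).
  have := usumP (vanishing_conv n hf (is_robba_deriv hg)).
  congr has_sum; apply/funext => i; rewrite /v /deriv_coef.
  by rewrite -addrA [- i + 1]addrC addrA.
have hu : has_sum u (conv (deriv_coef f) g n).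
  have := has_sum_reindex (h := fun j => j - 1) (h' := fun j => j + 1)
    (subrK 1) (addrK 1) (usumP (vanishing_conv n (is_robba_deriv hf) hg)).
  congr has_sum; apply/funext => i; rewrite /u /deriv_coef/= subrK.
  by congr (_ * g _); rewrite opprB addrA.
apply: has_sum_uniq (has_sumD hu hv).
have := has_sumM (n + 1)%:~R (usumP (vanishing_conv (n + 1) hf hg)).
congr has_sum; apply/funext => i; rewrite /u /v.
by rewrite mulrCA [X in _ = _ + X]mulrA -?mulrDl intrB; ring.
Qed.

End LaurentExpansions.

Section LaurentSeries.
Context {k : comNzRingType}.
Implicit Types f g h : int -> k.

(* Elements of k((t)); the sums in `lconv` have finitely many nonzero terms. *)
Definition is_laurent f := exists N : nat, forall i : int, i < - N%:Z -> f i = 0.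

Definition lconv f g (n : int) : k := \sum_(i \in [set: int]) f i * g (n - i).

Lemma is_laurentB f g : is_laurent f -> is_laurent g -> is_laurent (fun i => f i - g i).
Proof.
move=> [N hN] [M hM]; exists (N + M)%N => i iNM.
by rewrite hN ?hM ?subr0//; lia.
Qed.

Lemma lconvE f g (n : int) (B : {fset int}) :
  (forall i, i \notin B -> f i * g (n - i) = 0) ->
  lconv f g n = \sum_(i <- B) f i * g (n - i).
Proof. by move=> h; apply: fsbigTE. Qed.

Lemma lconv0 f g (N M : nat) (n : int) : (forall i : int, i < - N%:Z -> f i = 0) ->
  (forall i : int, i < - M%:Z -> g i = 0) ->
  forall B : {fset int}, (forall i : int, - N%:Z <= i -> i <= n + M%:Z -> i \in B) ->
  lconv f g n = \sum_(i <- B) f i * g (n - i).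
Proof.
move=> hf hg B hB; apply: lconvE => i iB.
have [iN|iN] := ltP i (- N%:Z); first by rewrite hf// mul0r.
have [iM|iM] := leP i (n + M%:Z); first by rewrite hB in iB.
by rewrite hg ?mulr0//; lia.
Qed.

Lemma is_laurent_lconv f g : is_laurent f -> is_laurent g -> is_laurent (lconv f g).
Proof.
move=> [N hN] [M hM]; exists (N + M)%N => n nNM.
rewrite (lconv0 hN hM (B := fset0)) ?big_seq_fset0// => i h1 h2; lia.
Qed.

Lemma lconvC f g : lconv f g = lconv g f.
Proof.
apply/funext => n; rewrite /lconv.
rewrite (reindex_fsbigT (fun i => n - i))/=; last first.
  by exists (fun i => n - i) => i; rewrite subKr.
by apply: eq_fsbigr => i _; rewrite subKr mulrC.
Qed.

Lemma lconvA f g h : is_laurent f -> is_laurent g -> is_laurent h ->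
  lconv f (lconv g h) = lconv (lconv f g) h.
Proof.
move=> lf lg lh; apply/funext => n.
have [N0 hgh] := is_laurent_lconv lg lh; have [N4 hfg] := is_laurent_lconv lf lg.
move: lf lg lh => [N1 hf] [N2 hg] [N3 hh].
pose B := int_ball (N0 + N1 + N2 + N3 + N4 + `|n|).
have inB (i : int) : (`|i| <= N0 + N1 + N2 + N3 + N4 + `|n|)%N -> i \in B.
  by rewrite in_int_ball.
rewrite (lconv0 hf hgh (B := B)); last by move=> i ? ?; apply: inB; lia.
rewrite (lconv0 hfg hh (B := B)); last by move=> i ? ?; apply: inB; lia.
transitivity (\sum_(i <- B) \sum_(j <- B) f i * g (j - i) * h (n - j)).
  apply: eq_bigr => i _.
  have [iN|iN] := ltP i (- N1%:Z).
    by rewrite hf// mul0r big1// => j _; rewrite !mul0r.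
  have -> : lconv g h (n - i) = \sum_(j <- B) g (j - i) * h (n - j).
    rewrite /lconv (reindex_fsbigT (fun j => j - i))/=; last first.
      by exists (fun j => j + i) => j; rewrite ?subrK ?addrK.
    rewrite (fsbigTE B) => [|j jB].
      by apply: eq_bigr => j _; congr (_ * h _); rewrite opprB addrA subrK.
    have [?|?] := ltP (j - i) (- N2%:Z); first by rewrite hg// mul0r.
    have [?|?] := ltP (n - i - (j - i)) (- N3%:Z); first by rewrite hh// mulr0.
    by move: jB; rewrite inB//; lia.
  by rewrite mulr_sumr; apply: eq_bigr => j _; rewrite mulrA.
rewrite exchange_big/=; apply: eq_bigr => j _.
have [jN|jN] := ltP (n - j) (- N3%:Z).
  by rewrite hh// mulr0 big1// => i _; rewrite mulr0.
rewrite (lconv0 hf hg (B := B)); last by move=> i ? ?; apply: inB; lia.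
by rewrite mulr_suml.
Qed.

Lemma lconvDl f g h : is_laurent f -> is_laurent g -> is_laurent h ->
  lconv (fun i => f i + g i) h = (fun i => lconv f h i + lconv g h i).
Proof.
move=> [N1 hf] [N2 hg] [N3 hh]; apply/funext => n.
pose B := int_ball (N1 + N2 + N3 + `|n|).
have inB (i : int) : (`|i| <= N1 + N2 + N3 + `|n|)%N -> i \in B.
  by rewrite in_int_ball.
rewrite (lconv0 hf hh (B := B)); last by move=> i ? ?; apply: inB; lia.
rewrite (lconv0 hg hh (B := B)); last by move=> i ? ?; apply: inB; lia.
rewrite (@lconv0 _ _ (N1 + N2) N3 n _ hh B).
- by rewrite -big_split/=; apply: eq_bigr => i _; rewrite mulrDl.
- by move=> i iN; rewrite hf ?hg ?addr0//; lia.
- by move=> i ? ?; apply: inB; lia.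
Qed.

Definition lone (i : int) : k := if i == 0 then 1 else 0.

Lemma is_laurent_one : is_laurent lone.
Proof. by exists 0%N => -[|] // [|]. Qed.

Lemma lconv1 f : lconv lone f = f.
Proof.
apply/funext => n; rewrite (@lconvE _ _ _ [fset 0]%fset).
  by rewrite big_seq_fset1 /lone eqxx mul1r subr0.
by move=> i; rewrite inE /lone => /negPf ->; rewrite mul0r.
Qed.

Definition laurent_pred : {pred int -> k} := [pred f | `[< is_laurent f >]].

Lemma laurent_predP f : reflect (is_laurent f) (f \in laurent_pred).
Proof. exact: asboolP. Qed.

Lemma laurent_zmod_closed : zmod_closed laurent_pred.
Proof.
split; first by apply/laurent_predP; exists 0%N.
by move=> f g /laurent_predP hf /laurent_predP hg; exact/laurent_predP/is_laurentB.
Qed.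

HB.instance Definition _ :=
  GRing.isZmodClosed.Build (int -> k) laurent_pred laurent_zmod_closed.

End LaurentSeries.

Record laurent (k : comNzRingType) := Laurent {
  laurent_coef :> int -> k;
  laurent_coefP : laurent_coef \in laurent_pred
}.

HB.instance Definition _ (k : comNzRingType) := [isSub for @laurent_coef k].
HB.instance Definition _ (k : comNzRingType) := [Choice of laurent k by <:].
HB.instance Definition _ (k : comNzRingType) :=
  [SubChoice_isSubZmodule of laurent k by <:].

Section LaurentRing.
Variable k : comNzRingType.
Implicit Types f g h : laurent k.

Lemma laurentP f : is_laurent f.
Proof. exact/laurent_predP/laurent_coefP. Qed.

Definition laurent_one : laurent k := Laurent (introT (laurent_predP _) is_laurent_one).

Definition laurent_mul f g : laurent k :=
  Laurent (introT (laurent_predP _) (is_laurent_lconv (laurentP f) (laurentP g))).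

Fact laurent_mulA : associative laurent_mul.
Proof. by move=> f g h; apply/val_inj/lconvA; exact: laurentP. Qed.

Fact laurent_mulC : commutative laurent_mul.
Proof. by move=> f g; apply/val_inj/lconvC. Qed.

Fact laurent_mul1 : left_id laurent_one laurent_mul.
Proof. by move=> f; apply/val_inj/lconv1. Qed.

Fact laurent_mulDl : left_distributive laurent_mul +%R.
Proof. by move=> f g h; apply/val_inj/lconvDl; exact: laurentP. Qed.

Fact laurent_one_neq0 : laurent_one != 0.
Proof.
apply/eqP => /(congr1 (fun f : laurent k => f 0)) /= /eqP.
by rewrite /lone eqxx (negPf (oner_neq0 _)).
Qed.

HB.instance Definition _ := GRing.Zmodule_isComNzRing.Build (laurent k)
  laurent_mulA laurent_mulC laurent_mul1 laurent_mulDl laurent_one_neq0.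

End LaurentRing.

Section Robba.
Context {R : realType}.
Variable K : completeUltrametricFieldType R.

Definition robba_pred : {pred int -> K} := [pred f | `[< is_robba f >]].

Lemma robba_predP f : reflect (is_robba f) (f \in robba_pred).
Proof. exact: asboolP. Qed.

Lemma robba_zmod_closed : zmod_closed robba_pred.
Proof.
split.
  apply/robba_predP; have := is_robba_monom (0 : K) 0.
  by congr is_robba; apply/funext => i; rewrite /monom_coef; case: ifP.
by move=> f g /robba_predP hf /robba_predP hg; exact/robba_predP/is_robbaB.
Qed.

HB.instance Definition _ :=
  GRing.isZmodClosed.Build (int -> K) robba_pred robba_zmod_closed.

Record robba := Robba {
  robba_coef :> int -> K;
  robba_coefP : robba_coef \in robba_pred
}.

HB.instance Definition _ := [isSub for robba_coef].
HB.instance Definition _ := [Choice of robba by <:].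
HB.instance Definition _ := [SubChoice_isSubZmodule of robba by <:].

Implicit Types (f g h : robba) (c : K).

Lemma robbaP f : is_robba f.
Proof. exact/robba_predP/robba_coefP. Qed.

(* c * T^n *)
Definition robba_monom c (n : int) : robba :=
  Robba (introT (robba_predP _) (is_robba_monom c n)).

Definition robba_mul f g : robba :=
  Robba (introT (robba_predP _) (is_robba_conv (robbaP f) (robbaP g))).

Fact robba_mulA : associative robba_mul.
Proof. by move=> f g h; apply/val_inj/convA; exact: robbaP. Qed.

Fact robba_mulC : commutative robba_mul.
Proof. by move=> f g; apply/val_inj/convC; exact: robbaP. Qed.

Fact robba_mul1 : left_id (robba_monom 1 0) robba_mul.
Proof. by move=> f; apply/val_inj/funext => n; rewrite /= conv_monom mul1r subr0. Qed.

Fact robba_mulDl : left_distributive robba_mul +%R.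
Proof. by move=> f g h; apply/val_inj/convDl; exact: robbaP. Qed.

Fact robba_one_neq0 : robba_monom 1 0 != 0.
Proof.
apply/eqP => /(congr1 (fun f : robba => f 0)) /= /eqP.
by rewrite /monom_coef eqxx (negPf (oner_neq0 _)).
Qed.

HB.instance Definition _ := GRing.Zmodule_isComNzRing.Build robba
  robba_mulA robba_mulC robba_mul1 robba_mulDl robba_one_neq0.

Definition robba_deriv f : robba :=
  Robba (introT (robba_predP _) (is_robba_deriv (robbaP f))).

Fact robba_derivB : {morph robba_deriv : f g / f - g}.
Proof. by move=> f g; apply/val_inj/funext => i; rewrite /= /deriv_coef mulrBr. Qed.

HB.instance Definition _ :=
  GRing.isZmodMorphism.Build robba robba robba_deriv robba_derivB.

Lemma robba_derivM f g : robba_deriv (f * g) = robba_deriv f * g + f * robba_deriv g.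
Proof. by apply/val_inj/deriv_conv; exact: robbaP. Qed.

(* T * d/dT *)
Definition robba_theta f : robba := robba_monom 1 1 * robba_deriv f.

Fact robba_thetaB : {morph robba_theta : f g / f - g}.
Proof. by move=> f g; rewrite /robba_theta raddfB mulrBr. Qed.

HB.instance Definition _ :=
  GRing.isZmodMorphism.Build robba robba robba_theta robba_thetaB.

Lemma robba_thetaM f g : robba_theta (f * g) = robba_theta f * g + f * robba_theta g.
Proof. by rewrite /robba_theta robba_derivM mulrDr mulrA mulrCA. Qed.

Lemma robba_thetaE f (i : int) : robba_theta f i = i%:~R * f i.
Proof. by rewrite /= conv_monom /deriv_coef mul1r subrK. Qed.

Definition robba_const c : robba := robba_monom c 0.

End Robba.

Record diffmod (R : realType) (K : completeUltrametricFieldType R) := DiffMod {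
  diffmod_car :> lmodType (robba K);
  nabla : diffmod_car -> diffmod_car;
  nablaB : {morph nabla : x y / x - y};
  nablaZ : forall (f : robba K) (x : diffmod_car),
    nabla (f *: x) = robba_theta f *: x + f *: nabla x
}.

Section DifferentialModules.
Context {R : realType} {K : completeUltrametricFieldType R}.
Implicit Types (M N L : diffmod K) (g h : robba K).

Definition diffmod_iso M N := exists phi : {linear M -> N},
  bijective phi /\ forall x, phi (nabla x) = nabla (phi x).

Definition is_basis1 M (e : M) :=
  forall x : M, exists! f : robba K, x = f *: e.

(* M is the rank one module defined by the operator theta - g. *)
Definition defined_by M g :=
  exists e : M, is_basis1 e /\ nabla e = g *: e.

Definition bilinear_map (M N L : lmodType (robba K)) (b : M -> N -> L) :=
  (forall y, linear (b^~ y)) /\ (forall x, linear (b x)).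

(* L is the tensor product of M and N over the Robba ring, the derivation being
   determined on pure tensors by the Leibniz rule. *)
Definition is_tensor M N L := exists t : M -> N -> L,
  [/\ bilinear_map t,
      forall x y, nabla (t x y) = t (nabla x) y + t x (nabla y) &
      forall (P : lmodType (robba K)) (b : M -> N -> P), bilinear_map b ->
        exists! u : L -> P, linear u /\ forall x y, u (t x y) = b x y].

(* The module with underlying space the Robba ring, with basis e = 1; the
   derivation is f e |-> (theta f + f g) e. *)
Section RankOne.
Variable g : robba K.

Definition rank1_nabla (f : (robba K)^o) : (robba K)^o := robba_theta f + f * g.

Fact rank1_nablaB : {morph rank1_nabla : x y / x - y}.
Proof. by move=> x y; rewrite /rank1_nabla raddfB mulrBl opprD addrACA. Qed.

Fact rank1_nablaZ (f : robba K) (x : (robba K)^o) :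
  rank1_nabla (f *: x) = robba_theta f *: x + f *: rank1_nabla x.
Proof.
have H (a y : robba K) :
  robba_theta (a * y) + a * y * g = robba_theta a * y + a * (robba_theta y + y * g).
  by rewrite robba_thetaM mulrDr -addrA [a * (y * g)]mulrA.
exact: H.
Qed.

Definition rank1 : diffmod K := DiffMod rank1_nablaB rank1_nablaZ.

End RankOne.

Fact robba_theta1 : robba_theta (1 : robba K) = 0.
Proof.
have := robba_thetaM (1 : robba K) 1; rewrite !mulr1 mul1r => /eqP.
by rewrite -subr_eq0 opprD addNKr oppr_eq0 => /eqP.
Qed.

Lemma rank1_defined_by g : defined_by (rank1 g) g.
Proof.
exists (1 : robba K); split=> [x|].
  exists (x : robba K); split=> [|f].
    by apply/esym; exact: (mulr1 (x : robba K)).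
  by move=> xf; apply: etrans xf _; exact: (mulr1 f).
have H : robba_theta 1 + 1 * g = g * 1 by rewrite robba_theta1 add0r mulrC.
exact: H.
Qed.

Lemma rank1_tensor g h : is_tensor (rank1 g) (rank1 h) (rank1 (g + h)).
Proof.
exists (fun x y : robba K => x * y); split.
- split=> [y a x z|x a y z].
    have H (a' x' y' z' : robba K) : (a' * x' + z') * y' = a' * (x' * y') + z' * y'.
      by rewrite mulrDl mulrA.
    exact: H.
  have H (a' x' y' z' : robba K) : x' * (a' * y' + z') = a' * (x' * y') + x' * z'.
    by rewrite mulrDr mulrCA.
  exact: H.
- have H (x y : robba K) : robba_theta (x * y) + x * y * (g + h) =
    (robba_theta x + x * g) * y + x * (robba_theta y + y * h).
    by rewrite robba_thetaM; ring.
  exact: H.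
- move=> P b [bl br].
  have blZ (a x y : robba K) : b (a * x) y = a *: b x y.
    have h0 : b 0 y = 0 by have := bl y (-1) 0 0; rewrite !scaleN1r oppr0 add0r addNr.
    by have := bl y a x 0; rewrite addr0 h0 addr0.
  have brZ (x a y : robba K) : b x (a * y) = a *: b x y.
    have h0 : b x 0 = 0 by have := br x (-1) 0 0; rewrite !scaleN1r oppr0 add0r addNr.
    by have := br x a y 0; rewrite addr0 h0 addr0.
  exists (fun x => b x 1); split=> [|u [ul ut]].
    split=> [|x y]; first exact: (bl 1).
    by rewrite -[y in RHS](mulr1 (y : robba K)) (brZ x y 1) mulrC blZ.
  by apply/funext => x; rewrite -ut (mulr1 (x : robba K)).
Qed.

End DifferentialModules.

Lemma defined_by_rank1 {R : realType} {K : completeUltrametricFieldType R}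
  (M : diffmod K) (g : robba K) : defined_by M g -> diffmod_iso (rank1 g) M.
Proof.
move=> [e [eb en]].
pose h (f : robba K) : M := f *: e.
have lh : linear (h : rank1 g -> M).
  have H (a x y : robba K) : (a * x + y) *: e = a *: (x *: e) + y *: e.
    by rewrite scalerDl scalerA.
  exact: H.
pose phi : {linear rank1 g -> M} :=
  HB.pack (h : rank1 g -> M) (GRing.isLinear.Build _ _ _ _ _ lh).
exists phi; split.
  have /choice[psi psiP] : forall x : M, exists f : robba K, x = f *: e.
    by move=> x; have [f []] := eb x; exists f.
  have psiK (x : robba K) : psi (x *: e) = x.
    have [f [_ fu]] := eb (x *: e).
    exact: etrans (esym (fu _ (psiP (x *: e)))) (fu x erefl).
  by exists psi => x; [exact: psiK|exact: esym (psiP x)].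
have H (f : robba K) : (robba_theta f + f * g) *: e = nabla (f *: e).
  by rewrite nablaZ en scalerA scalerDl.
exact: H.
Qed.

Section PicardGroup.
Context {R : realType}.
Variable K : completeUltrametricFieldType R.
Implicit Types (g h : robba K).

Fact rank1_isoP g h : diffmod_iso (rank1 g) (rank1 h) <->
  exists u v : robba K, u * v = 1 /\ robba_theta u + u * h = g * u.
Proof.
split=> [[phi [[psi psiK phiK] hphi]]|[u [v [uv hu]]]].
  pose F : robba K -> robba K := phi.
  have FZ (a x : robba K) : F (a * x) = a * F x by exact: (linearZZ phi a (x : rank1 g)).
  have FE x : F x = x * F 1 by rewrite -FZ mulr1.
  exists (F 1), (psi (1 : robba K)); split.
    by rewrite mulrC -FE; exact: phiK.
  have H : F (robba_theta 1 + 1 * g) = robba_theta (F 1) + F 1 * h by exact: (hphi (1 : robba K)).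
  by rewrite -H robba_theta1 add0r mul1r FE.
have lu : linear ((fun x : robba K => x * u) : rank1 g -> rank1 h).
  move=> a x y.
  have H (a' x' y' : robba K) : (a' * x' + y') * u = a' * (x' * u) + y' * u.
    by rewrite mulrDl mulrA.
  exact: H.
pose phi : {linear rank1 g -> rank1 h} :=
  HB.pack ((fun x : robba K => x * u) : rank1 g -> rank1 h)
    (GRing.isLinear.Build _ _ _ _ _ lu).
exists phi; split.
  exists (fun x : robba K => x * v).
  - have H (x : robba K) : x * u * v = x by rewrite -mulrA uv mulr1.
    exact: H.
  - have H (x : robba K) : x * v * u = x by rewrite -mulrA [v * u]mulrC uv mulr1.
    exact: H.
have H (x : robba K) : (robba_theta x + x * g) * u = robba_theta (x * u) + x * u * h.
  by rewrite robba_thetaM mulrDl -!mulrA -addrA -mulrDr hu.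
exact: H.
Qed.

(* The group of isomorphism classes of rank one differential modules. Any such
   module is some `rank1 g` up to isomorphism (`defined_by_rank1`), and
   rank1 g (x) rank1 h is rank1 (g + h) by `rank1_tensor`, so the tensor product
   of classes is induced by the addition of g and h. *)
Definition pic_rel : rel (robba K) :=
  fun g h => `[< diffmod_iso (rank1 g) (rank1 h) >].

Fact pic_relP g h : reflect (exists u v : robba K,
  u * v = 1 /\ robba_theta u + u * h = g * u) (pic_rel g h).
Proof. by apply: (iffP (asboolP _)) => /rank1_isoP. Qed.

Fact pic_rel_refl : reflexive pic_rel.
Proof.
by move=> g; apply/pic_relP; exists 1, 1; rewrite !mul1r robba_theta1 add0r mulr1.
Qed.

Fact pic_rel_sym : symmetric pic_rel.
Proof.
suff H g h : pic_rel g h -> pic_rel h g by move=> g h; apply/idP/idP; exact: H.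
move=> /pic_relP[u [v [uv hu]]]; apply/pic_relP; exists v, u; split; first by rewrite mulrC.
have tv : robba_theta v * u + v * robba_theta u = 0.
  by rewrite -robba_thetaM mulrC uv robba_theta1.
have -> : robba_theta v = (robba_theta v * u + v * robba_theta u) * v
   - v * v * robba_theta u + robba_theta v * (1 - u * v) by ring.
rewrite tv uv subrr mulr0 mul0r.
have -> : robba_theta u = g * u - u * h by rewrite -hu addrK.
have -> : 0 - v * v * (g * u - u * h) + 0 + v * g =
   h * v * (u * v) + v * g * (1 - u * v) by ring.
by rewrite uv subrr mulr0 addr0 mulr1.
Qed.

Fact pic_rel_trans : transitive pic_rel.
Proof.
move=> h g l /pic_relP[u [v [uv hu]]] /pic_relP[u' [v' [uv' hu']]].
apply/pic_relP; exists (u * u'), (v * v'); split; first by rewrite mulrACA uv uv' mulr1.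
have -> : g * (u * u') = g * u * u' by ring.
rewrite -hu mulrDl -[u * h * u']mulrA -hu' robba_thetaM; ring.
Qed.

Canonical pic_equiv := EquivRel pic_rel pic_rel_refl pic_rel_sym pic_rel_trans.
Canonical pic_encModRel := defaultEncModRel pic_rel.

Definition picard := {eq_quot pic_rel}.
HB.instance Definition _ := EqQuotient.on picard.
HB.instance Definition _ := Choice.on picard.

Fact pic_relD g g' h h' : pic_rel g g' -> pic_rel h h' -> pic_rel (g + h) (g' + h').
Proof.
move=> /pic_relP[u [v [uv hu]]] /pic_relP[u' [v' [uv' hu']]].
apply/pic_relP; exists (u * u'), (v * v'); split; first by rewrite mulrACA uv uv' mulr1.
have -> : (g + h) * (u * u') = g * u * u' + u * (h * u') by ring.
by rewrite -hu -hu' robba_thetaM; ring.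
Qed.

Fact pic_relN g g' : pic_rel g g' -> pic_rel (- g) (- g').
Proof.
move=> hg.
have := pic_relD (pic_rel_refl (- g - g')) hg.
rewrite subrK addrAC addNr add0r; rewrite pic_rel_sym; exact.
Qed.

Definition pic_zero : picard := lift_cst picard 0.
Definition pic_add := lift_op2 picard +%R.
Definition pic_opp := lift_op1 picard -%R.

Canonical pi_pic_zero_morph := PiConst pic_zero.

Fact pic_rel_repr g : pic_rel g (repr (\pi_picard g)).
Proof. by apply/eqmodP; rewrite reprK. Qed.

Fact pi_pic_opp : {morph \pi : g / - g >-> pic_opp g}.
Proof.
move=> g; unlock pic_opp; apply/eqP; rewrite piE; apply: pic_relN.
exact: pic_rel_repr.
Qed.
Canonical pi_pic_opp_morph := PiMorph1 pi_pic_opp.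

Fact pi_pic_add : {morph \pi : g h / g + h >-> pic_add g h}.
Proof.
move=> g h; unlock pic_add; apply/eqP; rewrite piE; apply: pic_relD.
  exact: pic_rel_repr.
exact: pic_rel_repr.
Qed.
Canonical pi_pic_add_morph := PiMorph2 pi_pic_add.

Fact pic_addA : associative pic_add.
Proof. by move=> x y z; rewrite -[x]reprK -[y]reprK -[z]reprK !piE addrA. Qed.

Fact pic_addC : commutative pic_add.
Proof. by move=> x y; rewrite -[x]reprK -[y]reprK !piE addrC. Qed.

Fact pic_add0 : left_id pic_zero pic_add.
Proof. by move=> x; rewrite -[x]reprK !piE add0r. Qed.

Fact pic_addN : left_inverse pic_zero pic_opp pic_add.
Proof. by move=> x; rewrite -[x]reprK !piE addNr. Qed.

HB.instance Definition _ :=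
  GRing.isZmodule.Build picard pic_addA pic_addC pic_add0 pic_addN.

Definition pic_class g : picard := \pi_picard g.

Fact pic_classB : {morph pic_class : g h / g - h}.
Proof. by move=> g h; rewrite /pic_class !piE. Qed.

HB.instance Definition _ :=
  GRing.isZmodMorphism.Build (robba K) picard pic_class pic_classB.

Lemma pic_class_eq g h : pic_class g = pic_class h <-> diffmod_iso (rank1 g) (rank1 h).
Proof.
split=> [/eqmodP/asboolP//|hgh]; apply/eqmodP.
by rewrite /= /pic_rel asboolT.
Qed.

End PicardGroup.

Section ResidueField.
Context {R : realType}.
Variable K : completeUltrametricFieldType R.

Definition valring_pred : {pred K} := [pred x | unorm x <= 1].

Fact valring_subring_closed : subring_closed valring_pred.
Proof.
split=> [|x y|x y]; rewrite !inE ?unorm1// => hx hy; first exact: unormB_le.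
by rewrite unormM mulr_ile1 ?unorm_ge0.
Qed.

HB.instance Definition _ :=
  GRing.isSubringClosed.Build K valring_pred valring_subring_closed.

Record valring := Valring { valring_val :> K; _ : valring_val \in valring_pred }.

HB.instance Definition _ := [isSub for valring_val].
HB.instance Definition _ := [Choice of valring by <:].
HB.instance Definition _ := [SubChoice_isSubComNzRing of valring by <:].

Definition maxideal : {pred valring} := [pred x | unorm (val x) < 1].

Fact maxideal_idealr_closed : idealr_closed maxideal.
Proof.
split=> [||a x y]; rewrite !inE ?unorm0 ?unorm1 ?ltr01 ?ltxx// => hx hy.
rewrite (le_lt_trans (unorm_leD _ _))// gt_max hy andbT unormM.
by rewrite (le_lt_trans _ hx)// ler_piMl ?unorm_ge0//; case: a.
Qed.

HB.instance Definition _ := isIdealr.Build valring maxideal maxideal_idealr_closed.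

Definition residue := {ideal_quot maxideal}.

HB.instance Definition _ := GRing.ComNzRing.on residue.
HB.instance Definition _ := NzRingQuotient.on residue.

Definition residue_class (x : valring) : residue := \pi x.

Definition residue_inv (x : residue) : residue :=
  residue_class (insubd 0 (val (repr x))^-1).

Fact maxidealP (x : valring) : (x \in maxideal) = (residue_class x == 0).
Proof. by rewrite -[x in LHS]subr0 Quotient.idealrBE pi_zeror. Qed.

Fact residue_mulVf : forall x : residue, x != 0 -> residue_inv x * x = 1.
Proof.
move=> x x0; pose y := repr x.
have xE : x = residue_class y by rewrite /residue_class reprK.
have : y \notin maxideal by rewrite maxidealP -xE.
rewrite inE -leNgt => y1.
transitivity (residue_class (insubd 0 (val y)^-1) * residue_class y); first by rewrite -xE.
rewrite /residue_class -pi_mulr; apply: etrans pi_oner; congr (\pi _).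
apply: val_inj => /=; rewrite insubdK; last first.
  by rewrite inE unormV invf_le1// (lt_le_trans ltr01).
by rewrite mulVf// -unorm_eq0 gt_eqF// (lt_le_trans ltr01).
Qed.

Fact residue_inv0 : residue_inv 0 = 0.
Proof.
rewrite /residue_inv; set y := repr 0.
have : y \in maxideal by rewrite maxidealP /residue_class reprK.
rewrite inE => y1; suff -> : insubd 0 (val y)^-1 = 0 :> valring by rewrite /residue_class pi_zeror.
have [y0|y0] := eqVneq (val y) 0.
  by rewrite y0 invr0; apply: val_inj; rewrite insubdK// inE unorm0 ler01.
rewrite /insubd insubN//= inE unormV -ltNge invf_gt1// lt_def unorm_eq0 y0.
exact: unorm_ge0.
Qed.

HB.instance Definition _ := GRing.ComNzRing_isField.Build residue
  residue_mulVf residue_inv0.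

End ResidueField.

Section QuotientGroups.
Variables (A : zmodType) (S : set A).

(* `zquot S` is the quotient of A by the subgroup generated by S; this is A / S
   when S is already a subgroup, see `zspan_id`. *)
Definition zspan : {pred A} := [pred x | `[< forall H : {pred A},
  zmod_closed H -> (forall y, S y -> y \in H) -> x \in H >]].

Fact zspan_zmod_closed : zmod_closed zspan.
Proof.
split=> [|x y /asboolP hx /asboolP hy]; apply/asboolP => H hH SH; first exact: hH.1.
by apply: hH.2; [exact: hx|exact: hy].
Qed.

HB.instance Definition _ := GRing.isZmodClosed.Build A zspan zspan_zmod_closed.

Lemma zspan_id : zmod_closed (mem S) -> forall x, (x \in zspan) = (x \in S).
Proof.
move=> hS x; apply/asboolP/idP => [h|xS H _ SH]; last by apply: SH; rewrite inE in xS.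
by have := h (mem S) hS (fun y => @mem_set _ S y).
Qed.

Definition zquot := Quotient.quot zspan.

HB.instance Definition _ := GRing.Zmodule.on zquot.

Definition zclass (x : A) : zquot := \pi x.

Lemma zclass_eq x y : zclass x = zclass y <-> x - y \in zspan.
Proof. by rewrite Quotient.idealrBE; split=> /eqP. Qed.

End QuotientGroups.

Section PadicField.
Context {R : realType}.
Variables (p : nat) (K : completeUltrametricFieldType R).

Definition padic_abs (q : rat) : R :=
  if q == 0 then 0
  else p%:R ^ ((logn p `|denq q|)%:Z - (logn p `|numq q|)%:Z).

(* As K is complete, it contains the valued field Q_p as soon as its absolute
   value restricts to the p-adic one on the rationals; Q_p and Z_p are then the
   closures of the rationals and of the integers in K. *)
Definition contains_Qp := forall q : rat, unorm (ratr q : K) = padic_abs q.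

(* The value group is the infinite cyclic group generated by unorm w. *)
Definition uniformizer (w : K) := [/\ w != 0, unorm w < 1 &
  forall x : K, x != 0 -> exists n : int, unorm x = unorm w ^ n].

Definition unramified := uniformizer p%:R.

(* Z_p, as the closure of the integers in K. *)
Definition padic_int_pred : {pred K} := [pred x | `[< forall e : R, 0 < e ->
  exists n : int, unorm (x - n%:~R) < e >]].

Fact padic_int_zmod_closed : zmod_closed padic_int_pred.
Proof.
split=> [|x y /asboolP hx /asboolP hy]; apply/asboolP => e e0.
  by exists 0; rewrite subr0 unorm0.
have [m hm] := hx e e0; have [n hn] := hy e e0; exists (m - n).
have -> : x - y - (m - n)%:~R = (x - m%:~R) - (y - n%:~R) by rewrite intrB; ring.
by rewrite (le_lt_trans (unorm_leB _ _))// gt_max hm hn.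
Qed.

HB.instance Definition _ := GRing.isZmodClosed.Build K padic_int_pred padic_int_zmod_closed.

Record padic_int := PadicInt { padic_int_val :> K; _ : padic_int_val \in padic_int_pred }.

HB.instance Definition _ := [isSub for padic_int_val].
HB.instance Definition _ := [Choice of padic_int by <:].
HB.instance Definition _ := [SubChoice_isSubZmodule of padic_int by <:].

Definition padic_int_modZ : zmodType :=
  zquot [set x : padic_int | exists n : int, (x : K) = n%:~R].

(* k((t)) / (F - 1) k((t)), with k the residue field of K. *)
Definition artin_schreier_quot : zmodType :=
  zquot (range (fun f : laurent (residue K) => f ^+ p - f)).

End PadicField.

Section Solvability.
Context {R : realType} {K : completeUltrametricFieldType R}.
Variable p : nat.
Implicit Types (g : robba K) (M : diffmod K).

Definition omega : R := unorm (p%:R : K) `^ (p.-1%:R)^-1.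

Definition g1 g : robba K := robba_monom 1 (- 1) * g.

Fixpoint giter g (i : nat) : robba K :=
  if i is j.+1 then robba_deriv (giter g j) + giter g j * g1 g else 1.

(* The inverse of a zero limsup is +oo in \bar R, and ray is then rho. *)
Definition ray g (rho : R) : \bar R :=
  Order.min rho%:E (omega%:E *
    (limn_esup (fun i => gauss_norm (giter g i) rho `^ (i%:R)^-1))^-1)%E.

Definition solvable_op g := ray g rho @[rho --> 1^'-] --> 1%:E.

Definition solvable M := exists2 g, defined_by M g & solvable_op g.

Definition moderate M := solvable M /\ exists a0 : K, defined_by M (robba_const a0).

Definition pic_sol : set (picard K) :=
  [set c | exists g, solvable (rank1 g) /\ c = pic_class g].

End Solvability.

(* Main.v *)
(* Write z_i for the coefficients of the Taylor series of the solution of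
   theta u = g u, so that [z_i = 1/i! (theta - i + 1 + g) ... (theta + g) 1].
   For solvable g the Gauss norms of the z_i grow at a rate that tends to 1 with
   the radius, and passing to the powers of sum_i z_i x^i shows that all the z_i
   have coefficients in the ring of integers.  Extremal monomials of Cauchy
   products then show that the positive part, the constant term and the negative
   part of g separately have integral z_i, so that the positive part is trivial
   and the constant term is a p-adic integer.

   For the negative part, the formal solution exp(sum l_n T^-n) has integral
   coefficients.  Writing it as an infinite product of factors 1 - x_n T^-n and
   using that K is unramified gives p | l_n.  If p > 2, then |p| < omega makes
   the exponential converge.  If p = 2, the class only depends on l_n / 2 modulo
   2, and it is trivial exactly when this reduction is the polar part of
   w^2 - w: for a unit solution 1 + w one compares coefficients in log (1 + w),
   and 1 - 2 x T^-m realises the converse.  A splitting of the Artin-Schreier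
   quotient of the residue field identifies the classes of polar parts with the
   Artin-Schreier quotient of the full Laurent series field, which has one more
   copy of k / (F - 1) k, coming from the constant term. *)
From HB Require Import structures.
Require Import Defs.
From mathcomp Require Import all_boot all_order all_algebra finmap.
From mathcomp Require Import all_classical all_reals all_analysis.
From mathcomp Require Import ring lra zify.

Set Implicit Arguments.
Unset Strict Implicit.
Unset Printing Implicit Defensive.

Import Order.TTheory GRing.Theory Num.Theory.
Import numFieldNormedType.Exports.

Local Open Scope classical_set_scope.
Local Open Scope ring_scope.
Local Open Scope quotient_scope.

(** * Coefficients and Gauss norms in the Robba ring *)

(** Solvability only bounds the growth of the z_i by rates close to 1, which does not forbid
    coefficients of norm above 1. Integrality is a rigidity phenomenon: sum_i z_i x^i is
    multiplicative in g and so are weighted Gauss norms, hence one norm above 1 would persist for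
    every multiple of g, whereas for p^N g the series is the exponential of a small argument.

    The constant omega is the threshold of exp, as |1/(k+1)!| <= omega^-k. Since omega^(p-1) = |p|,
    the bound |l_n| <= |p| lies strictly below the threshold for p > 2 and exactly on it for p = 2;
    there divisibility by 4 suffices for triviality, which is why only l_n / 2 modulo 2 matters.

    The divisibility p | l_n is a Witt vector argument: up to sign, n l_n is the n-th ghost
    component of the x_m and also a coefficient of g. It tends to 0, which excludes units among the
    x_m, and an unramified K has no norms strictly between |p| and 1.

    The additional copy of k / (F - 1) k is absorbed by a shift: the constant term moves to degree
    -1, and the copy carried by each odd degree -m moves to degree -(m + 2). *)

Section RobbaCoefficients.
Context {R : realType} {K : completeUltrametricFieldType R}.
Implicit Types (f g h : robba K) (c : K) (n m : int) (rho a b e : R).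

Lemma robba_ext f g : (forall n, f n = g n) -> f = g.
Proof. by move=> fg; apply/val_inj/funext. Qed.

Lemma rcoef0 n : (0 : robba K) n = 0.
Proof. by []. Qed.

Lemma rcoefB f g n : (f - g) n = f n - g n.
Proof. by []. Qed.

Lemma rcoefN f n : (- f) n = - f n.
Proof. by []. Qed.

Lemma rcoefD f g n : (f + g) n = f n + g n.
Proof. by []. Qed.

Lemma rcoef1 n : (1 : robba K) n = (n == 0)%:R.
Proof. by rewrite /= /monom_coef; case: eqP. Qed.

Lemma rcoef_monom c m n : robba_monom c m n = c *+ (n == m).
Proof. by rewrite /= /monom_coef; case: eqP. Qed.

Lemma rcoef_sum (I : Type) (r : seq I) (P : pred I) (F : I -> robba K) n :
  (\sum_(i <- r | P i) F i) n = \sum_(i <- r | P i) F i n.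
Proof.
elim/big_ind2: _; [exact: rcoef0 | move=> x1 x2 y1 y2 <- <-; exact: rcoefD | by []].
Qed.

Lemma rcoef_monomM c m f n : (robba_monom c m * f) n = c * f (n - m).
Proof. exact: conv_monom. Qed.

Lemma rcoefZ c f n : (robba_const c * f) n = c * f n.
Proof. by rewrite rcoef_monomM subr0. Qed.

Lemma rcoef_theta f n : robba_theta f n = n%:~R * f n.
Proof. exact: robba_thetaE. Qed.

Lemma robba_const_is_zmod : zmod_morphism (@robba_const R K).
Proof.
move=> a b; apply: robba_ext => n.
by rewrite rcoefB !rcoef_monom mulrnBl.
Qed.

Lemma robba_const_is_monoid : monoid_morphism (@robba_const R K).
Proof.
split=> [//|a b]; apply: robba_ext => n.
by rewrite rcoefZ !rcoef_monom mulrnAr.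
Qed.

HB.instance Definition _ :=
  GRing.isZmodMorphism.Build K (robba K) (@robba_const R K) robba_const_is_zmod.
HB.instance Definition _ :=
  GRing.isMonoidMorphism.Build K (robba K) (@robba_const R K) robba_const_is_monoid.

Lemma robba_theta_const c : robba_theta (robba_const c) = 0.
Proof.
apply: robba_ext => n; rewrite rcoef_theta rcoef_monom rcoef0.
by case: eqP => [->|_]; rewrite ?mulr0n ?mul0r ?mulr0.
Qed.

Lemma robba_thetaZ c f : robba_theta (robba_const c * f) = robba_const c * robba_theta f.
Proof. by rewrite robba_thetaM robba_theta_const mul0r add0r. Qed.

Lemma robba_monomM c1 c2 m1 m2 :
  robba_monom c1 m1 * robba_monom c2 m2 = robba_monom (c1 * c2) (m1 + m2).
Proof.
apply: robba_ext => n; rewrite rcoef_monomM !rcoef_monom mulrnAr.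
by congr (_ *+ _); rewrite subr_eq addrC.
Qed.

Lemma robba_theta_monom c m :
  robba_theta (robba_monom c m) = robba_const m%:~R * robba_monom c m.
Proof.
apply: robba_ext => n; rewrite rcoef_theta rcoefZ !rcoef_monom.
by case: eqP => [->//|_]; rewrite !mulr0.
Qed.

Lemma rcoefM_sum f g n : has_sum (fun i => f i * g (n - i)) ((f * g) n).
Proof. by apply/usumP/vanishing_conv; exact: robbaP. Qed.

Lemma rcoefM_le f g n e : 0 <= e ->
  (forall i, unorm (f i * g (n - i)) <= e) -> unorm ((f * g) n) <= e.
Proof. by move=> e0; apply: has_sum_le (rcoefM_sum f g n). Qed.

Lemma rcoefM_eq0 f g n : (forall i, f i * g (n - i) = 0) -> (f * g) n = 0.
Proof.
move=> h; apply: (has_sum_uniq (rcoefM_sum f g n)) => e e0; exists fset0 => F _.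
by rewrite big1 ?subr0 ?unorm0 ?ltW.
Qed.

Lemma rcoefM_finite f g n (F : {fset int}) :
  (forall i, i \notin F -> f i * g (n - i) = 0) ->
  (f * g) n = \sum_(i <- F) f i * g (n - i).
Proof.
move=> h; apply: (has_sum_uniq (rcoefM_sum f g n)) => e e0; exists F => G FG.
suff -> : \sum_(i <- F) f i * g (n - i) = \sum_(i <- G) f i * g (n - i).
  by rewrite subrr unorm0 ltW.
by apply/big_fset_incl => // i _ /h.
Qed.

Lemma rcoefM_close f g n i0 e : 0 <= e ->
  (forall i, i != i0 -> unorm (f i * g (n - i)) <= e) ->
  unorm ((f * g) n - f i0 * g (n - i0)) <= e.
Proof.
move=> e0 h.
rewrite -[X in (f * g) n - X](big_seq_fset1 +%R i0 (fun i => f i * g (n - i))).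
apply: (has_sum_tail e0 (rcoefM_sum f g n)) (fsubset_refl _).
by move=> i; rewrite inE => /h.
Qed.

(** Only finitely many terms exceed [e / 2], so a termwise strict bound is uniform. This is how
    strict inequalities pass to infinite sums. *)
Lemma vanishing_lt_le (I : choiceType) (u : I -> K) e : 0 < e -> vanishing u ->
  (forall i, unorm (u i) < e) -> exists2 d, 0 <= d < e & forall i, unorm (u i) <= d.
Proof.
move=> e0 vu ue; have e20 : 0 < e / 2 by lra.
have [F hF] := vu _ e20.
have [d [d0 dF]] : exists d, 0 <= d < e /\ forall i, i \in F -> unorm (u i) <= d.
  elim/finSet_rect: F {hF} => F IH.
  have [->|/fset0Pn[i iF]] := eqVneq F fset0; first by exists 0; rewrite lexx e0.
  have [d [d0 hd]] := IH _ (fproperD1 iF).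
  exists (Num.max d (unorm (u i))); split.
    by rewrite le_max gt_max ue; case/andP: d0 => -> ->.
  move=> j jF; have [->|ji] := eqVneq j i; first by rewrite le_max lexx orbT.
  by rewrite le_max hd// !inE ji jF.
exists (Num.max d (e / 2)).
  by rewrite le_max gt_max; apply/andP; split; [case/andP: d0 => -> _|apply/andP; split; lra].
move=> i; rewrite le_max; case: (boolP (i \in F)) => [/dF ->//|/hF ->].
by rewrite orbT.
Qed.

Lemma rcoefM_close_lt f g n i0 e : 0 < e ->
  (forall i, i != i0 -> unorm (f i * g (n - i)) < e) ->
  unorm ((f * g) n - f i0 * g (n - i0)) < e.
Proof.
move=> e0 h.
pose u i := if i == i0 then 0 else f i * g (n - i).
have vu : vanishing u.
  move=> d d0; have [F hF] := vanishing_conv n (robbaP f) (robbaP g) d0.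
  exists F => i /hF; rewrite /u; case: ifP => // _ _.
  by rewrite unorm0 ltW.
have [|d /andP[d0 de] hd] := vanishing_lt_le e0 vu.
  by move=> i; rewrite /u; case: eqP => [_|/eqP/h//]; rewrite unorm0.
apply: le_lt_trans de; apply: rcoefM_close => // i ii0.
by have := hd i; rewrite /u (negPf ii0).
Qed.

(** An upper bound for the Gauss norm, stated with reals so that estimates avoid extended-real
    arithmetic. *)
Definition gbound rho f a := forall n, unorm (f n) * rho ^ n <= a.

Lemma gbound_le rho f a b : gbound rho f a -> a <= b -> gbound rho f b.
Proof. by move=> h ab n; apply: le_trans (h n) ab. Qed.

Lemma gbound_ge0 rho f a : 0 < rho -> gbound rho f a -> 0 <= a.
Proof.
by move=> r0 /(_ 0); apply: le_trans; rewrite mulr_ge0 ?unorm_ge0 ?exprz_ge0 ?ltW.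
Qed.

Lemma gboundD rho f g a : 0 < rho -> gbound rho f a -> gbound rho g a -> gbound rho (f + g) a.
Proof.
move=> r0 hf hg n; have rn : 0 < rho ^ n by rewrite exprz_gt0.
by rewrite -ler_pdivlMr// rcoefD unormD_le// ler_pdivlMr.
Qed.

Lemma gboundN rho f a : gbound rho f a -> gbound rho (- f) a.
Proof. by move=> h n; rewrite rcoefN unormN. Qed.

Lemma gbound0 rho a : 0 <= a -> gbound rho 0 a.
Proof. by move=> a0 n; rewrite rcoef0 unorm0 mul0r. Qed.

Lemma gbound_sum rho (I : Type) (r : seq I) (P : pred I) (F : I -> robba K) a :
  0 < rho -> 0 <= a ->
  (forall i, P i -> gbound rho (F i) a) -> gbound rho (\sum_(i <- r | P i) F i) a.
Proof.
move=> r0 a0 h; elim/big_ind: _ => //; first exact: gbound0.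
by move=> x y; apply: gboundD.
Qed.

Lemma gboundM rho f g a b : 0 < rho -> gbound rho f a -> gbound rho g b ->
  gbound rho (f * g) (a * b).
Proof.
move=> r0 hf hg n; have rn : 0 < rho ^ n by rewrite exprz_gt0.
have a0 := gbound_ge0 r0 hf; have b0 := gbound_ge0 r0 hg.
rewrite -ler_pdivlMr//; apply: rcoefM_le; first by rewrite divr_ge0 ?mulr_ge0// ltW.
move=> i; rewrite ler_pdivlMr// unormM.
have -> : rho ^ n = rho ^ i * rho ^ (n - i).
  by rewrite -expfzDr ?gt_eqF// addrC subrK.
rewrite mulrACA; apply: ler_pM; rewrite ?hf ?hg//.
  by rewrite mulr_ge0 ?unorm_ge0 ?exprz_ge0// ltW.
by rewrite mulr_ge0 ?unorm_ge0 ?exprz_ge0// ltW.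
Qed.

Lemma gboundZ rho c f a : gbound rho f a -> gbound rho (robba_const c * f) (unorm c * a).
Proof. by move=> hf n; rewrite rcoefZ unormM -mulrA ler_wpM2l ?unorm_ge0. Qed.

Lemma gbound_theta rho f a : 0 < rho -> gbound rho f a -> gbound rho (robba_theta f) a.
Proof.
move=> r0 hf n; rewrite rcoef_theta unormM; apply: le_trans (hf n).
rewrite ler_wpM2r ?exprz_ge0 ?(ltW r0)// ler_piMl ?unorm_ge0//.
exact: unorm_int_le1.
Qed.

Lemma gbound1 rho : gbound rho 1 1.
Proof.
by move=> n; rewrite rcoef1; case: eqP => [->|_];
  rewrite ?unorm1 ?unorm0 ?mul0r ?mul1r ?ler01 ?lexx.
Qed.

Lemma gbound_exp rho f a k : 0 < rho -> gbound rho f a -> gbound rho (f ^+ k) (a ^+ k).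
Proof.
move=> r0 hf; elim: k => [|k IH]; first by rewrite !expr0; exact: gbound1.
by rewrite !exprS; apply: gboundM.
Qed.

Lemma gbound1E f a : gbound 1 f a <-> forall n, unorm (f n) <= a.
Proof. by split=> h n; have := h n; rewrite expr1z mulr1 || rewrite exp1rz mulr1. Qed.

Lemma robba_mulrn k f n : (k%:R * f) n = k%:R * f n.
Proof. by rewrite -(rmorph_nat (@robba_const R K)) rcoefZ. Qed.

End RobbaCoefficients.

(** * Exponentials of power series *)

Section ExponentialCoefficients.
Variables (A : comNzRingType) (iv : nat -> A).
Hypothesis ivP : forall k, iv k * k.+1%:R = 1.
Implicit Types (l : nat -> A) (P Q : {poly A}).

(** The inverse of k!, built from the chosen inverses [iv]. This keeps the section usable both for
    [K] and for the Robba ring, where the inverses are constants. *)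
Definition ifact k := \prod_(j < k) iv j.

Lemma ifactS k : ifact k.+1 * k.+1%:R = ifact k.
Proof. by rewrite /ifact big_ord_recr /= -mulrA ivP mulr1. Qed.

Lemma ivI k (x y : A) : k.+1%:R * x = k.+1%:R * y -> x = y.
Proof. by move=> /(congr1 ( *%R (iv k))); rewrite !mulrA !ivP !mul1r. Qed.

Definition exp_arg l n : {poly A} := \poly_(i < n.+1) (if i is 0 then 0 else l i).

(** As [exp_arg] has no constant term, its k-th power starts in degree k, and this truncation is
    exact in degrees at most n. *)
Definition exp_trunc l n : {poly A} := \sum_(k < n.+1) ifact k *: exp_arg l n ^+ k.

(* The coefficients of exp (l 1 X + l 2 X^2 + ...). *)
Definition expc l n : A := (exp_trunc l n)`_n.

Definition agree n P Q := forall i, (i <= n)%N -> P`_i = Q`_i.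

Lemma agreeM n P P' Q Q' : agree n P P' -> agree n Q Q' -> agree n (P * Q) (P' * Q').
Proof.
move=> hP hQ i iN; rewrite !coefM; apply: eq_bigr => -[j /= ji] _.
rewrite hP ?hQ//; first by rewrite (leq_trans (leq_subr _ _)).
by apply: leq_trans iN.
Qed.

Lemma agree_expr n P Q k : agree n P Q -> agree n (P ^+ k) (Q ^+ k).
Proof.
by move=> h; elim: k => [|k IH]; [rewrite !expr0|rewrite !exprS; apply: agreeM].
Qed.

Lemma exp_argE l n i : (exp_arg l n)`_i = if (0 < i <= n)%N then l i else 0.
Proof. by rewrite coef_poly ltnS; case: i => [|i] /=; rewrite ?if_same. Qed.

Lemma exp_arg_agree l n m : (n <= m)%N -> agree n (exp_arg l m) (exp_arg l n).
Proof. by move=> nm i iN; rewrite !exp_argE iN (leq_trans iN nm). Qed.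

Lemma exp_arg_expr0 l n k i : (i < k)%N -> (exp_arg l n ^+ k)`_i = 0.
Proof.
elim: k i => // k IH i ik; rewrite exprS coefM big1// => -[[|j] /= ji] _.
  by rewrite exp_argE mul0r.
by rewrite IH ?mulr0//; lia.
Qed.

Lemma coef_exp_trunc l n i :
  (exp_trunc l n)`_i = \sum_(k < n.+1) ifact k * (exp_arg l n ^+ k)`_i.
Proof. by rewrite coef_sum; apply: eq_bigr => k _; rewrite coefZ. Qed.

Lemma exp_truncE l n i : (i <= n)%N -> (exp_trunc l n)`_i = expc l i.
Proof.
move=> iN; rewrite /expc !coef_exp_trunc.
rewrite (big_ord_widen n.+1 (fun k => ifact k * (exp_arg l i ^+ k)`_i))//.
rewrite [LHS](bigID (fun k : 'I_n.+1 => (k < i.+1)%N))/= [X in _ + X]big1 ?addr0.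
  by apply: eq_bigr => k _; congr (_ * _); exact: agree_expr (exp_arg_agree l iN) _ (leqnn i).
by move=> k; rewrite ltnS -ltnNge => ik; rewrite exp_arg_expr0 ?mulr0.
Qed.

Lemma expc0 l : expc l 0 = 1.
Proof.
by rewrite /expc coef_exp_trunc big_ord1 /ifact big_ord0 mul1r expr0 coef1.
Qed.

(** The coefficient of X^n in exp(L)' = L' exp(L). *)
Lemma expcS l n :
  n.+1%:R * expc l n.+1 = \sum_(j < n.+1) (j.+1%:R * l j.+1) * expc l (n - j).
Proof.
have -> : n.+1%:R * expc l n.+1 = (exp_trunc l n.+1)^`()`_n.
  by rewrite coef_deriv mulr_natl.
have -> : (exp_trunc l n.+1)^`() =
    (exp_arg l n.+1)^`() * \sum_(k < n.+1) ifact k *: exp_arg l n.+1 ^+ k.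
  rewrite /exp_trunc raddf_sum big_ord_recl/= expr0 derivZ derivC scaler0 add0r.
  rewrite mulr_sumr; apply: eq_bigr => k _.
  rewrite derivZ deriv_exp /bump/= add1n -scaler_nat scalerA ifactS.
  by rewrite -scalerAr.
rewrite coefM; apply: eq_bigr => -[j /= jn] _.
have h1 : (0 < j.+1 <= n.+1)%N by lia.
rewrite coef_deriv exp_argE h1 mulr_natl; congr (_ * _).
rewrite -(@exp_truncE l n.+1); last by lia.
rewrite coef_exp_trunc coef_sum [RHS]big_ord_recr/=.
rewrite [X in _ = _ + X]mulrC exp_arg_expr0 ?mul0r ?addr0; last by lia.
by apply: eq_bigr => k _; rewrite coefZ.
Qed.

Lemma expc_uniq l (e : nat -> A) : e 0 = 1 ->
  (forall n, n.+1%:R * e n.+1 = \sum_(j < n.+1) (j.+1%:R * l j.+1) * e (n - j)%N) ->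
  e =1 expc l.
Proof.
move=> e0 eS n; elim/ltn_ind: n => -[|n] IH; first by rewrite expc0.
apply: (@ivI n); rewrite eS expcS; apply: eq_bigr => -[j /= jn] _.
by rewrite IH//; lia.
Qed.

Section Bound.
Variables (R : realType) (nb : A -> R -> Prop).
Hypothesis nb0 : forall a, 0 <= a -> nb 0 a.
Hypothesis nb1 : nb 1 1.
Hypothesis nbD : forall x y a, nb x a -> nb y a -> nb (x + y) a.
Hypothesis nbM : forall x y a b, nb x a -> nb y b -> nb (x * y) (a * b).
Hypothesis nb_le : forall x a b, nb x a -> a <= b -> nb x b.

Lemma nb_sum (I : Type) (r : seq I) (P : pred I) (F : I -> A) a :
  0 <= a -> (forall i, P i -> nb (F i) a) -> nb (\sum_(i <- r | P i) F i) a.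
Proof.
by move=> a0 h; elim/big_ind: _ => //; [exact: nb0|move=> x y; exact: nbD].
Qed.

(** The term of order k + 1 is at most W^k eps^(k+1) s^n, hence at most eps s^n because eps W <= 1.
    The relation [nb x a] stands for a norm of x being at most a, so that the bound serves for
    coefficients in [K] and for [gbound]. *)
Lemma expc_bound l (W eps s : R) : 0 <= W -> 0 <= eps -> eps * W <= 1 -> 0 <= s ->
  (forall k, nb (ifact k.+1) (W ^+ k)) ->
  (forall j, nb (l j.+1) (eps * s ^+ j.+1)) ->
  forall n, nb (expc l n.+1) (eps * s ^+ n.+1).
Proof.
move=> W0 e0 eW s0 hW hl n.
have s00 m : 0 <= s ^+ m by rewrite exprn_ge0.
have hL m k i : nb (exp_arg l m ^+ k)`_i (eps ^+ k * s ^+ i).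
  elim: k i => [|k IH] i.
    rewrite expr0 coef1; case: eqP => [->|_]; first by rewrite !expr0 mulr1.
    by apply: nb0; rewrite mulr_ge0 ?expr0.
  rewrite exprS coefM; apply: nb_sum; first by rewrite mulr_ge0 ?exprn_ge0.
  move=> [j /= ji] _; rewrite exp_argE; case: ifP => [/andP[j0 _]|_]; last first.
    by rewrite mul0r; apply: nb0; rewrite mulr_ge0 ?exprn_ge0.
  have -> : s ^+ i = s ^+ j * s ^+ (i - j) by rewrite -exprD subnKC.
  rewrite exprS mulrACA; apply: nbM => //.
  by case: j j0 {ji} => // j _.
rewrite /expc coef_exp_trunc big_ord_recl/= expr0 coef1/= mulr0 add0r.
apply: nb_sum; first by rewrite mulr_ge0.
move=> k _; rewrite /bump/= add1n.
apply: (nb_le (nbM (hW k) (hL _ _ _))).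
rewrite mulrA ler_wpM2r// exprSr mulrA -exprMn mulrC ler_piMr//.
by rewrite mulrC exprn_ile1// mulr_ge0.
Qed.

End Bound.
End ExponentialCoefficients.

(** * Binomial coefficients with an integer upper entry *)

Section IntegerBinomials.

(** The eigenvalue of T^i / i! (d/dT)^i on T^n; n may be negative. *)
Definition ibin (n : int) (i : nat) : int := ((\prod_(k < i) (n - k%:Z)) %/ i`!%:Z)%Z.

Lemma prod_shift_dvd (n : int) (i : nat) : (i`!%:Z %| \prod_(k < i) (n - k%:Z))%Z.
Proof.
case: n => n.
  have [ni|ni] := ltnP n i.
    by rewrite (bigD1 (Ordinal ni))//= subrr mul0r dvdz0.
  have -> : \prod_(k < i) (n%:Z - k%:Z) = ('C(n, i) * i`!)%:Z.
    rewrite bin_ffact ffact_prod (big_morph Posz PoszM (erefl 1%:Z)).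
    by apply: eq_bigr => -[k /= ki] _; lia.
  by rewrite PoszM dvdz_mull.
have -> : \prod_(k < i) (Negz n - k%:Z) = (-1) ^+ i * ('C(n + i, i) * i`!)%:Z.
  rewrite bin_ffact ffact_prod (big_morph Posz PoszM (erefl 1%:Z)).
  rewrite -[X in (-1) ^+ X](card_ord i) -prodr_const -big_split/=.
  rewrite (reindex_inj rev_ord_inj)/=; apply: eq_bigr => -[k /= ki] _.
  by lia.
by rewrite PoszM !dvdz_mull.
Qed.

Lemma ibinE n i : ibin n i * i`!%:Z = \prod_(k < i) (n - k%:Z).
Proof. by rewrite /ibin divzK// prod_shift_dvd. Qed.

Lemma ibin0 n : ibin n 0 = 1.
Proof. by have := ibinE n 0; rewrite big_ord0 mulr1. Qed.

Lemma fact_neq0z i : i`!%:Z != 0.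
Proof. by rewrite eqz_nat -lt0n fact_gt0. Qed.

Lemma ibinS n i : i.+1%:Z * ibin n i.+1 = (n - i%:Z) * ibin n i.
Proof.
apply: (mulIf (fact_neq0z i)).
rewrite mulrC mulrA -PoszM mulrC [(_ * i.+1)%N]mulnC -factS ibinE big_ord_recr /=.
by rewrite -ibinE; ring.
Qed.

Lemma ibinnn (n : nat) : ibin n n = 1.
Proof.
apply: (mulIf (fact_neq0z n)); rewrite ibinE mul1r fact_prod.
rewrite big_add1/= big_mkord (big_morph Posz PoszM (erefl 1%:Z)) (reindex_inj rev_ord_inj)/=.
by apply: eq_bigr => -[k /= ki] _; lia.
Qed.

Lemma ibinN (n i : nat) : ibin (- n.+1%:Z) i = (-1) ^+ i * ('C(n + i, i))%:Z.
Proof.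
apply: (mulIf (fact_neq0z i)).
rewrite ibinE -mulrA -PoszM bin_ffact ffact_prod (big_morph Posz PoszM (erefl 1%:Z)).
rewrite -[X in (-1) ^+ X](card_ord i) -prodr_const -big_split/=.
rewrite (reindex_inj rev_ord_inj)/=; apply: eq_bigr => -[k /= ki] _.
by lia.
Qed.

End IntegerBinomials.

(** * Taylor coefficients of solutions *)

Section TaylorCoefficients.
Context {R : realType} {K : completeUltrametricFieldType R}.
Hypothesis natK_neq0 : forall n, n.+1%:R != 0 :> K.
Implicit Types (f g h u : robba K) (P Q : pred int).

Definition inv_succ (A : unitRingType) (k : nat) : A := (k.+1%:R)^-1.

Lemma inv_succK k : inv_succ K k * k.+1%:R = 1.
Proof. by rewrite mulVf. Qed.

Definition rinv k : robba K := robba_const (inv_succ K k).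

Lemma rinvP k : rinv k * k.+1%:R = 1.
Proof. by rewrite /rinv -(rmorph_nat (@robba_const R K)) -rmorphM inv_succK. Qed.

(* If f'/f = g/T then [zt g i] is T^i f^(i)/(i! f), so that the series
   sum_i (zt g i) x^i is f(T(1 + x))/f(T). *)
Fixpoint zt g (i : nat) : robba K :=
  if i is j.+1 then rinv j * (robba_theta (zt g j) + (g - j%:R) * zt g j) else 1.

Lemma ztS g i : i.+1%:R * zt g i.+1 = robba_theta (zt g i) + (g - i%:R) * zt g i.
Proof. by rewrite /= mulrA [_ * rinv i]mulrC rinvP mul1r. Qed.

Lemma zt0 g : zt g 0 = 1.
Proof. by []. Qed.

Lemma zt_succ g i : zt g i.+1 = rinv i * (robba_theta (zt g i) + (g - i%:R) * zt g i).
Proof. by []. Qed.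

#[global] Opaque zt.

Lemma zt1 g : zt g 1 = g.
Proof. by rewrite -[LHS]mul1r (ztS g 0) zt0 robba_theta1 add0r subr0 mulr1. Qed.

Lemma robba_natI k f g : k.+1%:R * f = k.+1%:R * g -> f = g.
Proof. exact: (ivI rinvP). Qed.

Lemma robba_theta_sum (I : Type) (r : seq I) (P : pred I) (F : I -> robba K) :
  robba_theta (\sum_(i <- r | P i) F i) = \sum_(i <- r | P i) robba_theta (F i).
Proof. by apply: (raddf_sum (@robba_theta R K)). Qed.

Lemma robba_theta_nat k f : robba_theta (k%:R * f) = k%:R * robba_theta f.
Proof. by rewrite -(rmorph_nat (@robba_const R K)) robba_thetaZ. Qed.

(** Solutions of a tensor product are products of solutions, so their Taylor series multiply. The
    induction multiplies by [n.+1], split in each term as [i] plus [n.+1 - i], to use the recursion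
    on either factor. *)
Lemma ztD g h n : zt (g + h) n = \sum_(i < n.+1) zt g i * zt h (n - i).
Proof.
elim: n => [|n IH]; first by rewrite big_ord1 !zt0 mulr1.
apply: (@robba_natI n); rewrite ztS IH robba_theta_sum mulr_sumr -big_split/=.
pose F i := i%:R * zt g i * zt h (n.+1 - i).
pose G i := zt g i * ((n.+1 - i)%:R * zt h (n.+1 - i)).
transitivity (\sum_(i < n.+2) F i + \sum_(i < n.+2) G i); last first.
  rewrite -big_split mulr_sumr; apply: eq_bigr => -[i /= iN] _.
  rewrite /F /G; have -> : n.+1%:R = i%:R + (n.+1 - i)%:R :> robba K.
    by rewrite -natrD subnKC.
  by ring.
rewrite [X in _ = X + _]big_ord_recl (_ : F _ = 0) ?add0r; last by rewrite /F mulr0n !mul0r.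
rewrite [X in _ = _ + X]big_ord_recr/= (_ : G _.+1 = 0) ?addr0 -?big_split/=; last first.
  by rewrite /G subnn mulr0n mul0r mulr0.
apply: eq_bigr => -[i /= iN] _.
rewrite /F /G /bump/= add1n subSS ztS subSn// ztS robba_thetaM.
have -> : n%:R = i%:R + (n - i)%:R :> robba K by rewrite -natrD subnKC.
by ring.
Qed.

(* Coefficients of x d/dx log (sum_i (zt g i) x^i), shifted by one. *)
Fixpoint blog g (j : nat) : robba K :=
  if j is i.+1 then rinv i * (robba_theta (blog g i) - i.+1%:R * blog g i) else g.

Lemma blogS g j : j.+1%:R * blog g j.+1 = robba_theta (blog g j) - j.+1%:R * blog g j.
Proof. by rewrite /= mulrA [_ * rinv j]mulrC rinvP mul1r. Qed.

Lemma blog0 g : blog g 0 = g.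
Proof. by []. Qed.

#[global] Opaque blog.

Lemma blog_rec g i : i.+1%:R * zt g i.+1 = \sum_(j < i.+1) blog g j * zt g (i - j).
Proof.
elim: i => [|i IH]; first by rewrite big_ord1 zt0 blog0 mulr1 mul1r zt1.
apply: (@robba_natI i).
have -> : i.+1%:R * (i.+2%:R * zt g i.+2) =
    robba_theta (i.+1%:R * zt g i.+1) + (g - i.+1%:R) * (i.+1%:R * zt g i.+1).
  by rewrite ztS robba_theta_nat; ring.
rewrite IH robba_theta_sum mulr_sumr -big_split/=.
pose F j := j%:R * blog g j * zt g (i.+1 - j).
pose G j := blog g j * ((i.+1 - j)%:R * zt g (i.+1 - j)).
transitivity (\sum_(j < i.+2) F j + \sum_(j < i.+2) G j); last first.
  rewrite -big_split mulr_sumr; apply: eq_bigr => -[j /= jN] _.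
  rewrite /F /G; have -> : i.+1%:R = j%:R + (i.+1 - j)%:R :> robba K.
    by rewrite -natrD subnKC.
  by ring.
rewrite [X in _ = X + _]big_ord_recl (_ : F _ = 0) ?add0r; last by rewrite /F mulr0n !mul0r.
rewrite [X in _ = _ + X]big_ord_recr/= (_ : G _.+1 = 0) ?addr0 -?big_split/=; last first.
  by rewrite /G subnn mulr0n mul0r mulr0.
apply: eq_bigr => -[j /= jN] _.
rewrite /F /G /bump/= add1n subSS subSn// ztS blogS robba_thetaM.
have -> : i.+1%:R = j.+1%:R + (i - j)%:R :> robba K by rewrite -natrD addSn subnKC.
by rewrite -[j.+1]addn1 natrD; ring.
Qed.

Lemma natK_fact_neq0 i : (i`!)%:R != 0 :> K.
Proof. by case: i`! (fact_gt0 i) => // n _; exact: natK_neq0. Qed.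

(** The logarithmic derivative of f(T(1 + x)) in x is g(T(1 + x)) / (1 + x), in which T^n comes with
    (1 + x)^(n - 1). *)
Lemma blog_coef g j n : blog g j n = (ibin (n - 1) j)%:~R * g n.
Proof.
elim: j => [|j IH]; first by rewrite ibin0 blog0 mul1r.
apply: (mulfI (natK_neq0 j)).
rewrite -robba_mulrn blogS rcoefB robba_mulrn rcoef_theta IH.
have -> : j.+1%:R = (j.+1%:Z)%:~R :> K by [].
rewrite !mulrA -!intrM -mulrBl ibinS -intrB -mulrBl.
by congr ((_ * _)%:~R * _); lia.
Qed.

Lemma gbound_blog rho g j a : gbound rho g a -> 0 < rho -> gbound rho (blog g j) a.
Proof.
move=> h r0 n; rewrite blog_coef unormM; apply: le_trans (h n).
by rewrite ler_wpM2r ?exprz_ge0 ?(ltW r0)// ler_piMl ?unorm_ge0 ?unorm_int_le1.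
Qed.

(** The predecessors undo the shift of [blog]: the logarithm has coefficient [blog g (j - 1)]
    divided by j in degree j. *)
Lemma zt_expc g n : zt g n = expc rinv (fun j => rinv j.-1 * blog g j.-1) n.
Proof.
apply: (expc_uniq rinvP) => // i; rewrite blog_rec; apply: eq_bigr => j _ /=.
by rewrite mulrA [_ * rinv j]mulrC rinvP mul1r.
Qed.

Definition rsupp P f := forall n, ~~ P n -> f n = 0.

Lemma rsuppD P f g : rsupp P f -> rsupp P g -> rsupp P (f + g).
Proof. by move=> hf hg n nP; rewrite rcoefD hf// hg// addr0. Qed.

Lemma rsupp_theta P f : rsupp P f -> rsupp P (robba_theta f).
Proof. by move=> hf n nP; rewrite rcoef_theta hf// mulr0. Qed.

Lemma rsuppZ P c f : rsupp P f -> rsupp P (robba_const c * f).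
Proof. by move=> hf n nP; rewrite rcoefZ hf// mulr0. Qed.

Lemma rsuppM P Q (S : pred int) f g : rsupp P f -> rsupp Q g ->
  (forall a b, P a -> Q b -> S (a + b)) -> rsupp S (f * g).
Proof.
move=> hf hg PQ n nS; apply: rcoefM_eq0 => i.
have [Pi|/hf->] := boolP (P i); last by rewrite mul0r.
have [Qi|/hg->] := boolP (Q (n - i)); last by rewrite mulr0.
by have := PQ _ _ Pi Qi; rewrite addrC subrK (negPf nS).
Qed.

Lemma zt_supp P g i : (forall a b, P a -> P b -> P (a + b)) -> rsupp P g ->
  rsupp P (zt g i.+1).
Proof.
move=> hP hg; elim: i => [|i IH]; first by rewrite zt1.
rewrite zt_succ; apply/rsuppZ/rsuppD; first exact: rsupp_theta.
rewrite mulrBl -mulNr -[i.+1%:R](rmorph_nat (@robba_const R K)) -rmorphN.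
by apply: rsuppD; [exact: (rsuppM hg IH hP)|exact: rsuppZ].
Qed.

Definition rintegral f := forall n, unorm (f n) <= 1.

Lemma rintegralM f g : rintegral f -> rintegral g -> rintegral (f * g).
Proof.
move=> hf hg n; apply: rcoefM_le => // i.
by rewrite unormM mulr_ile1 ?unorm_ge0.
Qed.

Lemma rintegral_sum (I : Type) (r : seq I) (P : pred I) (F : I -> robba K) :
  (forall i, P i -> rintegral (F i)) -> rintegral (\sum_(i <- r | P i) F i).
Proof.
move=> h n; rewrite rcoef_sum; elim/big_ind: _ => [|x y|i /h//]; first by rewrite unorm0.
exact: unormD_le.
Qed.

Lemma zt0r i : zt 0 i.+1 = 0.
Proof.
by apply: robba_ext => n; apply: (zt_supp (P := pred0)).
Qed.

Lemma zt_integralD g h : (forall i, rintegral (zt g i)) ->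
  (forall i, rintegral (zt h i)) -> forall i, rintegral (zt (g + h) i).
Proof.
by move=> hg hh i; rewrite ztD; apply: rintegral_sum => j _; apply: rintegralM.
Qed.

(** By [ztD] the series of [- g] is the inverse of the series of [g], whose first coefficient is
    1. *)
Lemma zt_integralN g : (forall i, rintegral (zt g i)) ->
  forall i, rintegral (zt (- g) i).
Proof.
move=> hg i; elim/ltn_ind: i => -[|i] IH; first exact: (hg 0).
have /eqP : zt (g - g) i.+1 = 0 by rewrite subrr zt0r.
rewrite ztD big_ord_recl/= zt0 mul1r subn0.
rewrite addr_eq0 => /eqP -> n; rewrite rcoefN unormN.
apply: rintegral_sum => j _; apply: rintegralM; first exact: hg.
by apply: IH; rewrite /bump/=; lia.
Qed.

(** By induction the mixed terms of [ztD] are integral, hence so is [zt g i + zt h i]. Its two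
    summands have disjoint supports, so no cancellation can occur between them. *)
Lemma zt_integral_split P Q g h :
  (forall a b, P a -> P b -> P (a + b)) -> (forall a b, Q a -> Q b -> Q (a + b)) ->
  (forall a, P a -> ~~ Q a) -> rsupp P g -> rsupp Q h ->
  (forall i, rintegral (zt (g + h) i)) ->
  forall i, rintegral (zt g i) /\ rintegral (zt h i).
Proof.
move=> hP hQ PQ hg hh hgh i; elim/ltn_ind: i => -[|i] IH.
  by split=> n; rewrite zt0 rcoef1; case: eqP; rewrite ?unorm1 ?unorm0.
have int_sum : rintegral (zt g i.+1 + zt h i.+1).
  have -> : zt g i.+1 + zt h i.+1 = zt (g + h) i.+1 -
      \sum_(j < i) zt g j.+1 * zt h (i - j).
    rewrite ztD big_ord_recl big_ord_recr/= subnn !zt0 mulr1 subn0 mul1r.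
    rewrite /bump/= add1n; under [in X in _ = X - _]eq_bigr do rewrite add1n subSS.
    by ring.
  move=> n; rewrite rcoefB unormB_le//; first exact: hgh.
  apply: rintegral_sum => -[j /= ji] _; apply: rintegralM.
    by apply: (IH j.+1 _).1.
  by apply: (IH (i - j)%N _).2; lia.
have sg := zt_supp i hP hg; have sh := zt_supp i hQ hh.
split=> n; have := int_sum n; rewrite rcoefD.
  have [Pn|/sg->] := boolP (P n); last by rewrite unorm0 ler01.
  by rewrite (sh _ (PQ _ Pn)) addr0.
have [Pn|/sg->] := boolP (P n); last by rewrite add0r.
by rewrite (sh _ (PQ _ Pn)) unorm0 ler01.
Qed.

(** Where theta u = g u holds, [zt g i * u] is T^i u^(i) / i!, which acts on T^n by a binomial
    coefficient. [Q] contains the degrees of the error; being stable under adding degrees from [P],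
    it contains everything the error can affect. *)
Lemma zt_solution P Q g u : (forall a b, P a -> P b -> P (a + b)) -> P 0 ->
  (forall a b, P a -> Q b -> Q (a + b)) -> rsupp P g ->
  rsupp Q (robba_theta u - g * u) ->
  forall i n, ~~ Q n -> (zt g i * u) n = (ibin n i)%:~R * u n.
Proof.
move=> hP P0 PQ hg hu i n nQ; elim: i => [|i IH]; first by rewrite zt0 mul1r ibin0 mul1r.
apply: (mulfI (natK_neq0 i)); rewrite -robba_mulrn mulrA ztS.
have -> : (robba_theta (zt g i) + (g - i%:R) * zt g i) * u =
    robba_theta (zt g i * u) - i%:R * (zt g i * u) - zt g i * (robba_theta u - g * u).
  by rewrite robba_thetaM; ring.
rewrite rcoefB (_ : (zt g i * (robba_theta u - g * u)) n = 0); last first.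
  apply: (rsuppM _ hu PQ) nQ; case: i {IH} => [|i]; last exact: zt_supp.
  by move=> m; rewrite zt0 rcoef1; case: eqP => // ->; rewrite P0.
rewrite subr0 rcoefB rcoef_theta robba_mulrn IH.
have natE k : k%:R = (k%:Z)%:~R :> K by [].
by rewrite !natE !mulrA -!intrM ibinS -mulrBl -intrB -mulrBl.
Qed.

Lemma zt_solution_exact g u : robba_theta u = g * u ->
  forall i n, (zt g i * u) n = (ibin n i)%:~R * u n.
Proof.
move=> hu i n; apply: (@zt_solution predT pred0) => //.
by move=> m _; rewrite hu subrr.
Qed.

End TaylorCoefficients.

(** * Valuations of factorials *)

Section Legendre.
Variable p : nat.
Hypothesis p_prime : prime p.

Lemma logn_fact_rec n : logn p n`! = (n %/ p + logn p (n %/ p)`!)%N.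
Proof.
have p1 := prime_gt1 p_prime.
rewrite !logn_fact//; case: n => [|n]; first by rewrite div0n !big_geq.
rewrite big_ltn// expn1; congr addn.
rewrite big_add1/=.
have qn : (n.+1 %/ p <= n)%N by rewrite -ltnS ltn_Pdiv.
rewrite (@big_cat_nat _ _ _ (n.+1 %/ p).+1)//= [X in (_ + X)%N]big_nat_cond.
rewrite [X in (_ + X)%N]big1 ?addn0; last first.
  move=> k /andP[/andP[qk _] _]; rewrite expnS divnMA divn_small//.
  by rewrite (leq_trans qk)// ltnW// ltn_expl.
by apply: eq_bigr => k _; rewrite expnS divnMA.
Qed.

Lemma logn_fact_upper n : (p.-1 * logn p n.+1`! <= n)%N.
Proof.
have p1 := prime_gt1 p_prime.
elim/ltn_ind: n => n IH; rewrite logn_fact_rec.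
have := divn_eq n.+1 p; case E: (n.+1 %/ p)%N => [|q] nE; first by rewrite fact0 logn1 muln0.
have /IH : (q < n)%N by rewrite -ltnS -E ltn_Pdiv.
by nia.
Qed.

Lemma logn_upper n : (p.-1 * logn p n.+1 <= n)%N.
Proof.
apply: leq_trans (logn_fact_upper n); rewrite leq_pmul2l; last first.
  by have := prime_gt1 p_prime; lia.
by rewrite factS lognM ?fact_gt0// leq_addr.
Qed.

End Legendre.

(** * Norms of integers and factorials, and the constant omega *)

Section PadicNorm.
Context {R : realType} {K : completeUltrametricFieldType R}.
Variable p : nat.
Hypothesis p_prime : prime p.
Hypothesis K_padic : contains_Qp p K.

Let p_gt1 : (1 < p)%N. Proof. exact: prime_gt1. Qed.
Let p1_gt0 : (0 < p.-1)%N. Proof. by rewrite -subn1 subn_gt0. Qed.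

Lemma unorm_nat n : (0 < n)%N -> unorm (n%:R : K) = (p%:R^-1) ^+ logn p n.
Proof.
move=> n0.
have -> : n%:R = ratr n%:R :> K by rewrite ratr_nat.
rewrite K_padic /padic_abs pnatr_eq0 (gtn_eqF n0).
have -> : n%:R = (n%:Z)%:~R :> rat by [].
by rewrite numq_int denq_int/= logn1 sub0r exprVn exprnN.
Qed.

Lemma natK_neq0 n : n.+1%:R != 0 :> K.
Proof.
rewrite -unorm_eq0 unorm_nat// expf_neq0// invr_eq0 pnatr_eq0.
by case: p p_gt1.
Qed.

Lemma unorm_p : unorm (p%:R : K) = p%:R^-1.
Proof. by rewrite unorm_nat ?prime_gt0// logn_prime// eqxx expr1. Qed.

Lemma unorm_p_gt0 : 0 < unorm (p%:R : K).
Proof. by rewrite unorm_p invr_gt0 ltr0n prime_gt0. Qed.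

Lemma unorm_p_lt1 : unorm (p%:R : K) < 1.
Proof. by rewrite unorm_p invf_lt1 ?ltr1n// ltr0n prime_gt0. Qed.

Lemma unorm_nat_p n : (0 < n)%N -> unorm (n%:R : K) = unorm (p%:R : K) ^+ logn p n.
Proof. by move=> n0; rewrite unorm_nat// unorm_p. Qed.

Lemma unorm_natV n : (0 < n)%N -> unorm (n%:R^-1 : K) <= n%:R.
Proof.
move=> n0; rewrite unormV unorm_nat// exprVn invrK -natrX ler_nat.
by rewrite dvdn_leq// pfactor_dvdnn.
Qed.

Let w := @omega R K p.

Lemma omega_gt0 : 0 < w.
Proof. exact: powR_gt0 unorm_p_gt0. Qed.

Lemma omegaX : w ^+ p.-1 = unorm (p%:R : K).
Proof.
rewrite -powR_mulrn ?(ltW omega_gt0)// /w /omega -powRrM mulVf ?pnatr_eq0 -?lt0n//.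
by rewrite powRr1// unorm_ge0.
Qed.

Lemma omega_lt1 : w < 1.
Proof.
have := unorm_p_lt1; rewrite -omegaX => h.
rewrite ltNge; apply/negP => w1.
by have := exprn_ege1 p.-1 w1; rewrite leNgt h.
Qed.

Lemma p_lt_omega : (2 < p)%N -> unorm (p%:R : K) < w.
Proof.
move=> p2; rewrite -omegaX -[ltRHS]expr1 ltr_iXn2l ?omega_gt0 ?omega_lt1//.
by rewrite -subn1 ltn_subRL.
Qed.

Lemma fact_norm_lower k : w ^+ k <= unorm ((k.+1`!)%:R : K).
Proof.
rewrite unorm_nat_p ?fact_gt0// -omegaX -exprM ler_wiXn2l//.
- exact: ltW omega_gt0.
- exact: ltW omega_lt1.
- exact: logn_fact_upper.
Qed.

(** Matches [fact_norm_lower] up to a factor linear in k, which disappears in k-th roots. Replacing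
    k + 1 by its quotient q by p costs the factor p omega^r >= 1 of the remainder r, and p q <= k +
    1 keeps the linear factor under control. *)
Lemma fact_norm_upper k : unorm ((k.+1`!)%:R : K) <= p%:R * k.+1%:R * w ^+ k.+1.
Proof.
have w0 := omega_gt0; have w1 := omega_lt1.
have p0 : 0 < p%:R :> R by rewrite ltr0n prime_gt0.
(* For r <= p - 1 one has w^r >= w^(p-1) = |p| = 1/p. *)
have wr r : (r < p)%N -> 1 <= p%:R * w ^+ r.
  move=> rp; rewrite -ler_pdivrMl// mulr1 -unorm_p -omegaX.
  by rewrite ler_wiXn2l ?(ltW w0) ?(ltW w1)//; lia.
elim/ltn_ind: k => k IH.
have kE := divn_eq k.+1 p; have rp := ltn_pmod k.+1 (prime_gt0 p_prime).
rewrite unorm_nat_p ?fact_gt0// logn_fact_rec// exprD.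
rewrite -unorm_nat_p ?fact_gt0// -omegaX -exprM.
case E: (k.+1 %/ p)%N kE => [|q] kE.
  rewrite muln0 expr0 mul1r fact0 unorm1 mulrAC.
  have := wr _ rp; rewrite {1}(_ : (k.+1 %% p = k.+1)%N); last by lia.
  move=> h; apply: (le_trans h); rewrite ler_peMr ?mulr_ge0 ?exprn_ge0 ?(ltW w0) ?(ltW p0)//.
  by rewrite ler1n.
have /IH h : (q < k)%N by rewrite -ltnS -E ltn_Pdiv.
apply: (@le_trans _ _ (w ^+ (p.-1 * q.+1) * (p%:R * q.+1%:R * w ^+ q.+1))).
  by rewrite ler_wpM2l// exprn_ge0// ltW.
rewrite {2}kE exprD (_ : (q.+1 * p = p.-1 * q.+1 + q.+1)%N); last by nia.
rewrite exprD.
set A := w ^+ _; set B := w ^+ q.+1; set r := (k.+1 %% p)%N.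
have A0 : 0 <= A by rewrite exprn_ge0// ltW.
have B0 : 0 <= B by rewrite exprn_ge0// ltW.
have qk : p%:R * q.+1%:R <= k.+1%:R :> R.
  by rewrite -natrM ler_nat kE mulnC leq_addr.
have -> : A * (p%:R * q.+1%:R * B) = (p%:R * q.+1%:R) * 1 * (A * B) by ring.
have -> : p%:R * k.+1%:R * (A * B * w ^+ r) = k.+1%:R * (p%:R * w ^+ r) * (A * B) by ring.
rewrite ler_wpM2r ?mulr_ge0//; apply: ler_pM; rewrite ?mulr_ge0 ?(ltW p0)//.
exact: wr.
Qed.

Hypothesis K_unram : unramified p K.

(** The gap in the value group between |p| and 1, through which [unramified] enters the proof. *)
Lemma unorm_lt1_le (x : K) : unorm x < 1 -> unorm x <= unorm (p%:R : K).
Proof.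
have [->|x0] := eqVneq x 0; first by rewrite unorm0 unorm_ge0.
case: K_unram => _ _ /(_ x x0)[[n|n] ->].
  case: n => [|n]; first by rewrite expr0z ltxx.
  move=> _; rewrite -exprnP exprS ler_piMr ?unorm_ge0 ?exprn_ile1 ?unorm_ge0//.
  exact: ltW unorm_p_lt1.
rewrite NegzE -exprnN ltNge invf_ge1 ?exprn_gt0 ?unorm_p_gt0//.
by rewrite exprn_ile1 ?unorm_ge0// ltW ?unorm_p_lt1.
Qed.

End PadicNorm.

(** * Dominant terms of Cauchy products *)

Lemma seq_max_rel (T : eqType) (le : rel T) (x0 : T) (s : seq T) :
  total le -> transitive le -> x0 \in s ->
  exists2 x, x \in s & forall y, y \in s -> le y x.
Proof.
move=> tot tr; elim: s x0 => // a s IH x0 _.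
case: s IH => [_|b s IH].
  by exists a; rewrite ?mem_head// => y; rewrite inE => /eqP ->; have := tot a a; rewrite orbb.
have [x xs hx] := IH b (mem_head _ _).
have [ax|xa] := orP (tot a x).
  by by exists x; [rewrite in_cons xs orbT|move=> y /predU1P[->|/hx]].
exists a; rewrite ?mem_head// => y /predU1P[->|/hx yx]; last exact: tr yx xa.
by have := tot a a; rewrite orbb.
Qed.

Section Dominance.
Context {R : realType} {K : completeUltrametricFieldType R}.
Implicit Types (u v : nat -> robba K) (M C th : R) (s : bool).

Lemma unorm_close (x y : K) : unorm (x - y) < unorm y -> unorm x = unorm y.
Proof.
move=> h; apply/eqP; rewrite eq_le; apply/andP; split.
  by rewrite -[x](subrK y) unormD_le// ltW.
rewrite leNgt; apply/negP => xy.
have := unorm_leB x (x - y); rewrite opprB addrC subrK => h1.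
by have := le_lt_trans h1 (_ : Num.max _ _ < unorm y); rewrite gt_max xy h ltxx => /(_ isT).
Qed.

Lemma unorm_sum_lt (I : Type) (r : seq I) (P : pred I) (F : I -> K) (e : R) : 0 < e ->
  (forall i, P i -> unorm (F i) < e) -> unorm (\sum_(i <- r | P i) F i) < e.
Proof.
move=> e0 h; elim/big_ind: _ => [|x y xe ye|//]; first by rewrite unorm0.
by apply: le_lt_trans (unorm_leD _ _) _; rewrite gt_max xe.
Qed.

Lemma rcoefM_lt (f g : robba K) (n : int) (e : R) : 0 < e ->
  (forall i, unorm (f i * g (n - i)) < e) -> unorm ((f * g) n) < e.
Proof.
move=> e0 h.
have [d /andP[d0 de] hd] := vanishing_lt_le e0 (vanishing_conv n (robbaP f) (robbaP g)) h.
by apply: le_lt_trans de; apply: rcoefM_le.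
Qed.

Definition lexlt s (i j : nat) (n m : int) :=
  (i < j)%N || (i == j) && (if s then n < m else m < n).

(** The order is compatible with addition, so a pair of indices whose sum exceeds the sum of two
    maximal ones must exceed one of them. *)
Lemma lexlt_add s i j k l (a b c d : int) : lexlt s (i + j) (k + l) (a + b) (c + d) ->
  lexlt s i k a c \/ lexlt s j l b d.
Proof. by rewrite /lexlt; case: s; lia. Qed.

Variables (rho r : R).
Hypotheses (rho0 : 0 < rho) (r0 : 0 < r).

Definition wnorm u (i : nat) (n : int) : R := unorm (u i n) * rho ^ n * r ^+ i.

Lemma wnorm_ge0 u i n : 0 <= wnorm u i n.
Proof. by rewrite /wnorm !mulr_ge0 ?unorm_ge0 ?exprz_ge0 ?exprn_ge0 ?ltW. Qed.

(* M is the largest weighted norm of a coefficient of the double series u, and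
   (i0, n0) is the lexicographically last index where it is attained; the order
   of the second index is reversed when s is false. *)
Definition dominated s u M i0 n0 :=
  [/\ forall i n, wnorm u i n <= M, wnorm u i0 n0 = M &
      forall i n, lexlt s i0 i n0 n -> wnorm u i n < M].

Definition cauchy u v k : robba K := \sum_(i < k.+1) u i * v (k - i)%N.

Lemma wnorm_mul u v (i j : nat) (a b : int) :
  unorm (u i a * v j b) * (rho ^ (a + b) * r ^+ (i + j)) = wnorm u i a * wnorm v j b.
Proof. by rewrite /wnorm unormM expfzDr ?gt_eqF// exprD; ring. Qed.

Lemma wnorm_term u v (i k : nat) (a n : int) : (i <= k)%N ->
  unorm (u i a * v (k - i)%N (n - a)) * (rho ^ n * r ^+ k) =
  wnorm u i a * wnorm v (k - i) (n - a).
Proof.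
move=> ik; by rewrite -wnorm_mul subrKC subnKC.
Qed.

(** Gauss's lemma with a tie-break. Among the products contributing to the index
    [(i0 + j0, n0 + m0)], every one but the product of the two dominant terms involves an index
    beyond a dominant one, hence has weight below [M * M']. *)
Lemma dominated_cauchy s u v M M' i0 n0 j0 m0 : 0 < M -> 0 < M' ->
  dominated s u M i0 n0 -> dominated s v M' j0 m0 ->
  dominated s (cauchy u v) (M * M') (i0 + j0) (n0 + m0).
Proof.
move=> M0 M'0 [u1 u2 u3] [v1 v2 v3].
have wp n k : 0 < rho ^ n * r ^+ k by rewrite mulr_gt0 ?exprz_gt0 ?exprn_gt0.
have MM : 0 < M * M' by rewrite mulr_gt0.
have le_term i j a b : wnorm u i a * wnorm v j b <= M * M'.
  by apply: ler_pM; rewrite ?wnorm_ge0.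
have lt_term i j a b : lexlt s i0 i n0 a \/ lexlt s j0 j m0 b ->
    wnorm u i a * wnorm v j b < M * M'.
  move=> [/u3 h|/v3 h].
    apply: (@le_lt_trans _ _ (wnorm u i a * M')); first by rewrite ler_wpM2l ?wnorm_ge0.
    by rewrite ltr_pM2r.
  apply: (@le_lt_trans _ _ (M * wnorm v j b)); first by rewrite ler_wpM2r ?wnorm_ge0.
  by rewrite ltr_pM2l.
have lt_prod i k n : (i <= k)%N ->
    (forall a, wnorm u i a * wnorm v (k - i) (n - a) < M * M') ->
    unorm ((u i * v (k - i)%N) n) < M * M' / (rho ^ n * r ^+ k).
  move=> ik h; apply: rcoefM_lt; first by rewrite divr_gt0.
  by move=> a; rewrite ltr_pdivlMr// wnorm_term.
split.
- move=> k n; rewrite /wnorm -mulrA -ler_pdivlMr// /cauchy rcoef_sum.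
  apply: unorm_sum_le => [|[i /= ik] _ _]; first by rewrite divr_ge0 ?ltW.
  apply: rcoefM_le => [|a]; first by rewrite divr_ge0 ?ltW.
  by rewrite ler_pdivlMr// wnorm_term.
- have ik : (i0 < (i0 + j0).+1)%N by rewrite ltnS leq_addr.
  pose x := u i0 n0 * v j0 m0.
  have xE : unorm x * (rho ^ (n0 + m0) * r ^+ (i0 + j0)) = M * M'.
    by rewrite wnorm_mul u2 v2.
  rewrite /wnorm -mulrA -xE; congr (_ * _).
  have xE' : unorm x = M * M' / (rho ^ (n0 + m0) * r ^+ (i0 + j0)).
    by rewrite -xE mulfK// gt_eqF.
  apply: unorm_close; rewrite /cauchy rcoef_sum (bigD1 (Ordinal ik))//.
  rewrite [nat_of_ord (Ordinal ik)]/= addrAC addKn.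
  apply: le_lt_trans (unorm_leD _ _) _; rewrite gt_max; apply/andP; split.
    have mE : n0 + m0 - n0 = m0 by rewrite addrC addKr.
    have := @rcoefM_close_lt _ _ (u i0) (v j0) (n0 + m0) n0 (unorm x).
    rewrite mE; apply; first by rewrite xE' divr_gt0.
    move=> a an; rewrite xE' ltr_pdivlMr//.
    have := wnorm_mul u v i0 j0 a (n0 + m0 - a); rewrite subrKC => ->.
    apply: lt_term.
    by rewrite /lexlt; case: (s); lia.
  rewrite xE'; apply: unorm_sum_lt; first by rewrite divr_gt0.
  move=> [i /= ij]; rewrite -val_eqE/= => ii0; apply: lt_prod; first by rewrite -ltnS.
  by move=> a; apply: lt_term; rewrite /lexlt; lia.
- move=> k n kn; rewrite /wnorm -mulrA -ltr_pdivlMr// /cauchy rcoef_sum.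
  apply: unorm_sum_lt => [|[i /= ik] _]; first by rewrite divr_gt0.
  apply: lt_prod => [|a]; first by rewrite -ltnS.
  apply/lt_term/lexlt_add; rewrite subnKC; last by rewrite -ltnS.
  by rewrite [a + _]addrC subrK.
Qed.

Lemma dominated_exists s u C th i1 n1 : 0 <= C -> 0 < th < 1 ->
  (forall i n, wnorm u i n <= C * th ^+ (i + `|n|)) -> u i1 n1 != 0 ->
  exists M i0 n0, 0 < M /\ dominated s u M i0 n0.
Proof.
move=> C0 th01 hC un0.
have w0 : 0 < wnorm u i1 n1.
  by rewrite /wnorm !mulr_gt0 ?exprz_gt0 ?exprn_gt0// lt_def unorm_eq0 un0 unorm_ge0.
have [|N hN] := geo_small C0 th01 (e := wnorm u i1 n1 / 2); first lra.
have small i n : (N <= i + `|n|)%N -> wnorm u i n < wnorm u i1 n1.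
  by move=> h; apply: le_lt_trans (hC i n) _; apply: le_lt_trans (hN _ h) _; lra.
pose L := [seq (i, n) | i <- iota 0 N.+1, n <- enum_fset (int_ball N)] : seq (nat * int).
have inL i n : (i + `|n| <= N)%N -> (i, n) \in L.
  move=> h; apply/allpairsP; exists (i, n); split; [|have := in_int_ball N n|by []].
    by rewrite mem_iota [fst _]/=; lia.
  by move=> hn; change (n \in int_ball N); rewrite hn; lia.
pose W (x : nat * int) := wnorm u x.1 x.2.
(* Only indices in the box [L] can compete with [(i1, n1)]; they are ordered by weight, ties being
   broken by [lexlt]. *)
pose le : rel (nat * int) := fun x y => (W x < W y) || (W x == W y) &&
  ((x == y) || lexlt s x.1 y.1 x.2 y.2).
have le_tot : total le.
  move=> [i n] [j m]; rewrite /le; have [//|//|_] := ltgtP (W (i, n)) (W (j, m)).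
  by rewrite /= /lexlt -!pair_eqE/=; case: (s); lia.
have le_tr : transitive le.
  move=> [i n] [j m] [k l] /orP[h1|/andP[/eqP h1 h1']] /orP[h2|/andP[/eqP h2 h2']].
  - by rewrite /le (lt_trans h1 h2).
  - by rewrite /le -h2 h1.
  - by rewrite /le h1 h2.
  - rewrite /le h1 h2 eqxx ltxx /=; move: h1' h2'.
    by rewrite /lexlt -!pair_eqE/=; case: (s); lia.
have hL : (i1, n1) \in L.
  by apply: inL; rewrite leqNgt; apply/negP => /ltnW /small; rewrite ltxx.
have [[i0 n0] _ h0] := seq_max_rel le_tot le_tr hL.
have W1 : wnorm u i1 n1 <= wnorm u i0 n0.
  by have /orP[/ltW//|/andP[/eqP + _]] := h0 _ hL; rewrite /W/= => ->.
exists (wnorm u i0 n0), i0, n0; split; first exact: lt_le_trans W1.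
split=> // i n.
- have [h|h] := leqP (i + `|n|) N.
    by have /orP[/ltW//|/andP[/eqP + _]] := h0 _ (inL _ _ h); rewrite /W/= => ->.
  by apply/ltW/(lt_le_trans _ W1)/small/ltnW.
- move=> hlt; have [h|h] := leqP (i + `|n|) N.
    have /orP[//|/andP[_]] := h0 _ (inL _ _ h).
    by move: hlt; rewrite /lexlt -!pair_eqE/=; case: (s); lia.
  by apply/(lt_le_trans _ W1)/small/ltnW.
Qed.

End Dominance.

(** * Solvability and integrality *)

Section LimSup.
Context {R : realType}.
Implicit Types (u : nat -> \bar R) (c : \bar R).

Lemma limn_esup_lt u c : (limn_esup u < c)%E ->
  exists N, forall n, (N <= n)%N -> (u n < c)%E.
Proof.
rewrite /limn_esup /limf_esup => /ereal_inf_lt[_ [A [N _ NA] <-] Ac].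
exists N => n Nn; apply: le_lt_trans Ac; apply: ereal_sup_ubound.
by exists n => //; exact: NA.
Qed.

Lemma limn_esup_le u c : (exists N, forall n, (N <= n)%N -> (u n <= c)%E) ->
  (limn_esup u <= c)%E.
Proof.
move=> [N hN]; rewrite /limn_esup /limf_esup.
apply: (@le_trans _ _ (ereal_sup [set u n | n in [set n | (N <= n)%N]])).
  by apply: ereal_inf_lbound; exists [set n | (N <= n)%N] => //; exists N.
by apply: ge_ereal_sup => _ [n /= /hN h <-].
Qed.

Lemma limn_esup_ge0 u : (forall n, (0 <= u n)%E) -> (0 <= limn_esup u)%E.
Proof.
move=> u0; rewrite leNgt; apply/negP => /limn_esup_lt[N /(_ N (leqnn _))].
by rewrite ltNge u0.
Qed.

End LimSup.

Section GeometricBounds.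
Context {R : realType}.
Implicit Types (th s B : R).

Lemma nat_geo th : 0 < th < 1 -> exists2 B, 0 <= B & forall n, n%:R * th ^+ n <= B.
Proof.
move=> /andP[t0 t1]; pose h := th^-1 - 1.
have h0 : 0 < h by rewrite subr_gt0 invf_gt1.
exists h^-1; first by rewrite invr_ge0 ltW.
move=> n; have th0 : 0 < th ^+ n by rewrite exprn_gt0.
rewrite -ler_pdivlMr// -exprVn ler_pdivlMl// mulrC.
have -> : th^-1 = 1 + h by rewrite /h addrC subrK.
elim: n {th0} => [|n IH]; first by rewrite mul0r expr0.
have := exprn_ege1 n (_ : 1 <= 1 + h); rewrite lerDl (ltW h0) => /(_ isT) h1.
set X := (1 + h) ^+ n in IH h1 *.
have -> : (1 + h) ^+ n.+1 = X + X * h by rewrite exprSr mulrDr mulr1.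
rewrite -addn1 natrD mulrDl mul1r lerD//.
by rewrite ler_peMl// ltW.
Qed.

Lemma nat_geo_shift th : 0 < th < 1 -> exists B s,
  [/\ 0 <= B, th < s < 1 & forall n, n%:R * th ^+ n <= B * s ^+ n].
Proof.
move=> /andP[t0 t1]; pose s := (th + 1) / 2.
have s01 : th < s < 1 by rewrite /s; lra.
have s0 : 0 < s by lra.
have [|B B0 hB] := @nat_geo (th / s).
  by rewrite divr_gt0// ltr_pdivrMr// mul1r; lra.
exists B, s; split=> // n; have := hB n.
by rewrite expr_div_n mulrA ler_pdivrMr// exprn_gt0.
Qed.

End GeometricBounds.

Section SolvableGrowth.
Context {R : realType} {K : completeUltrametricFieldType R}.
Variable p : nat.
Hypothesis p_prime : prime p.
Hypothesis K_padic : contains_Qp p K.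
Implicit Types (g : robba K) (rho eta : R).

Let natK := natK_neq0 p_prime K_padic.
Let w := @omega R K p.

Lemma robba_derivE (f : robba K) : robba_deriv f = robba_monom 1 (- 1) * robba_theta f.
Proof. by rewrite /robba_theta mulrA robba_monomM mulr1 addNr mul1r. Qed.

Lemma giter_zt g i : giter g i = robba_monom (i`!)%:R (- i%:Z) * zt g i.
Proof.
elim: i => [|i IH]; first by rewrite zt0 mulr1 fact0.
rewrite [giter _ _]/= IH robba_derivE robba_thetaM robba_theta_monom /g1.
have -> : robba_monom (i.+1`!%:R : K) (- i.+1%:Z) =
    robba_monom 1 (- 1) * robba_monom (i`!)%:R (- i%:Z) * i.+1%:R.
  rewrite robba_monomM mul1r -(rmorph_nat (@robba_const R K)) robba_monomM factS.
  by rewrite mulnC natrM addr0; congr robba_monom; lia.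
rewrite -[RHS]mulrA (ztS natK).
have -> : robba_const (- i%:Z)%:~R = - i%:R :> robba K.
  by rewrite intrN rmorphN (rmorph_nat (@robba_const R K)).
by ring.
Qed.

Lemma giter_coef g i n : giter g i n = (i`!)%:R * zt g i (n + i%:Z).
Proof. by rewrite giter_zt rcoef_monomM opprK. Qed.

Lemma gauss_norm_ge0 (f : int -> K) rho : 0 < rho -> (0 <= gauss_norm f rho)%E.
Proof.
move=> r0; apply: (@le_trans _ _ (unorm (f 0) * rho ^ (0 : int))%:E).
  by rewrite lee_fin mulr_ge0 ?unorm_ge0 ?exprz_ge0 ?ltW.
by apply: ereal_sup_ubound; exists 0.
Qed.

Lemma gauss_norm_le (f : int -> K) rho (c : R) :
  (gauss_norm f rho <= c%:E)%E <-> forall n, unorm (f n) * rho ^ n <= c.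
Proof.
split=> [h n|h]; last by apply: ge_ereal_sup => _ [n _ <-]; rewrite lee_fin.
by rewrite -lee_fin (le_trans _ h)//; apply: ereal_sup_ubound; exists n.
Qed.

Lemma gbound_zt g rho a i : 0 < rho -> gbound rho g a -> exists c, gbound rho (zt g i) c.
Proof.
move=> r0 hg; elim: i => [|i [c hc]]; first by exists 1; rewrite zt0; exact: gbound1.
have c0 := gbound_ge0 r0 hc.
pose b := Num.max a 1.
have gb : gbound rho (g - i%:R) b.
  apply: gboundD => //; first by apply: gbound_le hg _; rewrite le_max lexx.
  apply: gboundN => n; rewrite -(rmorph_nat (@robba_const R K)) rcoef_monom.
  case: eqP => [->|_]; rewrite ?expr0z ?mulr1 ?mulr0n ?unorm0 ?mul0r le_max ?ler01 ?orbT//.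
  by rewrite mulr1n unorm_nat_le1 orbT.
exists (unorm (inv_succ K i) * Num.max c (b * c)).
rewrite zt_succ; apply/gboundZ/gboundD => //.
  by apply: gbound_le (gbound_theta r0 hc) _; rewrite le_max lexx.
by apply: gbound_le (gboundM r0 gb hc) _; rewrite le_max lexx orbT.
Qed.

Lemma robba_radius g : exists2 e : R, 0 < e < 1 &
  forall rho, 1 - e < rho < 1 -> exists a, gbound rho g a.
Proof. by have /is_robbaP := robbaP g. Qed.

Lemma near1_left (P : R -> Prop) : (\forall rho \near 1^'-, P rho) ->
  exists2 d : R, 0 < d < 1 & forall rho, 1 - d < rho < 1 -> P rho.
Proof.
move=> [e /= e0 he]; exists (Num.min e (1 / 2)).
  by rewrite lt_min gt_min e0/=; apply/andP; split; [lra|apply/orP; right; lra].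
move=> rho /andP[h1 h2]; apply: he => //=.
have : Num.min e (1 / 2) <= e by rewrite ge_min lexx.
by rewrite ger0_norm; lra.
Qed.

(** A radius above eta says that |i! z_i|_rho rho^-i is at most (omega / eta)^i for large i, and
    |i!| >= omega^(i-1) turns this into a bound by eta^-i for z_i. The finitely many other indices
    go into [C]. *)
Lemma solvable_growth g eta : solvable_op p g -> 0 < eta < 1 ->
  exists2 d, 0 < d < 1 & forall rho, 1 - d < rho < 1 ->
    exists2 C, 0 <= C & forall i, gbound rho (zt g i) (C * eta^-1 ^+ i).
Proof.
move=> hs /andP[eta0 eta1].
have w0 : 0 < w by exact: omega_gt0 p_prime K_padic.
have hray : \forall rho \near 1^'-, (eta%:E < ray p g rho)%E.
  suff /hs : nbhs 1%:E [set y | (eta%:E < y)%E] by [].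
  by apply: open_nbhs_nbhs; split; [exact: open_ereal_gt_ereal|rewrite /= lte_fin].
have [d1 d101 hd1] := near1_left hray; have [d2 d201 hd2] := robba_radius g.
have m1 : Num.min d1 d2 <= d1 by rewrite ge_min lexx.
have m2 : Num.min d1 d2 <= d2 by rewrite ge_min lexx orbT.
exists (Num.min d1 d2).
  by apply/andP; split; [rewrite lt_min; lra|lra].
move=> rho rho1; have rho0 : 0 < rho by lra.
have [a ha] := hd2 rho ltac:(lra).
have := hd1 rho ltac:(lra); rewrite /ray lt_min => /andP[_].
set u := fun i => _; set L := limn_esup u => hL.
have u0 n : (0 <= u n)%E by apply: poweR_ge0.
have L0 : (0 <= L)%E by exact: limn_esup_ge0.
(* If L = 0, its inverse +oo is harmless; if L = +oo, its inverse 0 contradicts [hL]. *)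
have : (L < (w / eta)%:E)%E.
  move: hL L0; case: (inveP L) => //.
  - by move=> _ _; rewrite lte_fin divr_gt0.
  - by rewrite mule0 lte_fin => h; move: eta0; rewrite ltNge (ltW h).
  - move=> l l0; rewrite -EFinM !lte_fin lee_fin => h lge.
    have lgt : 0 < l by rewrite lt_def l0.
    by rewrite ltr_pdivlMr// mulrC -ltr_pdivlMr.
move=> /limn_esup_lt[N hN].
have bigN i : (N.+1 <= i)%N -> gbound rho (zt g i) (eta^-1 ^+ i).
  case: i => // i Ni.
  have := hN _ (ltnW Ni); rewrite /u => hG.
  have : (gauss_norm (giter g i.+1) rho <= ((w / eta) ^+ i.+1)%:E)%E.
    move: hG; have := gauss_norm_ge0 (giter g i.+1) rho0.
    case: (gauss_norm _ _) => [G| |]//=; last by rewrite ?invr_eq0 ?pnatr_eq0.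
    rewrite lte_fin !lee_fin => G0 hG.
    rewrite -[G](@powRr1 _ G)// -(mulVf (_ : i.+1%:R != 0 :> R)) ?pnatr_eq0//.
    rewrite powRrM powR_mulrn ?powR_ge0// lerXn2r ?nnegrE ?powR_ge0//.
      by rewrite divr_ge0 ?ltW.
    exact: ltW.
  move=> /gauss_norm_le h n.
  have fi := fact_norm_lower p_prime K_padic i.
  have := h (n - i.+1%:Z); rewrite giter_coef subrK unormM => {}h.
  move: fi; rewrite -/w; set x := unorm (_ : K) => fi.
  have -> : rho ^ n = rho ^ (n - i.+1%:Z) * rho ^+ i.+1.
    by rewrite exprnP -expfzDr ?gt_eqF// subrK.
  have r1 : rho ^+ i.+1 <= 1 by rewrite exprn_ile1//; lra.
  have w1 : w < 1 by exact: omega_lt1 p_prime K_padic.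
  have wi : 0 < w ^+ i by rewrite exprn_gt0.
  have A0 : 0 <= unorm (zt g i.+1 n) * rho ^ (n - i.+1%:Z).
    by rewrite mulr_ge0 ?unorm_ge0 ?exprz_ge0 ?ltW.
  rewrite mulrA; apply: le_trans (ler_piMr A0 r1) _.
  rewrite -(ler_pM2l wi); apply: (@le_trans _ _ ((w / eta) ^+ i.+1)).
    by apply: le_trans h; rewrite -mulrA ler_wpM2r.
  rewrite expr_div_n exprVn ler_wpM2r ?invr_ge0 ?exprn_ge0 ?(ltW eta0)//.
  by rewrite exprS ler_piMl ?(ltW wi)// ltW.
have [C [C0 hC]] : exists C, 0 <= C /\ forall i, (i <= N)%N -> gbound rho (zt g i) C.
  elim: N {hN bigN} => [|N [C [C0 hC]]].
    by exists 1; split=> // -[|//] _; rewrite zt0; exact: gbound1.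
  have [c hc] := gbound_zt N.+1 rho0 ha.
  exists (Num.max C c); split; first by rewrite le_max C0.
  move=> i; rewrite leq_eqVlt => /predU1P[->|/hC h].
    by apply: gbound_le hc _; rewrite le_max lexx orbT.
  by apply: gbound_le h _; rewrite le_max lexx.
have e1 : 1 <= eta^-1 by rewrite invf_ge1// ltW.
exists (C + 1); first by rewrite addr_ge0.
move=> i; have [iN|Ni] := leqP i N.
  apply: gbound_le (hC _ iN) _; have := exprn_ege1 i e1.
  by move=> h; apply: (@le_trans _ _ (C + 1)); [rewrite lerDl|rewrite ler_peMr// addr_ge0].
apply: gbound_le (bigN _ Ni) _; rewrite ler_peMl ?exprn_ge0 ?(le_trans ler01)//.
by rewrite lerDr.
Qed.

(* A geometric degree bound on the poles suffices: coefficients of norm at most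
   1 in degrees [-N i, oo) have rho-norm at most rho^(-N i). *)
Lemma integral_solvable g (N : nat) :
  (forall i, rintegral (zt g i)) ->
  (forall i (n : int), n < - (N * i)%N%:Z -> zt g i n = 0) ->
  solvable_op p g.
Proof.
move=> hint hsupp.
have w0 : 0 < w by exact: omega_gt0 p_prime K_padic.
have ray_le rho : (ray p g rho <= rho%:E)%E by rewrite /ray ge_min lexx.
(* Of the exponent [N.+1 * i], the part [N * i] bounds the poles of [zt g i] and one more [i] comes
   from the factor T^-i in [giter_zt]. *)
have gn_le rho i : 0 < rho < 1 -> (gauss_norm (giter g i) rho <=
    (unorm ((i`!)%:R : K) * (rho^-1) ^+ (N.+1 * i))%:E)%E.
  move=> /andP[rho0 rho1]; apply/gauss_norm_le => n; rewrite giter_coef unormM -mulrA.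
  rewrite ler_wpM2l ?unorm_ge0//.
  have [ni|ni] := ltP (n + i%:Z) (- (N * i)%N%:Z).
    by rewrite hsupp// unorm0 mul0r exprn_ge0// invr_ge0 ltW.
  apply: (@le_trans _ _ (rho ^ n)).
    by rewrite ler_piMl ?exprz_ge0 ?(ltW rho0)//; exact: hint.
  rewrite exprnP -[n in leLHS]opprK -exprz_inv ler_weXz2l ?invf_ge1 ?(ltW rho1)//.
  by nia.
have ray_ge rho : 0 < rho < 1 -> (rho%:E * (rho ^+ N)%:E <= ray p g rho)%E.
  move=> rho01; have /andP[rho0 rho1] := rho01.
  rewrite /ray le_min -EFinM lee_fin ler_piMr ?(ltW rho0) ?exprn_ile1 ?(ltW rho0) ?(ltW rho1)//=.
  set L := limn_esup _.
  have L0 : (0 <= L)%E by apply: limn_esup_ge0 => n; exact: poweR_ge0.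
  (* The factor [c] absorbs the linear factor of [fact_norm_upper]; [Lle'] then lets it tend to
     1. *)
  have Lle (c : R) : 1 < c -> (L <= (w * c * (rho^-1) ^+ N.+1)%:E)%E.
    move=> c1.
    have c0 : 0 < c by lra.
    have [|B [t [B0 t01 hB]]] := @nat_geo_shift _ c^-1.
      by rewrite invr_gt0 c0 invf_lt1.
    have pB0 : 0 <= p%:R * B by rewrite mulr_ge0.
    have t01' : 0 < t < 1 by have : 0 < c^-1; [rewrite invr_gt0|lra].
    have [M hM] := geo_small pB0 t01' ltr01.
    apply: limn_esup_le; exists M.+1 => -[//|i] Mi.
    set D := w * c * _; have D0 : 0 <= D.
      by rewrite !mulr_ge0 ?exprn_ge0 ?invr_ge0 ?(ltW w0) ?(ltW c0) ?(ltW rho0).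
    have hD : (gauss_norm (giter g i.+1) rho <= (D ^+ i.+1)%:E)%E.
      apply: le_trans (gn_le _ _ rho01) _; rewrite lee_fin /D exprMn -exprM.
      rewrite ler_wpM2r ?exprn_ge0 ?invr_ge0 ?(ltW rho0)//.
      apply: le_trans (fact_norm_upper p_prime K_padic i) _.
      rewrite -/w exprMn mulrC ler_wpM2l ?exprn_ge0 ?(ltW w0)//.
      have ci : 0 < c ^+ i.+1 by rewrite exprn_gt0.
      rewrite -[leRHS]mul1r -ler_pdivrMr// -exprVn -mulrA; apply: le_trans (hM i.+1 (ltnW Mi)).
      by rewrite -mulrA ler_wpM2l.
    move: hD; have := gauss_norm_ge0 (giter g i.+1) rho0.
    case: (gauss_norm _ _) => [G| |]//=; rewrite !lee_fin => G0 hG.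
    have DE : D = (D ^+ i.+1) `^ (i.+1%:R)^-1.
      by rewrite -powR_mulrn// -powRrM mulfV ?powRr1// pnatr_eq0.
    by rewrite [leRHS]DE ge0_ler_powR ?nnegrE ?exprn_ge0// invr_ge0.
  have Lle' : (L <= (w * (rho^-1) ^+ N.+1)%:E)%E.
    have A0 : 0 < w * (rho^-1) ^+ N.+1 by rewrite mulr_gt0 ?exprn_gt0 ?invr_gt0.
    have Lle2 := Lle 2 ltac:(lra).
    move: L0 Lle2 Lle; clearbody L; case: L => [l| |]//; rewrite !lee_fin => l0 _ Lle.
    apply/ler_addgt0Pr => e e0.
    set X := rho^-1 ^+ N.+1 in A0 Lle *; set A := w * X in A0 *.
    have := Lle (1 + e / A); rewrite ltrDl divr_gt0// => /(_ isT).
    rewrite lee_fin => /le_trans; apply.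
    have -> : w * (1 + e / A) * X = A + A / A * e by rewrite /A; ring.
    by rewrite mulfV ?mul1r// gt_eqF.
  move: Lle' L0; case: (inveP L) => [_ _|//|//|l l0].
    by rewrite gt0_muley ?lte_fin// leey.
  rewrite -EFinM !lee_fin => Lle' l1; have lgt : 0 < l by rewrite lt_def l0.
  rewrite ler_pdivlMr// mulrC -ler_pdivlMr ?mulr_gt0 ?exprn_gt0//.
  by rewrite -exprS -exprVn.
have rho01 : \forall rho \near (1 : R)^'-, (0 < rho < 1).
  near=> rho; apply/andP; split; near: rho.
    exact: nbhs_left_gt.
  exact: nbhs_left_lt.
apply: (@squeeze_cvge _ _ _ _ (fun rho : R => (rho ^+ N.+1)%:E) _ (fun rho => rho%:E)).
- near=> rho; have h : 0 < rho < 1 by near: rho.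
  by rewrite ray_le andbT exprS EFinM ray_ge.
- apply: cvg_EFin; first by near=> rho.
  rewrite -[X in _ --> X](expr1n _ N.+1).
  apply: cvg_at_left_filter; exact: exprn_continuous.
- apply: cvg_EFin; first by near=> rho.
  by apply: cvg_at_left_filter; exact: cvg_id.
Unshelve. all: by end_near. Qed.

End SolvableGrowth.

Section Integrality.
Context {R : realType} {K : completeUltrametricFieldType R}.
Variable p : nat.
Hypothesis p_prime : prime p.
Hypothesis K_padic : contains_Qp p K.
Implicit Types (g : robba K) (rho eta : R).

Let natK := natK_neq0 p_prime K_padic.
Let w := @omega R K p.
Let w0 : 0 < w. Proof. exact: omega_gt0 p_prime K_padic. Qed.

Lemma ifact_rinv k : ifact (@rinv R K) k = robba_const ((k`!)%:R^-1).
Proof.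
elim: k => [|k IH]; first by rewrite /ifact big_ord0 fact0 invr1.
by rewrite /ifact big_ord_recr -/(ifact _ _) /= IH /rinv -rmorphM -invfM -natrM factS mulnC.
Qed.

Lemma ifact_inv_succ k : ifact (inv_succ K) k = (k`!)%:R^-1.
Proof.
elim: k => [|k IH]; first by rewrite /ifact big_ord0 fact0 invr1.
by rewrite /ifact big_ord_recr -/(ifact _ _) /= IH /inv_succ -invfM -natrM factS mulnC.
Qed.

Lemma gbound_const rho (c : K) a : 0 <= a -> unorm c <= a -> gbound rho (robba_const c) a.
Proof.
move=> a0 ca n; rewrite rcoef_monom; case: eqP => [->|_]; first by rewrite expr0z mulr1 mulr1n.
by rewrite mulr0n unorm0 mul0r.
Qed.

Lemma inv_fact_norm k : unorm ((k.+1`!)%:R^-1 : K) <= w^-1 ^+ k.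
Proof.
rewrite unormV exprVn lef_pV2 ?posrE ?exprn_gt0//; first exact: fact_norm_lower.
by apply: lt_le_trans (fact_norm_lower p_prime K_padic k); rewrite exprn_gt0.
Qed.

Lemma gbound_expc rho (l : nat -> robba K) (eps s : R) : 0 < rho -> 0 <= eps <= w -> 0 <= s ->
  (forall j, gbound rho (l j.+1) (eps * s ^+ j.+1)) ->
  forall n, gbound rho (expc (@rinv R K) l n.+1) (eps * s ^+ n.+1).
Proof.
move=> r0 /andP[e0 ew] s0 hl n.
apply: (@expc_bound _ _ R (gbound rho) _ _ _ _ _ l w^-1 eps s) => //.
- by move=> a; exact: gbound0.
- exact: gbound1.
- by move=> x y a; exact: gboundD.
- by move=> x y a b; exact: gboundM.
- by move=> x a b; exact: gbound_le.
- by rewrite invr_ge0 ltW.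
- by rewrite ler_pdivrMr// mul1r.
- move=> k; rewrite ifact_rinv; apply: gbound_const; last exact: inv_fact_norm.
  by rewrite exprn_ge0// invr_ge0 ltW.
Qed.

Lemma unorm_expc (l : nat -> K) (eps s : R) : 0 <= eps <= w -> 0 <= s ->
  (forall j, unorm (l j.+1) <= eps * s ^+ j.+1) ->
  forall n, unorm (expc (inv_succ K) l n.+1) <= eps * s ^+ n.+1.
Proof.
move=> /andP[e0 ew] s0 hl n.
apply: (@expc_bound _ _ R (fun x a => unorm x <= a) _ _ _ _ _ l w^-1 eps s) => //.
- by move=> a; rewrite unorm0.
- by rewrite unorm1.
- by move=> x y a; exact: unormD_le.
- by move=> x y a b ? ?; rewrite unormM ler_pM ?unorm_ge0.
- by move=> x a b; exact: le_trans.
- by rewrite invr_ge0 ltW.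
- by rewrite ler_pdivrMr// mul1r.
- by move=> k; rewrite ifact_inv_succ; exact: inv_fact_norm.
Qed.

Lemma bernoulli_lower (t : R) m : 0 <= t <= 1 -> 1 - m%:R * t <= (1 - t) ^+ m.
Proof.
move=> /andP[t0 t1]; elim: m => [|m IH]; first by rewrite expr0; lra.
rewrite exprS; have m0 : 0 <= m%:R :> R by [].
have : (1 - t) * (1 - m%:R * t) <= (1 - t) * (1 - t) ^+ m by rewrite ler_wpM2l//; lra.
by apply: le_trans; rewrite -natr1; nra.
Qed.

Lemma shrink_factor (x : R) m : 1 < x -> exists2 k, 0 < k < 1 & 1 < x * k ^+ m.
Proof.
(* With this t, Bernoulli's inequality gives x (1 - t)^m >= x - (x - 1) m / (m + 2) > 1. *)
move=> x1; pose t := (x - 1) / (x * m.+2%:R).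
have x0 : 0 < x by lra.
have t0 : 0 < t by rewrite divr_gt0 ?subr_gt0 ?mulr_gt0.
have tx : t * (x * m.+2%:R) = x - 1 by rewrite divfK// mulf_neq0 ?gt_eqF.
have m2 : 1 + m%:R < m.+2%:R :> R by rewrite -natr1 -[m.+1%:R]natr1; lra.
have m0 : 0 <= m%:R :> R by [].
set y : R := m.+2%:R in m2 tx t0 *.
have y1 : 1 < y by lra.
have t1 : t < 1 by rewrite /t ltr_pdivrMr -/y ?mulr_gt0//; nra.
exists (1 - t); first lra.
have bern : 1 - m%:R * t <= (1 - t) ^+ m by apply: bernoulli_lower; rewrite (ltW t0) ltW.
have xt : 0 < x * t by rewrite mulr_gt0.
have h1 : x * t * m%:R <= x * t * (y - 1) by rewrite ler_wpM2l ?(ltW xt)//; lra.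
have h2 : x * (1 - m%:R * t) <= x * (1 - t) ^+ m by rewrite ler_wpM2l ?(ltW x0).
apply: lt_le_trans h2; move: h1 tx xt; set a : R := m%:R.
have -> : x * t * (y - 1) = t * (x * y) - x * t by ring.
have -> : x * (1 - a * t) = x - x * t * a by ring.
by move=> h1 tx xt; move: h1; rewrite tx; lra.
Qed.

Lemma zt_dominated_mul rho r s g M i0 n0 q : 0 < rho -> 0 < r -> 0 < M ->
  dominated rho r s (zt g) M i0 n0 ->
  dominated rho r s (zt (q.+1%:R * g)) (M ^+ q.+1) (i0 * q.+1)%N (n0 * q.+1%:Z).
Proof.
move=> rho0 r0 M0 hM; elim: q => [|q IH]; first by rewrite mul1r expr1 muln1 mulr1.
have -> : zt (q.+2%:R * g) = cauchy (zt g) (zt (q.+1%:R * g)).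
  apply/funext => k; rewrite /cauchy -(ztD natK); congr zt.
  by rewrite -[q.+2]add1n natrD mulrDl mul1r.
rewrite exprS [(i0 * q.+2)%N]mulnS.
rewrite (_ : n0 * q.+2%:Z = n0 + n0 * q.+1%:Z); last by lia.
by apply: dominated_cauchy => //; rewrite exprn_gt0.
Qed.

(** The multiple is p^N. The logarithm of the series has coefficients [blog] divided by j + 1, and
    [r < 1] pays for this denominator through the bound [B] of (j + 1) r^(j+1). Once |p|^N a B <=
    omega the exponential is controlled by [gbound_expc]. *)
Lemma gbound_zt_small rho r g a : 0 < rho -> 0 < r < 1 -> gbound rho g a ->
  exists q, forall i n, wnorm rho r (zt (q.+1%:R * g)) i n <= 1.
Proof.
move=> rho0 /andP[r0 r1] ga; have a0 := gbound_ge0 rho0 ga.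
have [|B B0 hB] := @nat_geo _ r; first by rewrite r0.
have up01 : 0 < unorm (p%:R : K) < 1.
  by rewrite (unorm_p_gt0 p_prime K_padic) (unorm_p_lt1 p_prime K_padic).
have [N hN] := geo_small (mulr_ge0 a0 B0) up01 w0.
exists (p ^ N).-1; rewrite prednK ?expn_gt0 ?prime_gt0//.
move=> [|i] n.
  rewrite /wnorm zt0 expr0 mulr1; exact: gbound1.
rewrite /wnorm (zt_expc natK).
have ri : 0 < r ^+ i.+1 by rewrite exprn_gt0.
rewrite -ler_pdivlMr// mul1r.
apply: (@le_trans _ _ (w * r^-1 ^+ i.+1)); last first.
  by rewrite exprVn ler_piMl ?invr_ge0 ?(ltW ri)// ltW// (omega_lt1 p_prime K_padic).
move: n; apply: gbound_expc => //; rewrite ?lexx ?(ltW w0) ?invr_ge0 ?(ltW r0)//.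
move=> j /=; rewrite /rinv.
have gq : gbound rho ((p ^ N)%:R * g) (unorm (p%:R : K) ^+ N * a).
  rewrite -(rmorph_nat (@robba_const R K)).
  apply: gbound_le (gboundZ _ ga) _; rewrite natrX.
  suff -> : unorm ((p%:R : K) ^+ N) = unorm (p%:R : K) ^+ N by [].
  by elim: N {hN} => [|N IH]; rewrite ?expr0 ?unorm1// !exprS unormM IH.
apply: gbound_le (gboundZ _ (gbound_blog natK j gq rho0)) _.
have h1 : unorm (inv_succ K j) <= j.+1%:R by rewrite /inv_succ (unorm_natV K_padic).
have := hN N (leqnn _); have := hB j.+1.
set P := unorm (p%:R : K) ^+ N => hj hP.
have P0 : 0 <= P by rewrite exprn_ge0 ?unorm_ge0.
have rj : 0 < r ^+ j.+1 by rewrite exprn_gt0.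
rewrite exprVn ler_pdivlMr//; apply: le_trans hP.
rewrite (_ : a * B * P = B * (P * a)); last by ring.
rewrite mulrAC ler_wpM2r ?mulr_ge0//; apply: le_trans hj.
by rewrite ler_wpM2r// ltW.
Qed.

(** If a coefficient had norm above 1, the largest weighted norm M of the series would exceed 1, and
    by Gauss's lemma M^q would be attained by the series of q g for every q >= 1. This contradicts
    [gbound_zt_small]. *)
Lemma solvable_integral g : solvable_op p g -> forall i, rintegral (zt g i).
Proof.
move=> hs i0 n0; rewrite leNgt; apply/negP => z1.
(* The weight k is so close to 1 that the offending coefficient keeps a weighted norm above 1; eta
   lies between k and 1, so that (k / eta)^i decays. *)
have [k /andP[k0 k1] hk] := shrink_factor (i0 + `|n0|) z1.
pose eta := (k + 1) / 2.
have eta01 : 0 < eta < 1 by rewrite /eta; lra.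
have keta : k < eta by rewrite /eta; lra.
have eta0 : 0 < eta by lra.
have [d d01 hd] := solvable_growth p_prime K_padic hs eta01.
have [d' d'01 hd'] := robba_radius g.
have [b [kb db d'b b1]] : exists b, [/\ k < b, 1 - d < b, 1 - d' < b & b < 1].
  have h1 : k <= Num.max k (Num.max (1 - d) (1 - d')) by rewrite le_max lexx.
  have h2 : 1 - d <= Num.max k (Num.max (1 - d) (1 - d')) by rewrite !le_max lexx orbT.
  have h3 : 1 - d' <= Num.max k (Num.max (1 - d) (1 - d')) by rewrite !le_max lexx !orbT.
  have h4 : Num.max k (Num.max (1 - d) (1 - d')) < 1 by rewrite !gt_max; apply/and3P; split; lra.
  exists ((Num.max k (Num.max (1 - d) (1 - d')) + 1) / 2); split; lra.
(* Decay in the degree at rho comes from rho1 < rho for negative degrees and from rho2 > rho for the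
   others. Moreover rho1 > k, so rho^n is at least k^|n|. *)
pose rho1 := b; pose rho := (b + 1) / 2; pose rho2 := (rho + 1) / 2.
have rho10 : 0 < rho1 by rewrite /rho1; lra.
have rhoP : rho1 < rho < 1 by rewrite /rho /rho1; lra.
have rho2P : rho < rho2 < 1 by move: rhoP; rewrite /rho2 /rho; lra.
have r1P : [/\ k < rho1, 1 - d < rho1, 1 - d' < rho1 & rho1 < 1] by split.
clearbody rho2; clearbody rho; clearbody rho1; case: r1P => kr1 dr1 d'r1 r11.
have rho0 : 0 < rho by lra.
have rho20 : 0 < rho2 by lra.
have [|C1 C10 hC1] := hd rho1; first lra.
have [|C2 C20 hC2] := hd rho2; first lra.
have [|a ha] := hd' rho; first lra.
pose t0 := k / eta; pose t1 := rho1 / rho; pose t2 := rho / rho2.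
pose th := Num.max t0 (Num.max t1 t2).
have th_t0 : t0 <= th by rewrite le_max lexx.
have th_t1 : t1 <= th by rewrite !le_max lexx orbT.
have th_t2 : t2 <= th by rewrite !le_max lexx !orbT.
have t00 : 0 < t0 by rewrite divr_gt0.
have t10 : 0 < t1 by rewrite divr_gt0.
have t20 : 0 < t2 by rewrite divr_gt0.
have th01 : 0 < th < 1.
  rewrite (lt_le_trans t00 th_t0)/= !gt_max !ltr_pdivrMr// !mul1r keta.
  by apply/andP; split; lra.
have decay i n : wnorm rho k (zt g) i n <= (C1 + C2) * th ^+ (i + `|n|).
  rewrite /wnorm.
  have key C (rho' : R) t : 0 <= C -> 0 < rho' -> 0 < t -> t <= th ->
      C <= C1 + C2 ->
      gbound rho' (zt g i) (C * eta^-1 ^+ i) -> rho ^ n = rho' ^ n * t ^+ `|n|%N ->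
      unorm (zt g i n) * rho ^ n * k ^+ i <= (C1 + C2) * th ^+ (i + `|n|).
    move=> C0 r'0 tt0 tth CC hC ->; rewrite exprD.
    have -> : unorm (zt g i n) * (rho' ^ n * t ^+ `|n|%N) * k ^+ i =
       unorm (zt g i n) * rho' ^ n * k ^+ i * t ^+ `|n|%N by ring.
    rewrite mulrA; apply: ler_pM.
    - by rewrite !mulr_ge0 ?unorm_ge0 ?exprz_ge0 ?exprn_ge0 ?ltW.
    - by rewrite exprn_ge0// ltW.
    - apply: (@le_trans _ _ (C * eta^-1 ^+ i * k ^+ i)).
        by rewrite ler_wpM2r ?exprn_ge0 ?(ltW k0).
      rewrite -mulrA -exprMn [eta^-1 * k]mulrC -/t0; apply: ler_pM => //.
        by rewrite exprn_ge0// ltW.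
      by rewrite lerXn2r ?nnegrE ?(ltW t00)//; case/andP: th01 => /ltW.
    - by rewrite lerXn2r ?nnegrE ?(ltW tt0)//; case/andP: th01 => /ltW.
  case: n key => n key.
  - apply: (key C2 rho2 t2) => //; first by rewrite lerDr.
    by rewrite /t2 -!exprnP expr_div_n mulrC divfK// expf_neq0 ?gt_eqF.
  - apply: (key C1 rho1 t1) => //; first by rewrite lerDl.
    rewrite /t1 !NegzE -!exprnN expr_div_n /=.
    by rewrite mulrA mulVf ?mul1r// expf_neq0 ?gt_eqF.
have zn0 : zt g i0 n0 != 0 by rewrite -unorm_eq0 gt_eqF// (lt_trans ltr01).
have CC : 0 <= C1 + C2 by rewrite addr_ge0.
have [M [i1 [n1 [M0 hM]]]] := dominated_exists rho0 k0 true CC th01 decay zn0.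
have M1 : 1 < M.
  case: hM => /(_ i0 n0) + _ _; apply: lt_le_trans; apply: (lt_le_trans hk).
  rewrite /wnorm -mulrA exprD [k ^+ i0 * _]mulrC ler_wpM2l ?unorm_ge0//.
  rewrite ler_wpM2r ?exprn_ge0 ?(ltW k0)//.
  case: (n0) => n.
    by rewrite -exprnP lerXn2r ?nnegrE; lra.
  rewrite NegzE -exprnN (@le_trans _ _ 1)//; first by rewrite exprn_ile1//; lra.
  rewrite invf_ge1 ?exprn_gt0// exprn_ile1//; lra.
have [q hq] := gbound_zt_small rho0 (andb_true_intro (conj k0 k1)) ha.
have [_ hMq _] := zt_dominated_mul q rho0 k0 M0 hM.
have := hq (i1 * q.+1)%N (n1 * q.+1%:Z); rewrite hMq leNgt exprn_egt1//.
Qed.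

End Integrality.

(** * Equations supported on one side *)

Section OneSidedSeries.
Context {R : realType} {K : completeUltrametricFieldType R}.
Implicit Types (f g u : robba K) (s : bool) (a : nat -> K).

Definition sg s (n : nat) : int := if s then - n%:Z else n%:Z.

Definition on_side s : pred int := fun m => if s then m <= 0 else 0 <= m.

Definition strict_side s : pred int := fun m => if s then m < 0 else 0 < m.

Lemma sg_abs s m : on_side s m -> sg s `|m| = m.
Proof. by rewrite /sg /on_side; case: s; lia. Qed.

Lemma abs_sg s n : `|sg s n|%N = n.
Proof. by rewrite /sg; case: s; lia. Qed.

Lemma on_side_sg s n : on_side s (sg s n).
Proof. by rewrite /sg /on_side; case: s; lia. Qed.

Lemma sg_inj s : injective (sg s).
Proof. by move=> m n /(congr1 absz); rewrite !abs_sg. Qed.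

Lemma sgB s m n : (n <= m)%N -> sg s (m - n) = sg s m - sg s n.
Proof. by rewrite /sg; case: s; lia. Qed.

Lemma strict_sideD s m n : strict_side s m -> strict_side s n -> strict_side s (m + n).
Proof. by rewrite /strict_side; case: s; lia. Qed.

Lemma strict_side_on s m : strict_side s m -> on_side s m.
Proof. by rewrite /strict_side /on_side; case: s; lia. Qed.

Lemma on_sideD s m n : on_side s m -> on_side s n -> on_side s (m + n).
Proof. by rewrite /on_side; case: s; lia. Qed.

Lemma rsuppW (P Q : pred int) f : (forall n, P n -> Q n) -> rsupp P f -> rsupp Q f.
Proof. by move=> PQ hf n nQ; apply: hf; apply: contra nQ => /PQ. Qed.

Lemma side_mul s f g (n : nat) : rsupp (on_side s) f -> rsupp (on_side s) g ->
  (f * g) (sg s n) = \sum_(j < n.+1) f (sg s j) * g (sg s (n - j)).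
Proof.
move=> hf hg.
rewrite (@rcoefM_finite _ _ _ _ _ [fset sg s (nat_of_ord j) | j : 'I_n.+1]%fset).
  rewrite big_imfset/=; last by move=> i j _ _ /sg_inj/val_inj.
  rewrite big_enum /=; apply: eq_bigr => -[j /= jn] _.
  by rewrite sgB.
move=> i iF; have [si|/hf->] := boolP (on_side s i); last by rewrite mul0r.
have [sni|/hg->] := boolP (on_side s (sg s n - i)); last by rewrite mulr0.
case/negP: iF; apply/imfsetP => /=.
have ni : (`|i| < n.+1)%N by move: si sni; rewrite /sg /on_side; case: s {hf hg}; lia.
by exists (Ordinal ni); rewrite //= sg_abs.
Qed.

Definition side_coef s a (m : int) : K := if on_side s m then a `|m|%N else 0.

Lemma is_robba_side_pos a (C : R) : (forall n, unorm (a n) <= C) ->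
  is_robba (side_coef false a).
Proof.
move=> hC; have C0 : 0 <= C by apply: le_trans (hC 0); rewrite unorm_ge0.
apply/is_robbaP; exists (1 / 2); first lra.
move=> rho rho1; exists C => -[n|n]; rewrite /side_coef/=; last by rewrite unorm0 mul0r.
rewrite -exprnP; apply: le_trans (hC n); rewrite ler_piMr ?unorm_ge0 ?exprn_ile1//; lra.
Qed.

Lemma is_robba_side_geo s a (C t : R) : 0 < t < 1 -> (forall n, unorm (a n) <= C * t ^+ n) ->
  is_robba (side_coef s a).
Proof.
move=> t01 hC; have C0 : 0 <= C.
  by have := hC 0; rewrite expr0 mulr1; apply: le_trans; rewrite unorm_ge0.
case: s; last first.
  apply: (@is_robba_side_pos _ C) => n; apply: le_trans (hC n) _.
  by rewrite ler_piMr// exprn_ile1//; lra.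
apply/is_robbaP; exists (1 - t); first lra.
move=> rho rho1; have rho0 : 0 < rho by lra.
exists C => m; rewrite /side_coef/=; case: ifP => [m0|_]; last by rewrite unorm0 mul0r.
have mE : m = - `|m|%N%:Z by lia.
rewrite [in rho ^ m]mE -exprnN; set n := absz _.
rewrite ler_pdivrMr ?exprn_gt0//; apply: le_trans (hC n) _; rewrite ler_wpM2l//.
by rewrite lerXn2r ?nnegrE; lra.
Qed.

Lemma is_robba_side_fin s a N : (forall n, (N <= n)%N -> a n = 0) ->
  is_robba (side_coef s a).
Proof.
move=> hN; pose C := \sum_(n < N) unorm (a n) * 2 ^+ n.
apply: (@is_robba_side_geo _ _ C (1 / 2)); first lra.
have C0 : 0 <= C by apply: sumr_ge0 => i _; rewrite mulr_ge0 ?unorm_ge0 ?exprn_ge0.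
move=> n; have [/hN->|nN] := leqP N n; first by rewrite unorm0 mulr_ge0// exprn_ge0//; lra.
rewrite div1r exprVn ler_pdivlMr ?exprn_gt0// /C (bigD1 (Ordinal nN))//= lerDl.
by apply: sumr_ge0 => i _; rewrite mulr_ge0 ?unorm_ge0 ?exprn_ge0.
Qed.

Definition mk_robba (c : int -> K) (rc : is_robba c) : robba K :=
  Robba (introT (robba_predP _) rc).

Lemma mk_robbaE (c : int -> K) (rc : is_robba c) n : mk_robba rc n = c n.
Proof. by []. Qed.

Lemma side_coefE s a n : side_coef s a (sg s n) = a n.
Proof. by rewrite /side_coef on_side_sg abs_sg. Qed.

Lemma rsupp_side s a (ra : is_robba (side_coef s a)) : rsupp (on_side s) (mk_robba ra).
Proof. by move=> n /negPf h; rewrite mk_robbaE /side_coef h. Qed.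

Section Exponential.
Hypothesis natK_neq0 : forall n, n.+1%:R != 0 :> K.

Definition side_log s g (j : nat) : K := (sg s j)%:~R^-1 * g (sg s j).

Lemma intK_sg s n : (sg s n.+1)%:~R != 0 :> K.
Proof. by rewrite /sg; case: s; rewrite ?mulrNz ?oppr_eq0 natK_neq0. Qed.

Lemma side_logE s g n : (sg s n.+1)%:~R * side_log s g n.+1 = g (sg s n.+1).
Proof. by rewrite /side_log mulrA mulfV ?mul1r// intK_sg. Qed.

Lemma sg_nat s n : (sg s n)%:~R = (-1) ^+ s * n%:R :> K.
Proof. by rewrite /sg; case: s; rewrite ?mulrNz ?expr0 ?expr1 ?mul1r ?mulN1r. Qed.

(** Truncating the formal exponential gives an element of the Robba ring before any convergence is
    known; the defect of the equation then lies beyond degree N. *)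
Lemma side_theta_upto s g u N : rsupp (strict_side s) g -> rsupp (on_side s) u ->
  (forall n, (n <= N)%N -> u (sg s n) = expc (inv_succ K) (side_log s g) n) ->
  rsupp (fun m => on_side s m && (N < `|m|)%N) (robba_theta u - g * u).
Proof.
move=> hg hu uE m; have hg' := rsuppW (@strict_side_on s) hg.
have [sm|sm _] := boolP (on_side s m); last first.
  by rewrite rcoefB rcoef_theta hu// mulr0 (rsuppM hg' hu (@on_sideD s)) ?subr0.
rewrite andTb -leqNgt => mN; rewrite -(sg_abs sm) rcoefB rcoef_theta side_mul// big_ord_recl/=.
rewrite hg ?mul0r ?add0r; last by rewrite /strict_side /sg; case: (s).
case: (`|m|)%N mN => [|n] nN.
  by rewrite big_ord0 /sg if_same mul0r subrr.
rewrite uE// sg_nat -mulrA (expcS (inv_succK natK_neq0)) mulr_sumr -sumrB big1// => -[j /= jn] _.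
rewrite /bump/= add1n subSS uE; last by rewrite (leq_trans (leq_subr _ _))// ltnW.
by rewrite -side_logE sg_nat !mulrA subrr.
Qed.

Lemma side_theta s g u : rsupp (strict_side s) g -> rsupp (on_side s) u ->
  (forall n, u (sg s n) = expc (inv_succ K) (side_log s g) n) ->
  robba_theta u = g * u.
Proof.
move=> hg hu uE; apply/eqP; rewrite -subr_eq0; apply/eqP/robba_ext => m.
by apply: (side_theta_upto (N := `|m|) hg hu) => [n _|]; rewrite ?ltnn ?andbF.
Qed.

Lemma theta_eq0 u : robba_theta u = 0 -> u = robba_const (u 0).
Proof.
move=> h; apply: robba_ext => m; rewrite rcoef_monom.
have [->//|m0] := eqVneq m 0; rewrite mulr0n.
have := rcoef_theta u m; rewrite h rcoef0 => /esym/eqP; rewrite mulf_eq0 => /orP[|/eqP//].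
case: m m0 => [[|n]|n] //= _; first by rewrite (negPf (natK_neq0 n)).
by rewrite NegzE mulrNz oppr_eq0 (negPf (natK_neq0 n)).
Qed.

(** The solutions for [g] and [- g] have a product killed by theta, hence constant, and equal to 1
    in degree 0. *)
Lemma side_unit s g (ru : is_robba (side_coef s (expc (inv_succ K) (side_log s g))))
    (rv : is_robba (side_coef s (expc (inv_succ K) (side_log s (- g))))) :
  rsupp (strict_side s) g ->
  exists u v : robba K, u * v = 1 /\ robba_theta u = g * u.
Proof.
move=> hg; pose u := mk_robba ru; pose v := mk_robba rv.
have hu : rsupp (on_side s) u by exact: rsupp_side.
have hv : rsupp (on_side s) v by exact: rsupp_side.
have tu : robba_theta u = g * u.
  by apply: side_theta hg hu _ => n; rewrite mk_robbaE side_coefE.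
have tv : robba_theta v = - g * v.
  apply: side_theta hv _ => [m /hg|n]; last by rewrite mk_robbaE side_coefE.
  by rewrite rcoefN => ->; rewrite oppr0.
exists u, v; split=> //.
have /theta_eq0-> : robba_theta (u * v) = 0 by rewrite robba_thetaM tu tv; ring.
have -> : (0 : int) = sg s 0 by rewrite /sg if_same.
rewrite side_mul// big_ord1 subnn !mk_robbaE !side_coefE.
by rewrite !expc0 mulr1.
Qed.

End Exponential.
End OneSidedSeries.

(** * Integrality of one-sided formal solutions *)

Section SideIntegrality.
Context {R : realType} {K : completeUltrametricFieldType R}.
Variable p : nat.
Hypothesis p_prime : prime p.
Hypothesis K_padic : contains_Qp p K.
Implicit Types (g u : robba K) (s : bool).

Let natK := natK_neq0 p_prime K_padic.

(** The binomial is the product of (j + p^k) / j for 1 <= j <= m, and j + p^k has the norm of j when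
    0 < j < p^k. *)
Lemma unorm_bin_ppow m k : (m < p ^ k)%N -> unorm ('C(m + p ^ k, m)%:R : K) = 1.
Proof.
elim: m => [|m IH] mk; first by rewrite bin0 unorm1.
have := mul_bin_diag (m.+1 + p ^ k) m; rewrite addSn /= => h.
have : unorm (((m + p ^ k).+1 * 'C(m + p ^ k, m))%:R : K) =
       unorm ((m.+1 * 'C((m + p ^ k).+1, m.+1))%:R : K) by rewrite h.
rewrite !natrM !unormM (IH (ltnW mk)) mulr1.
have -> : unorm ((m + p ^ k).+1%:R : K) = unorm (m.+1%:R : K).
  apply: unorm_close; rewrite -addSn natrD addrAC subrr add0r.
  have pk0 : (0 < p ^ k)%N by rewrite expn_gt0 prime_gt0.
  rewrite (unorm_nat_p p_prime K_padic pk0) (unorm_nat_p p_prime K_padic (ltn0Sn m)).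
  have up0 := unorm_p_gt0 p_prime K_padic; have up1 := unorm_p_lt1 p_prime K_padic.
  rewrite pfactorK// ltr_iXn2l// ltnNge; apply/negP.
  by rewrite -pfactor_dvdn// => /dvdn_leq; lia.
move=> /esym h1; have m0 : unorm (m.+1%:R : K) != 0 by rewrite unorm_eq0 natK.
by apply: (mulfI m0); rewrite h1 mulr1.
Qed.

(** For the exponent n + 1 take i = n + 1. For - (n + 1) the i-th binomial is C(n + i, i) up to
    sign, a unit for i = p^n because n < p^n. *)
Lemma exists_unit_ibin s n : exists2 i, (0 < i)%N & unorm ((ibin (sg s n.+1) i)%:~R : K) = 1.
Proof.
case: s; last by exists n.+1 => //; rewrite ibinnn unorm1.
exists (p ^ n)%N; first by rewrite expn_gt0 prime_gt0.
rewrite ibinN intrM unormM rmorphXn/= -signr_odd; set b := odd _.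
have -> : unorm ((-1 : int)%:~R ^+ b : K) = 1 by case: b; rewrite ?expr1 ?unormN unorm1.
by rewrite mul1r -bin_sub ?leq_addl// addnK unorm_bin_ppow// ltn_expl// prime_gt1.
Qed.

(* Comparing the coefficients of degree n in (zt g i) f = binom(theta, i) f,
   where i >= 1 is such that the i-th binomial coefficient of the exponent is a
   unit, expresses the n-th coefficient of f by the previous ones. *)
Lemma side_integral s g : rsupp (strict_side s) g -> (forall i, rintegral (zt g i)) ->
  forall n, unorm (expc (inv_succ K) (side_log s g) n) <= 1.
Proof.
move=> hg hz n; elim/ltn_ind: n => -[|n] IH.
  by rewrite expc0 unorm1.
set e := expc _ _ in IH *.
have ra : is_robba (side_coef s (fun m => if (m <= n.+1)%N then e m else 0)).
  by apply: (@is_robba_side_fin _ _ _ _ n.+2) => m; case: ifP => // h1 h2; lia.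
pose u := mk_robba ra.
have hu : rsupp (on_side s) u by exact: rsupp_side.
have uE m : (m <= n.+1)%N -> u (sg s m) = e m by move=> mn; rewrite mk_robbaE side_coefE mn.
clearbody u.
have [i i0 hi] := exists_unit_ibin s n.
have hsol := side_theta_upto natK hg hu uE.
have -> : e n.+1 = u (sg s n.+1) by rewrite uE.
have hg' := rsuppW (@strict_side_on s) hg.
have hzi : rsupp (strict_side s) (zt g i).
  by case: i i0 {hi} => // i _; apply: zt_supp => //; exact: strict_sideD.
have hzi' := rsuppW (@strict_side_on s) hzi.
suff <- : unorm ((zt g i * u) (sg s n.+1)) = unorm (u (sg s n.+1)).
  rewrite side_mul// big_ord_recl/= hzi ?mul0r ?add0r; last first.
    by rewrite /strict_side /sg; case: (s).
  apply: unorm_sum_le => //= -[j /= jn] _ _; rewrite unormM mulr_ile1 ?unorm_ge0//.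
    exact: hz.
  by rewrite /bump/= add1n subSS uE ?IH//; lia.
rewrite (@zt_solution _ _ natK (on_side s) _ g u _ _ _ _ hsol) //.
- by rewrite unormM hi mul1r.
- exact: on_sideD.
- by rewrite /on_side; case: (s).
- by move=> a b; rewrite /on_side; case: (s); lia.
- by rewrite on_side_sg abs_sg ltnn.
Qed.

End SideIntegrality.

(** * Product factorization *)

Section ProductFactorization.
Variables (F : fieldType) (f : nat -> F).

(* wpoly M is the product of the 1 - lam m X^m for m <= M, the lam m being
   chosen so that the first M coefficients are those of f. *)
Fixpoint wpoly (M : nat) : {poly F} :=
  if M is M'.+1 then wpoly M' * (1 - ((wpoly M')`_M - f M) *: 'X^M) else 1.

Definition lam M : F := (wpoly M.-1)`_M - f M.

Lemma wpolyS M : wpoly M.+1 = wpoly M * (1 - lam M.+1 *: 'X^(M.+1)).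
Proof. by []. Qed.

Lemma coef_wpolyS M i :
  (wpoly M.+1)`_i = (wpoly M)`_i - if (i < M.+1)%N then 0 else lam M.+1 * (wpoly M)`_(i - M.+1).
Proof.
by rewrite wpolyS mulrBr mulr1 -scalerAr coefB coefZ coefMXn; case: ifP; rewrite ?mulr0.
Qed.

Lemma wpoly0 M : (wpoly M)`_0 = 1.
Proof. by elim: M => [|M IH]; rewrite ?coef1// coef_wpolyS IH subr0. Qed.

Lemma wpolyE M i : f 0 = 1 -> (i <= M)%N -> (wpoly M)`_i = f i.
Proof.
move=> f0; elim: M => [|M IH]; first by rewrite leqn0 => /eqP ->; rewrite coef1.
rewrite leq_eqVlt coef_wpolyS ltnS => /predU1P[->|iM].
  by rewrite ltnn subnn wpoly0 mulr1 /lam subKr.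
by rewrite iM subr0 IH.
Qed.

(** Truncation of X P' / P for P = [wpoly M]: the factor 1 - y, with y = lam m X^m, contributes - m
    y / (1 - y), and the geometric series is cut after D terms. *)
Definition wghost M D : {poly F} :=
  - \sum_(m < M) m.+1%:R *: ((lam m.+1 *: 'X^(m.+1)) * \sum_(i < D) (lam m.+1 *: 'X^(m.+1)) ^+ i).

Lemma agree_lincomb n (P P' Q Q' : {poly F}) :
  agree n P P' -> agree n Q Q' -> agree n (P + Q) (P' + Q').
Proof. by move=> h1 h2 i iN; rewrite !coefD h1 ?h2. Qed.

Lemma wpoly_deriv M D : agree D ('X * (wpoly M)^`()) (wpoly M * wghost M D).
Proof.
elim: M => [|M IH].
  by move=> i _; rewrite derivC mulr0 /wghost big_ord0 oppr0 mulr0.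
pose y : {poly F} := lam M.+1 *: 'X^(M.+1).
have gS : wghost M.+1 D = wghost M D - M.+1%:R *: (y * \sum_(i < D) y ^+ i).
  by rewrite /wghost big_ord_recr opprD.
have yD : 'X * y^`() = M.+1%:R *: y.
  rewrite /y derivZ derivXn /= -scalerAr mulrnAr -exprS.
  by rewrite -scaler_nat !scalerA mulrC.
have -> : 'X * (wpoly M.+1)^`() = (1 - y) * ('X * (wpoly M)^`()) - M.+1%:R *: (wpoly M * y).
  rewrite wpolyS -/y derivM derivB derivC sub0r.
  rewrite scalerAr -yD; ring.
have -> : wpoly M.+1 * wghost M.+1 D = (1 - y) * (wpoly M * wghost M D) -
    M.+1%:R *: (wpoly M * y) + M.+1%:R *: (wpoly M * y * y ^+ D).
  rewrite wpolyS -/y gS mulrBr -addrA; congr (_ + _); first by ring.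
  rewrite -!mul_polyC; set c := _%:P; set S := \sum_(i < D) _.
  have hy : (1 - y) * S = 1 - y ^+ D by rewrite -opprB mulNr -subrX1 opprB.
  transitivity (- (c * (wpoly M * y * ((1 - y) * S)))); first by ring.
  by rewrite hy; ring.
move=> i iD; rewrite [RHS]coefD [X in _ = _ + X](_ : _ = 0); last first.
  rewrite -mulrA -exprS coefZ /y exprZn -exprM -scalerAr coefZ coefMXn.
  by rewrite (_ : (i < _)%N) ?mulr0//; nia.
rewrite addr0; move: i iD; apply: agree_lincomb; first by apply: agreeM.
by [].
Qed.

(** Up to sign, the ghost components of the big Witt vector with coordinates [lam m]. *)
Lemma coef_wghost n : (0 < n)%N ->
  (wghost n n)`_n = - \sum_(m < n | (m.+1 %| n)%N) m.+1%:R * lam m.+1 ^+ (n %/ m.+1).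
Proof.
move=> n0; rewrite coefN coef_sum [in RHS]big_mkcond/=; congr (- _).
apply: eq_bigr => -[m /= mn] _.
rewrite coefZ mulr_sumr coef_sum.
have coefE i : (lam m.+1 *: 'X^(m.+1) * (lam m.+1 *: 'X^(m.+1)) ^+ i)`_n =
    lam m.+1 ^+ i.+1 *+ (n == m.+1 * i.+1)%N.
  by rewrite -exprS exprZn -exprM coefZ coefXn mulr_natr.
under eq_bigr do rewrite coefE.
case: ifPn => [/dvdnP[k nE]|ndvd]; last first.
  rewrite big1 ?mulr0// => i _; case: eqP => // nE.
  by rewrite nE dvdn_mulr in ndvd.
have k0 : (0 < k)%N by move: n0; rewrite nE muln_gt0 => /andP[].
have kn : (k.-1 < n)%N by rewrite nE; nia.
rewrite (bigD1 (Ordinal kn))//= prednK// big1 ?addr0 => [|i].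
  by rewrite nE mulnC eqxx mulr1n mulKn.
rewrite -val_eqE/= => ik; case: eqP => // nE'.
have : (m.+1 * i.+1 = m.+1 * k)%N by rewrite -nE' nE mulnC.
by move=> /eqP; rewrite eqn_pmul2l// => /eqP kE; move: ik; rewrite -kE eqxx.
Qed.

End ProductFactorization.

(** * Divisibility of logarithmic coefficients by p *)

Section LogarithmDivisibility.
Context {R : realType} {K : completeUltrametricFieldType R}.
Variable p : nat.
Hypothesis p_prime : prime p.
Hypothesis K_padic : contains_Qp p K.
Hypothesis K_unram : unramified p K.

Let natK := natK_neq0 p_prime K_padic.
Let ivP := inv_succK natK.

Variable l : nat -> K.
Let f := expc (inv_succ K) l.
Hypothesis f_int : forall n, unorm (f n) <= 1.

Lemma wpoly_int M i : unorm (wpoly f M)`_i <= 1.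
Proof.
elim: M i => [|M IH] i.
  by rewrite coef1; case: eqP; rewrite ?unorm1 ?unorm0.
rewrite coef_wpolyS; case: ifP => _; first by rewrite subr0.
rewrite unormB_le// unormM mulr_ile1 ?unorm_ge0// /lam unormB_le//.
Qed.

Lemma lam_int m : unorm (lam f m) <= 1.
Proof. by rewrite unormB_le// wpoly_int. Qed.

(** Both sides are coefficients of X f' / f: on the left for f as an exponential, on the right for f
    as a product. They satisfy the same recursion. *)
Lemma ghostE n : (0 < n)%N -> n%:R * l n =
  - \sum_(m < n | (m.+1 %| n)%N) m.+1%:R * lam f m.+1 ^+ (n %/ m.+1).
Proof.
move=> n0; rewrite -coef_wghost//.
have G0 : (wghost f n n)`_0 = 0.
  rewrite coefN coef_sum big1 ?oppr0// => m _.
  by rewrite coefZ -scalerAl coefZ coefXnM mulr0 mulr0.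
have f0 : f 0 = 1 by rewrite /f expc0.
suff H k : (0 < k <= n)%N -> k%:R * l k = (wghost f n n)`_k by rewrite H// n0 /=.
elim/ltn_ind: k => -[|k] IH // kn.
have : f k.+1 *+ k.+1 = (wghost f n n * wpoly f n)`_k.+1.
  by have := wpoly_deriv f n kn; rewrite coefXM coef_deriv wpolyE// mulrC.
rewrite -[f k.+1 *+ _]mulr_natl.
rewrite /f (expcS ivP) -/f coefM [X in _ = X -> _]big_ord_recl G0 mul0r add0r.
under [X in _ = X -> _]eq_bigr do rewrite lift0 subSS.
rewrite !big_ord_recr /= !subnn wpoly0 f0 !mulr1.
rewrite (_ : \sum_(i < k) _ = \sum_(i < k) (wghost f n n)`_i.+1 * (wpoly f n)`_(k - i)).
  by move=> /addrI.
apply: eq_bigr => -[j /= jk] _; rewrite IH//; last by lia.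
by rewrite wpolyE//; lia.
Qed.

(** Among the indices of unit factors take those of least valuation a, and among these the smallest
    m. In the ghost component of m p^j, for large j, the divisor m contributes norm |p|^a and every
    other divisor strictly less, so n l_n does not tend to 0. *)
Lemma exists_unit_lam_absurd m0 : (0 < m0)%N -> unorm (lam f m0) = 1 ->
  ~ (forall e : R, 0 < e -> exists N, forall n, (N <= n)%N -> unorm (n%:R * l n) <= e).
Proof.
move=> m00 um0 small.
have up0 := unorm_p_gt0 p_prime K_padic; have up1 := unorm_p_lt1 p_prime K_padic.
pose unit_at m := (0 < m)%N && (unorm (lam f m) == 1).
have exa : exists a, [exists m : 'I_m0.+1, unit_at m && (logn p m == a)].
  exists (logn p m0); apply/existsP; exists ord_max; rewrite /unit_at/= m00 um0.
  by rewrite !eqxx.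
have exA : exists a, `[< exists m, unit_at m /\ logn p m = a >].
  by exists (logn p m0); apply/asboolP; exists m0; rewrite /unit_at m00 um0 eqxx.
have [a /asboolP exM amin] := ex_minnP exA.
have exM' : exists m, unit_at m && (logn p m == a).
  by case: exM => m [um ma]; exists m; rewrite um ma eqxx.
have [m /andP[/andP[m_gt0 /eqP um] /eqP ma] mmin] := ex_minnP exM'.
have [N hN] := small (unorm (p%:R : K) ^+ a.+1) (exprn_gt0 _ up0).
(* The summand N gives [n >= N]; the summand a makes [n %/ d] exceed a for the divisors d of
   valuation at most a. *)
pose j := (N + a)%N; pose n := (m * p ^ j)%N.
have pj : (j < p ^ j)%N by rewrite ltn_expl ?prime_gt1.
have n_gt0 : (0 < n)%N by rewrite muln_gt0 m_gt0 expn_gt0 prime_gt0.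
have nN : (N <= n)%N by rewrite /n /j; move: pj; rewrite /j; nia.
have mn : (m <= n)%N by rewrite leq_pmulr// expn_gt0 prime_gt0.
suff E : unorm (n%:R * l n) = unorm (p%:R : K) ^+ a.
  by have := hN n nN; rewrite E exprS leNgt gtr_pMl ?exprn_gt0 ?up1.
have mE : m.-1.+1 = m by rewrite prednK.
have mn' : (m.-1 < n)%N by rewrite mE.
rewrite ghostE// unormN (bigD1 (Ordinal mn'))/=; last by rewrite mE dvdn_mulr.
set x := (X in X + _); have xE : unorm x = unorm (p%:R : K) ^+ a.
  rewrite /x mE unormM (unorm_nat_p p_prime K_padic m_gt0) ma.
  suff -> : unorm (lam f m ^+ (n %/ m)) = 1 by rewrite mulr1.
  by elim: (n %/ m)%N => [|i IH]; rewrite ?expr0 ?unorm1// exprS unormM um mul1r.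
rewrite -xE; apply: unorm_close; rewrite addrAC subrr add0r xE.
apply: unorm_sum_lt; first by rewrite exprn_gt0.
move=> [d' d'n] /= /andP[dn]; rewrite -val_eqE /= => dm.
set d := d'.+1 in dn *; have d_gt0 : (0 < d)%N by [].
have dm' : d != m by apply: contra dm; rewrite -mE eqSS.
rewrite unormM (unorm_nat_p p_prime K_padic d_gt0).
have powE i : unorm (lam f d ^+ i) = unorm (lam f d) ^+ i.
  by elim: i => [|i IH]; rewrite ?expr0 ?unorm1// !exprS unormM IH.
have [vd|vd] := ltnP a (logn p d).
  apply: (@le_lt_trans _ _ (unorm (p%:R : K) ^+ logn p d)); last by rewrite ltr_iXn2l.
  by rewrite ler_piMr ?exprn_ge0 ?(ltW up0)// powE exprn_ile1 ?unorm_ge0 ?lam_int.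
have [ud|ud] := eqVneq (unorm (lam f d)) 1.
  have vda : logn p d = a.
    apply/eqP; rewrite eqn_leq vd/=; apply: amin; apply/asboolP.
    by exists d; rewrite /unit_at d_gt0 ud eqxx.
  have : (m <= d)%N by apply: mmin; rewrite /unit_at d_gt0 ud vda !eqxx.
  (* The p-parts of d and m agree, and the prime-to-p part of d divides that of n, which is that of
     m. *)
  suff /dvdn_leq : (d %| m)%N by move=> /(_ m_gt0); move: dm'; lia.
  have dE := partnC p d_gt0; have mE' := partnC p m_gt0.
  rewrite -dE -mE' !p_part vda ma dvdn_pmul2l ?expn_gt0 ?(prime_gt0 p_prime)//.
  have : (d`_p^' %| n`_p^')%N by apply: partn_dvd.
  rewrite /n partnM ?expn_gt0 ?(prime_gt0 p_prime)//.
  rewrite (_ : (p ^ j)`_p^' = 1)%N ?muln1//.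
  by apply: part_p'nat; rewrite pnatNK pnatX pnat_id.
have {}ud : unorm (lam f d) <= unorm (p%:R : K).
  by apply: (unorm_lt1_le p_prime K_padic K_unram); rewrite lt_neqAle ud lam_int.
have q_gt : (a < n %/ d)%N.
  have : (p ^ j %| n %/ d)%N.
    rewrite pfactor_dvdn// ?divn_gt0 ?(dvdn_leq n_gt0 dn)//.
    rewrite logn_div// /n lognM ?expn_gt0 ?(prime_gt0 p_prime)// pfactorK// ma.
    by rewrite addnC -addnBA// leq_addr.
  move=> /dvdn_leq; rewrite divn_gt0// (dvdn_leq n_gt0 dn) => /(_ isT).
  by apply: leq_trans; apply: leq_trans pj; rewrite /j ltnS leq_addl.
apply: (@le_lt_trans _ _ (unorm (p%:R : K) ^+ (n %/ d))); last by rewrite ltr_iXn2l.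
rewrite -[leRHS]mul1r; apply: ler_pM; rewrite ?exprn_ge0 ?unorm_ge0 ?exprn_ile1 ?(ltW up0) ?(ltW up1)//.
by rewrite powE lerXn2r ?nnegrE ?unorm_ge0.
Qed.

(* If exp (sum l_n X^n) is integral and n l_n tends to 0, then its factors
   1 - lam m X^m are trivial modulo p, hence their logarithms are divisible by p. *)
Lemma log_div_p :
  (forall e : R, 0 < e -> exists N, forall n, (N <= n)%N -> unorm (n%:R * l n) <= e) ->
  forall n, (0 < n)%N -> unorm (l n) <= unorm (p%:R : K).
Proof.
move=> small n n0.
have up0 := unorm_p_gt0 p_prime K_padic; have up1 := unorm_p_lt1 p_prime K_padic.
have lam_p m : (0 < m)%N -> unorm (lam f m) <= unorm (p%:R : K).
  move=> m0; apply: (unorm_lt1_le p_prime K_padic K_unram).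
  rewrite lt_neqAle lam_int andbT; apply/eqP => um.
  exact: exists_unit_lam_absurd m0 um small.
have nn0 : n%:R != 0 :> K by case: n n0 => // n _; exact: natK.
have -> : l n = n%:R^-1 * (n%:R * l n) by rewrite mulrA mulVf// mul1r.
rewrite ghostE// mulrN unormN mulr_sumr.
apply: unorm_sum_le; first exact: unorm_ge0.
move=> [d' d'n] /= _ dn; set d := d'.+1 in dn *; have d_gt0 : (0 < d)%N by [].
have := divnK dn; set q := (n %/ d)%N => nE.
have q0 : (0 < q)%N by rewrite divn_gt0// dvdn_leq.
have dK : d%:R != 0 :> K by exact: natK.
rewrite -nE natrM invfM mulrA -[_ * d%:R^-1 * d%:R]mulrA mulVf// mulr1.
rewrite unormM unormV (unorm_nat_p p_prime K_padic q0).
have powE i : unorm (lam f d ^+ i) = unorm (lam f d) ^+ i.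
  by elim: i => [|i IH]; rewrite ?expr0 ?unorm1// !exprS unormM IH.
rewrite powE mulrC ler_pdivrMr ?exprn_gt0// -exprS.
apply: (@le_trans _ _ (unorm (p%:R : K) ^+ q)).
  by rewrite lerXn2r ?nnegrE ?unorm_ge0// lam_p.
(* It remains to see that 1 + v(q) <= q, where 1 + v(q) collects the target |p| and the denominator
   q. *)
rewrite ler_wiXn2l ?(ltW up0) ?(ltW up1)//.
have := logn_upper p_prime q.-1; rewrite prednK//.
by have := prime_gt1 p_prime; nia.
Qed.

End LogarithmDivisibility.

(** * Decomposition of solvable modules *)

Section Decomposition.
Context {R : realType} {K : completeUltrametricFieldType R}.
Variable p : nat.
Hypothesis p_prime : prime p.
Hypothesis K_padic : contains_Qp p K.
Hypothesis K_unram : unramified p K.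
Implicit Types (g h u : robba K) (a : K).

Let natK := natK_neq0 p_prime K_padic.
Let w := @omega R K p.
Let w0 : 0 < w. Proof. exact: omega_gt0 p_prime K_padic. Qed.
Let w1 : w < 1. Proof. exact: omega_lt1 p_prime K_padic. Qed.

Lemma is_robba_restrict (P : pred int) g : is_robba (fun n => if P n then g n else 0).
Proof.
have [e e01 he] := robba_radius g; apply/is_robbaP; exists e => // rho rho1.
have [c hc] := he rho rho1; exists c => n; case: ifP => // _.
by rewrite unorm0 mul0r; apply: gbound_ge0 hc; lra.
Qed.

Definition restrict P g : robba K := mk_robba (is_robba_restrict P g).

Lemma restrictE P g n : restrict P g n = if P n then g n else 0.
Proof. by []. Qed.

Lemma rsupp_restrict P g : rsupp P (restrict P g).
Proof. by move=> n /negPf h; rewrite restrictE h. Qed.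

Lemma side_logN s g n : side_log s (- g) n = - side_log s g n.
Proof. by rewrite /side_log rcoefN mulrN. Qed.

(** For large n the decay already beats [w]. For the finitely many others, the room between [eps]
    and [w] allows a ratio k < 1 close to 1. *)
Lemma geo_interpolate (b : nat -> R) (eps D s : R) : 0 <= D -> 0 < s < 1 -> eps < w ->
  (forall n, b n <= eps) -> (forall n, b n <= D * s ^+ n) ->
  exists2 t, 0 < t < 1 & forall n, b n <= w * t ^+ n.
Proof.
move=> D0 s01 ew be bs; pose t := (s + 1) / 2.
have tP : s < t < 1 by rewrite /t; lra.
clearbody t; have t0 : 0 < t by lra.
have st : 0 < s / t < 1 by rewrite divr_gt0 ?ltr_pdivrMr//; lra.
have [N hN] := geo_small D0 st w0.
pose e := Num.max eps (w / 2).
have e0 : 0 < e by rewrite lt_max divr_gt0 ?orbT.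
have we : e < w by rewrite gt_max ew/= ltr_pdivrMr// ltr_pMr// ltr1n.
have [|k k01 hk] := @shrink_factor _ (w / e) N; first by rewrite ltr_pdivlMr// mul1r.
have kt : k <= Num.max k t by rewrite le_max lexx.
have tt : t <= Num.max k t by rewrite le_max lexx orbT.
have m1 : Num.max k t < 1 by rewrite gt_max; apply/andP; split; lra.
exists (Num.max k t); first by rewrite (lt_le_trans t0 tt).
move=> n; have [nN|Nn] := leqP N n.
  apply: (le_trans (bs n)); have := hN n nN; rewrite expr_div_n mulrA ler_pdivrMr ?exprn_gt0// => h.
  apply: (le_trans h); rewrite ler_wpM2l ?(ltW w0)// lerXn2r ?nnegrE//; lra.
apply: (le_trans (be n)); apply: (@le_trans _ _ (w * k ^+ N)).
  apply: (@le_trans _ _ e); first by rewrite le_max lexx.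
  by move: hk; rewrite mulrAC ltr_pdivlMr// mul1r => /ltW.
rewrite ler_wpM2l ?(ltW w0)//; apply: (@le_trans _ _ (k ^+ n)).
  by rewrite ler_wiXn2l ?(ltnW Nn)//; lra.
by rewrite lerXn2r ?nnegrE//; lra.
Qed.

Lemma robba_geo_neg g : exists D t, [/\ 0 <= D, 0 < t < 1 &
  forall n, unorm (g (- n%:Z)) <= D * t ^+ n].
Proof.
have [e e01 he] := robba_radius g.
have [|c hc] := he (1 - e / 2); first lra.
have r0 : 0 < 1 - e / 2 by lra.
exists c, (1 - e / 2); split; [exact: gbound_ge0 hc|lra|move=> n].
by have := hc (- n%:Z); rewrite -exprnN ler_pdivrMr ?exprn_gt0.
Qed.

Lemma side_log0 s g : side_log s g 0 = 0.
Proof. by rewrite /side_log /sg if_same invr0 mul0r. Qed.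

Lemma side_log_norm g n : unorm (side_log true g n) <= n%:R * unorm (g (- n%:Z)).
Proof.
case: n => [|n]; first by rewrite side_log0 unorm0 mulr0n mul0r.
rewrite /side_log unormM ler_wpM2r ?unorm_ge0// /sg mulrNz invrN unormN.
exact: (unorm_natV K_padic).
Qed.

Lemma pic_rel0 g : pic_rel g 0 <-> exists u v, u * v = 1 /\ robba_theta u = g * u.
Proof.
by split=> [/pic_relP|] [u [v [uv hu]]]; [|apply/pic_relP]; exists u, v; move: hu;
  rewrite mulr0 addr0.
Qed.

(** A uniform bound strictly below omega combines with the decay of [g] into a bound [w * k ^+ n]
    with k < 1. The exponentials of the logarithm and of its opposite then converge for |T| > k. *)
Lemma trivial_neg g eps : rsupp (strict_side true) g -> eps < w ->
  (forall n, unorm (side_log true g n.+1) <= eps) -> pic_rel g 0.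
Proof.
move=> hg ew he; have [D [t [D0 t01 hD]]] := robba_geo_neg g.
have eps0 : 0 <= eps by apply: le_trans (he 0); exact: unorm_ge0.
have [B [s [B0 ts hB]]] := nat_geo_shift t01.
have s01 : 0 < s < 1 by lra.
pose b n := unorm (side_log true g n).
have [| | |k k01 hk] := @geo_interpolate b eps (D * B) s _ s01 ew.
- exact: mulr_ge0.
- by case=> [|n]; [rewrite /b side_log0 unorm0|exact: he].
- move=> n; apply: le_trans (side_log_norm g n) _.
  apply: (@le_trans _ _ (n%:R * (D * t ^+ n))); first by rewrite ler_wpM2l.
  by rewrite mulrCA -!mulrA ler_wpM2l.
have exp_geo f : (forall n, unorm (f n) <= b n) ->
    is_robba (side_coef true (expc (inv_succ K) f)).
  move=> hf; apply: (@is_robba_side_geo _ _ _ _ 1 k k01) => -[|n].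
    by rewrite expc0 unorm1 expr0 mulr1.
  rewrite mul1r; apply: (@le_trans _ _ (w * k ^+ n.+1)).
    apply: (unorm_expc p_prime K_padic); first by rewrite lexx (ltW w0).
      by case/andP: k01 => /ltW.
    by move=> j; apply: le_trans (hf _) _; exact: hk.
  by rewrite ler_piMl ?(ltW w1)// exprn_ge0//; case/andP: k01 => /ltW.
apply/pic_rel0; apply: (@side_unit _ _ natK true g) => //; apply: exp_geo => n //.
by rewrite side_logN unormN.
Qed.

(** In nonnegative degrees integral coefficients already give convergence on the open unit disc. *)
Lemma trivial_pos g : rsupp (strict_side false) g -> (forall i, rintegral (zt g i)) ->
  pic_rel g 0.
Proof.
move=> hg hz; apply/pic_rel0; apply: (@side_unit _ _ natK false g) => //.
  by apply: (@is_robba_side_pos _ _ _ 1); exact: (side_integral p_prime K_padic).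
apply: (@is_robba_side_pos _ _ _ 1); apply: (side_integral p_prime K_padic).
  by move=> n /hg; rewrite rcoefN => ->; rewrite oppr0.
exact: zt_integralN.
Qed.

Definition fall (x : K) n := \prod_(k < n) (x - k%:R).

Lemma fallD x m n : fall x (m + n) = fall x m * fall (x - m%:R) n.
Proof.
rewrite /fall big_split_ord/=; congr (_ * _); apply: eq_bigr => k _.
by rewrite natrD opprD addrA.
Qed.

Lemma zt_const a i : (i`!)%:R * zt (robba_const a) i 0 = fall a i.
Proof.
elim: i => [|i IH]; first by rewrite zt0 rcoef1 eqxx /fall big_ord0 mulr1.
rewrite factS natrM mulrAC -robba_mulrn (ztS natK).
have -> : robba_const a - i%:R = robba_const (a - i%:R).
  by rewrite rmorphB rmorph_nat.
rewrite rcoefD rcoef_theta mul0r add0r rcoefZ mulrC mulrA [_ * (a - _)]mulrC -mulrA IH.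
by rewrite mulrC /fall [RHS]big_ord_recr.
Qed.

Lemma rsupp_const a : rsupp (pred1 0) (robba_const a).
Proof. by move=> n h; rewrite rcoef_monom (negPf (h : n != 0)). Qed.

Lemma zt_const_supp a i : rsupp (pred1 0) (zt (robba_const a) i).
Proof.
case: i => [|i].
  by move=> n h; rewrite zt0 rcoef1 (negPf (h : n != 0)).
apply: (zt_supp natK) => [x y|]; last exact: rsupp_const.
by move=> /eqP -> /eqP ->.
Qed.

(** All binomial coefficients of [a] are integral; for an unramified [K] this characterizes Z_p. *)
Definition fall_small a := forall i, unorm (fall a i) <= unorm ((i`!)%:R : K).

Lemma zt_const_integral a : (forall i, rintegral (zt (robba_const a) i)) <-> fall_small a.
Proof.
have f0 i : 0 < unorm ((i`!)%:R : K).
  by rewrite lt_def unorm_eq0 (natK_fact_neq0 natK) ?unorm_ge0.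
split=> h i.
  rewrite -zt_const unormM ler_piMr ?unorm_ge0//; exact: h.
move=> n; have [->|n0] := eqVneq n 0; last by rewrite zt_const_supp ?unorm0.
have := h i; rewrite -zt_const unormM -ler_pdivlMl//.
by rewrite mulVf ?gt_eqF.
Qed.

Lemma fall_small_int (n : int) : fall_small n%:~R.
Proof.
move=> i; have -> : fall n%:~R i = (ibin n i)%:~R * (i`!)%:R :> K.
  have -> : (i`!)%:R = ((i`!)%:Z)%:~R :> K by [].
  rewrite -intrM ibinE rmorph_prod/=; apply: eq_bigr => k _.
  by rewrite intrB.
by rewrite unormM ler_piMl ?unorm_ge0 ?unorm_int_le1.
Qed.

(** Vandermonde's convolution, obtained here from [ztD] for constants. *)
Lemma fall_smallB a (n : int) : fall_small a -> fall_small (a - n%:~R).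
Proof.
move=> /zt_const_integral ha; apply/zt_const_integral; rewrite rmorphB.
apply: zt_integralD => //; apply: zt_integralN => //.
exact/zt_const_integral/fall_small_int.
Qed.

Lemma prod_close (u v : nat -> K) (e : R) m : 0 <= e -> (forall k, unorm (u k) <= 1) ->
  (forall k, unorm (v k) <= 1) -> (forall k, unorm (u k - v k) <= e) ->
  unorm (\prod_(k < m) u k - \prod_(k < m) v k) <= e.
Proof.
move=> e0 hu hv huv; elim: m => [|m IH]; first by rewrite !big_ord0 subrr unorm0.
have prod1 : unorm (\prod_(k < m) v k) <= 1.
  elim/big_ind: _ => [|x y hx hy|k _]; [by rewrite unorm1| |exact: hv].
  by rewrite unormM mulr_ile1 ?unorm_ge0.
rewrite !big_ord_recr /=; set P := \prod_(k < m) u k in IH *; set Q := \prod_(k < m) v k in IH prod1 *.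
rewrite (_ : P * u m - Q * v m = (P - Q) * u m + Q * (u m - v m)); last by ring.
rewrite unormD_le// unormM.
  by rewrite (le_trans _ IH)// ler_piMr ?unorm_ge0.
by rewrite (le_trans _ (huv m))// ler_piMl ?unorm_ge0.
Qed.

Lemma padic_int_le1 a : a \in @padic_int_pred R K -> unorm a <= 1.
Proof.
move=> /asboolP /(_ 1 ltr01)[n hn]; rewrite -[a](subrK n%:~R).
by rewrite unormD_le ?unorm_int_le1// ltW.
Qed.

Lemma padic_int_fall_small a : a \in @padic_int_pred R K -> fall_small a.
Proof.
move=> ha i; have a1 := padic_int_le1 ha; move/asboolP: ha => ha.
have fi : 0 < unorm ((i`!)%:R : K).
  by rewrite lt_def unorm_eq0 (natK_fact_neq0 natK) ?unorm_ge0.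
have [n hn] := ha _ fi.
rewrite -[fall a i](subrK (fall n%:~R i)) unormD_le//; last exact: fall_small_int.
apply: (@prod_close (fun k => a - k%:R) (fun k => n%:~R - k%:R)); first exact: ltW.
- by move=> k; rewrite unormB_le// unorm_nat_le1.
- by move=> k; rewrite unormB_le ?unorm_nat_le1 ?unorm_int_le1.
- by move=> k; rewrite opprB addrA subrK ltW.
Qed.

(** Of the p factors p b - p i - k with 0 <= k < p, only the one with k = 0 can fail to be a unit,
    and it is p (b - i). *)
Lemma fall_mulp (b : K) i : unorm b <= 1 ->
  unorm (fall (p%:R * b) (p * i)) = unorm (p%:R : K) ^+ i * unorm (fall b i).
Proof.
move=> b1; elim: i => [|i IH]; first by rewrite muln0 /fall !big_ord0 unorm1 mulr1.
rewrite mulnS addnC fallD unormM IH.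
have -> : fall b i.+1 = fall b i * (b - i%:R) by rewrite /fall big_ord_recr.
have -> : p%:R * b - (p * i)%:R = p%:R * (b - i%:R) by rewrite natrM -mulrBr.
have -> : unorm (fall (p%:R * (b - i%:R)) p) = unorm (p%:R : K) * unorm (b - i%:R).
  have up1 := unorm_p_lt1 p_prime K_padic.
  set y := p%:R * (b - i%:R).
  rewrite -[X in fall y X](prednK (prime_gt0 p_prime)) -add1n fallD unormM -[RHS]mulr1.
  congr (_ * _); first by rewrite /fall big_ord1 subr0 unormM.
  have unit_term (k : 'I_p.-1) : unorm (y - 1 - k%:R) = 1.
    rewrite -addrA -opprD nat1r.
    have uk : unorm (k.+1%:R : K) = 1.
      rewrite (unorm_nat_p p_prime K_padic (ltn0Sn k)) (_ : logn p k.+1 = 0)%N ?expr0//.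
      by apply/eqP; rewrite -leqn0 leqNgt logn_gt0 mem_primes p_prime/= gtnNdvd//;
        case: k => k /=; lia.
    rewrite -[RHS]uk -[in RHS]unormN; apply: unorm_close; rewrite opprK subrK unormN uk /y unormM.
    apply: le_lt_trans up1; rewrite ler_piMr ?unorm_ge0//.
    by rewrite unormB_le// unorm_nat_le1.
  rewrite /fall; elim/big_ind: _ => [|x z hx hz|k _]; [by rewrite unorm1| |exact: unit_term].
  by rewrite unormM hx hz mulr1.
by rewrite exprS !unormM; ring.
Qed.

Lemma fact_mulp i : unorm (((p * i)`!)%:R : K) = unorm (p%:R : K) ^+ i * unorm ((i`!)%:R : K).
Proof.
rewrite (unorm_nat_p p_prime K_padic (fact_gt0 _)) logn_fact_rec// mulKn ?prime_gt0//.
by rewrite exprD -(unorm_nat_p p_prime K_padic (fact_gt0 _)).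
Qed.

(** The p-adic digits are found one at a time. Since |fall b p| <= |p!| < 1, some j < p satisfies |b
    - j| < 1; the norm gap makes (b - j) / p integral, and [fall_mulp] shows that it inherits the
    hypothesis. *)
Lemma fall_small_padic_int a : fall_small a -> a \in @padic_int_pred R K.
Proof.
move=> ha; have up0 := unorm_p_gt0 p_prime K_padic; have up1 := unorm_p_lt1 p_prime K_padic.
have key m : forall b, fall_small b -> exists n : nat, unorm (b - n%:R) <= unorm (p%:R : K) ^+ m.
  elim: m => [|m IH] b hb.
    by exists 0%N; rewrite subr0 expr0; have := hb 1; rewrite /fall big_ord1 subr0 unorm1.
  have [j hj] : exists j : 'I_p, unorm (b - j%:R) < 1.
    apply: contrapT => hno.
    have : unorm (fall b p) <= unorm (p%:R : K).
      apply: (le_trans (hb p)); have := fact_mulp 1; rewrite muln1 (_ : 1`! = 1)%N // unorm1 expr1 mulr1.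
      by move=> ->.
    suff -> : unorm (fall b p) = 1 by rewrite leNgt up1.
    rewrite /fall; elim/big_ind: _ => [|x y hx hy|k _]; first by rewrite unorm1.
      by rewrite unormM hx hy mulr1.
    apply/eqP; rewrite eq_le; apply/andP; split; last first.
      by rewrite leNgt; apply/negP => hk; apply: hno; exists k.
    rewrite unormB_le ?unorm_nat_le1//.
    by have := hb 1; rewrite /fall big_ord1 subr0 unorm1.
  pose c := (b - j%:R) / p%:R.
  have p0 : p%:R != 0 :> K by rewrite -unorm_eq0 gt_eqF.
  have cE : b - j%:R = p%:R * c by rewrite mulrC divfK.
  have c1 : unorm c <= 1.
    rewrite /c unormM unormV ler_pdivrMr// mul1r.
    exact: (unorm_lt1_le p_prime K_padic K_unram).
  have hc : fall_small c.
    move=> i; have := fall_smallB j%:Z hb; rewrite [(j%:Z)%:~R](_ : _ = j%:R)// cE.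
    move=> /(_ (p * i)%N); rewrite fall_mulp// fact_mulp.
    by rewrite ler_pM2l ?exprn_gt0.
  have [n hn] := IH _ hc; exists (j + p * n)%N.
  rewrite natrD natrM opprD addrA cE -mulrBr unormM exprS.
  by rewrite ler_wpM2l ?unorm_ge0.
apply/asboolP => e e0.
have up01 : 0 < unorm (p%:R : K) < 1 by rewrite up0.
have e20 : 0 < e / 2 by rewrite divr_gt0.
have [m hm] := geo_small ler01 up01 e20.
have [n hn] := key m a ha; exists n%:Z.
apply: (le_lt_trans hn); have := hm m (leqnn _); rewrite mul1r => /le_lt_trans; apply.
by rewrite ltr_pdivrMr// ltr_pMr// ltr1n.
Qed.

Definition negpart g := restrict (strict_side true) g.

Lemma robba_decomp g :
  g = restrict (strict_side false) g + (robba_const (g 0) + negpart g).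
Proof.
apply: robba_ext => n; rewrite !rcoefD !restrictE rcoef_monom /strict_side.
by case: ltgtP => [n0|n0|<-]; rewrite ?mulr0n ?mulr1n ?add0r ?addr0.
Qed.

Lemma solvable_decomp g : solvable_op p g ->
  [/\ g 0 \in @padic_int_pred R K, pic_rel g (robba_const (g 0) + negpart g) &
      forall n, unorm (side_log true (negpart g) n.+1) <= unorm (p%:R : K)].
Proof.
move=> /(solvable_integral p_prime K_padic) hz.
have hz' i : rintegral (zt (restrict (strict_side false) g +
    (robba_const (g 0) + negpart g)) i) by rewrite -robba_decomp.
have s1 : rsupp (strict_side false) (restrict (strict_side false) g) by exact: rsupp_restrict.
have s2 : rsupp (strict_side true) (negpart g) by exact: rsupp_restrict.
have s3 := rsupp_const (g 0).
have s4 : rsupp (fun n => n <= 0) (robba_const (g 0) + negpart g).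
  apply: rsuppD; first by apply: rsuppW s3 => n /eqP ->.
  by apply: rsuppW s2 => n /ltW.
have h1 := zt_integral_split natK (@strict_sideD false) _ _ s1 s4 hz'.
have {}h1 i := h1 ltac:(lia) ltac:(rewrite /strict_side; lia) i.
have h2 := zt_integral_split natK _ (@strict_sideD true) _ s3 s2 (fun i => (h1 i).2).
have {}h2 i := h2 ltac:(by move=> x y /eqP -> /eqP ->; rewrite /= addr0)
  ltac:(by move=> x /eqP ->) i.
split.
- by apply: fall_small_padic_int; apply/zt_const_integral => i; exact: (h2 i).1.
- have := pic_relD (trivial_pos s1 (fun i => (h1 i).1))
    (pic_rel_refl (robba_const (g 0) + negpart g)).
  by rewrite -robba_decomp add0r.
- move=> n; apply: (log_div_p p_prime K_padic K_unram) => //.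
    by apply: (side_integral p_prime K_padic s2) => i; exact: (h2 i).2.
  (* Up to sign, n l_n is the coefficient of T^-n in [g], which decays geometrically. *)
  move=> e e0; have [D [t [D0 t01 hD]]] := robba_geo_neg (negpart g).
  have [N hN] := geo_small D0 t01 e0; exists N.+1 => -[//|m] mN.
  have := side_logE natK true (negpart g) m; rewrite /sg mulrNz mulNr => /eqP.
  rewrite eqr_oppLR => /eqP ->; rewrite unormN; apply: (le_trans (hD _)).
  by apply: hN; exact: ltnW.
Qed.

End Decomposition.

(** * Moderate classes *)

Section QuotientLift.
Variables (A B : zmodType) (S : set A) (f : {additive A -> B}).
Hypothesis S_closed : zmod_closed (mem S).
Hypothesis kerf : forall x, S x -> f x = 0.

Lemma zclass_S x y : zclass S x = zclass S y <-> S (x - y).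
Proof. by rewrite zclass_eq zspan_id// inE. Qed.

Lemma zclass_repr (x : zquot S) : zclass S (repr x) = x.
Proof. exact: reprK. Qed.

Definition zlift (x : zquot S) : B := f (repr x).

Lemma zliftE x : zlift (zclass S x) = f x.
Proof.
apply/eqP; rewrite -subr_eq0 -raddfB; apply/eqP/kerf/zclass_S.
exact: zclass_repr.
Qed.

Lemma zclassB x y : zclass S (x - y) = zclass S x - zclass S y.
Proof. exact: (raddfB (\pi_(zquot S))). Qed.

Lemma zlift_is_zmod : zmod_morphism zlift.
Proof.
move=> x y; rewrite -[x in LHS]zclass_repr -[y in LHS]zclass_repr.
by rewrite -zclassB zliftE raddfB.
Qed.

HB.instance Definition _ := GRing.isZmodMorphism.Build (zquot S) B zlift zlift_is_zmod.

Lemma zquot_factor : exists Phi : {additive zquot S -> B}, forall x, Phi (zclass S x) = f x.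
Proof. by exists zlift => x; exact: zliftE. Qed.

Lemma zclass_eq0 x : zclass S x = 0 <-> S x.
Proof.
have -> : 0 = zclass S 0 by rewrite -[in RHS](subrr 0) zclassB subrr.
by rewrite zclass_S subr0.
Qed.

End QuotientLift.

Section ModerateClasses.
Context {R : realType} {K : completeUltrametricFieldType R}.
Variable p : nat.
Hypothesis p_prime : prime p.
Hypothesis K_padic : contains_Qp p K.
Hypothesis K_unram : unramified p K.
Implicit Types (g h u : robba K) (a : K).

Lemma pic_classE g h : pic_class g = pic_class h <-> pic_rel g h.
Proof. by rewrite pic_class_eq; split=> [h0|/asboolP//]; apply/asboolP. Qed.

Lemma pic_class0 g : pic_class g = 0 <-> pic_rel g 0.
Proof. by rewrite -pic_classE raddf0. Qed.

Lemma robba_unit_neq0 u v : u * v = 1 -> exists n, u n != 0.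
Proof.
move=> uv; apply: contrapT => h.
have u0 : u = 0.
  by apply: robba_ext => n; apply/eqP; apply: contrapT => /negP un; apply: h; exists n.
by have /eqP := uv; rewrite u0 mul0r eq_sym (negPf (oner_neq0 _)).
Qed.

(** Theta multiplies degree n by n, so any nonzero coefficient of a solution determines the
    exponent. *)
Lemma const_trivial a : pic_rel (robba_const a) 0 <-> exists n : int, a = n%:~R.
Proof.
rewrite pic_rel0; split=> [[u [v [uv hu]]]|[n ->]].
  have [n un] := robba_unit_neq0 uv; exists n.
  have := rcoef_theta u n; rewrite hu rcoefZ => h.
  exact: (mulIf un h).
exists (robba_monom 1 n), (robba_monom 1 (- n)); split.
  by rewrite robba_monomM mulr1 subrr.
by rewrite robba_theta_monom.
Qed.

Lemma solvable_const a : a \in @padic_int_pred R K -> solvable_op p (robba_const a).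
Proof.
move=> /(padic_int_fall_small p_prime K_padic) /(zt_const_integral p_prime K_padic) ha.
apply: (@integral_solvable _ _ _ p_prime K_padic _ 0%N) => // i n n0.
apply: (zt_const_supp p_prime K_padic); move: n0; rewrite mul0n oppr0 /=.
by rewrite lt_neqAle => /andP[].
Qed.

Lemma solvable_rank1 g : solvable_op p g -> solvable p (rank1 g).
Proof. by exists g => //; exact: rank1_defined_by. Qed.

Lemma solvable_rank1_class g : solvable p (rank1 g) ->
  exists2 h, solvable_op p h & pic_class g = pic_class h.
Proof.
move=> [h hd hs]; exists h => //; apply/esym/pic_class_eq.
exact: defined_by_rank1.
Qed.

Lemma diffmod_iso_sym M N : @diffmod_iso R K M N -> diffmod_iso N M.
Proof.
move=> [phi [[psi phiK psiK] hphi]].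
have lpsi : linear psi.
  by move=> a x y; apply: (can_inj phiK); rewrite linearP !psiK.
pose L : {linear N -> M} := HB.pack psi (GRing.isLinear.Build _ _ _ _ _ lpsi).
exists L; split; first by exists phi.
by move=> x; apply: (can_inj phiK); rewrite hphi !psiK.
Qed.

Lemma diffmod_iso_trans M N P : @diffmod_iso R K M N -> diffmod_iso N P -> diffmod_iso M P.
Proof.
move=> [f [bf hf]] [g [bg hg]]; exists (g \o f); split; first exact: bij_comp.
by move=> x /=; rewrite hf hg.
Qed.

Lemma defined_by_iso M g h : @defined_by R K M g -> diffmod_iso (rank1 g) (rank1 h) ->
  defined_by M h.
Proof.
move=> hM; have := diffmod_iso_trans (diffmod_iso_sym _) (defined_by_rank1 hM).
move=> /(_ (rank1 h)) H gh; have [phi [[psi phiK psiK] hphi]] := H gh.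
pose one : rank1 h := (1 : robba K).
have oneE (f : robba K) : f *: one = f by exact: (mulr1 f).
exists (phi one); split=> [x|].
  exists (psi x); split; first by rewrite -linearZZ oneE psiK.
  by move=> f ->; rewrite -linearZZ oneE phiK.
rewrite -hphi -linearZZ oneE; congr (phi _).
by rewrite /nabla /= /rank1_nabla robba_theta1 add0r mul1r.
Qed.

Definition padic_class (a : padic_int K) : picard K := pic_class (robba_const (a : K)).

Lemma padic_class_is_zmod : zmod_morphism padic_class.
Proof. by move=> a b; rewrite /padic_class -raddfB -rmorphB. Qed.

HB.instance Definition _ :=
  GRing.isZmodMorphism.Build (padic_int K) (picard K) padic_class padic_class_is_zmod.

Definition integers : set (padic_int K) := [set x | exists n : int, (x : K) = n%:~R].

Lemma integers_closed : zmod_closed (mem integers).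
Proof.
split; first by rewrite inE; exists 0.
move=> x y; rewrite !inE => -[m xm] [n yn]; exists (m - n).
by rewrite intrB -xm -yn.
Qed.

Lemma padic_class_eq0 (a : padic_int K) : padic_class a = 0 <-> integers a.
Proof. by rewrite pic_class0 const_trivial. Qed.

Hypothesis p_gt2 : (2 < p)%N.

Lemma solvable_op_const g : solvable_op p g ->
  g 0 \in @padic_int_pred R K /\ pic_rel g (robba_const (g 0)).
Proof.
move=> /(solvable_decomp p_prime K_padic K_unram)[g0 hg hl]; split=> //.
apply: pic_rel_trans hg _; rewrite -[X in pic_rel _ X]addr0.
apply: pic_relD; first exact: pic_rel_refl.
apply: (trivial_neg p_prime K_padic _ _ hl); last exact: p_lt_omega.
exact: rsupp_restrict.
Qed.

Lemma pic_sol_odd : exists Phi : {additive padic_int_modZ K -> picard K},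
  [/\ injective Phi, range Phi = pic_sol p &
      forall a : padic_int K, Phi (zclass _ a) = pic_class (robba_const (a : K))].
Proof.
have ker (x : padic_int K) : integers x -> padic_class x = 0 by move=> /padic_class_eq0.
have [Phi PhiE] := zquot_factor integers_closed ker; exists Phi; split.
- apply: raddf_inj => x; rewrite -[x](zclass_repr (S := integers)) PhiE.
  by move=> /padic_class_eq0 h; apply/(zclass_eq0 integers_closed).
- apply/seteqP; split=> [_ [x _ <-]|c [g [hg ->]]].
    rewrite -[x](zclass_repr (S := integers)) PhiE.
    exists (robba_const (repr x : K)); split=> //.
    by apply/solvable_rank1/solvable_const; case: (repr x).
  have [h hh ->] := solvable_rank1_class hg.
  have [h0 hc] := solvable_op_const hh.
  exists (zclass integers (PadicInt h0)) => //.
  by rewrite PhiE; apply/esym/pic_classE.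
- exact: PhiE.
Qed.

(** The isomorphism of rank one models is transported to a new basis of M itself, in which the
    operator has constant coefficient. *)
Lemma solvable_moderate (M : diffmod K) : solvable p M -> moderate p M.
Proof.
move=> hM; split=> //; have [g hd hs] := hM.
have [_ hc] := solvable_op_const hs; exists (g 0).
by apply: defined_by_iso hd _; apply/asboolP.
Qed.

End ModerateClasses.

(** * Artin-Schreier theory of Laurent series *)

Section Complement.
Variables (A : zmodType) (B : {pred A}).
Hypothesis A2 : forall x : A, x + x = 0.
Hypothesis B_closed : zmod_closed B.

Let oppA x : - x = x :> A.
Proof. by apply/eqP; rewrite eq_sym -addr_eq0 A2. Qed.

Let B0 : 0 \in B. Proof. exact: B_closed.1. Qed.

Let BD x y : x \in B -> y \in B -> x + y \in B.
Proof. by move=> xB yB; rewrite -[y]oppA; exact: B_closed.2. Qed.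

(* e is the projection onto a complement of B. *)
Lemma complement_projection : exists e : A -> A,
  [/\ {morph e : x y / x + y}, forall x, x \in B -> e x = 0 & forall x, e x - x \in B].
Proof.
pose P (C : set A) := (forall x y, C x -> C y -> C (x + y)) /\
  (forall x, C x -> x \in B -> x = 0).
have [C [[CD CB] Cmax]] : exists C, P C /\ forall D, C `<` D -> ~ P D.
  apply: Zorn_bigcup => F FP tot; split=> [x y [X FX Xx] [Y FY Yy]|x [X FX Xx] xB].
    have [XY|YX] := tot X Y FX FY.
      by exists Y => //; apply: (FP _ FY).1 => //; exact: XY.
    by exists X => //; apply: (FP _ FX).1 => //; exact: YX.
  exact: (FP _ FX).2 x Xx xB.
(* [P] cannot require 0, since it must hold for the union of the empty chain; 0 is added back
   here. *)
pose C0 x := C x \/ x = 0.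
have C0D x y : C0 x -> C0 y -> C0 (x + y).
  by move=> [Cx|->] [Cy|->]; rewrite ?addr0 ?add0r; [left; apply: CD|left|left|right].
have C0B x : C0 x -> x \in B -> x = 0 by move=> [/CB|].
have /choice[e he] : forall x, exists c, C0 c /\ c - x \in B.
  move=> x; apply: contrapT => hx.
  have xx : x - x = 0 := subrr x.
  apply: (Cmax (fun y => C0 y \/ C0 (y - x))).
    split=> [y Cy|h]; first by left; left.
    apply: hx; exists x; rewrite xx; split=> //; left; apply: h.
    by right; rewrite xx; right.
  split=> [y z [Cy|Cy] [Cz|Cz]|y [Cy|Cy] yB].
  - by left; exact: C0D.
  - by right; rewrite -addrA; exact: C0D.
  - by right; rewrite addrAC; exact: C0D.
  - left; have := C0D _ _ Cy Cz; rewrite addrACA -opprD A2 subr0//.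
  - exact: C0B.
  - by case: hx; exists (y - x); rewrite -addrA -opprD A2 subr0.
exists e; split=> [x y|x xB|x]; last exact: (he x).2.
  apply/eqP; rewrite -subr_eq0; apply/eqP/C0B.
    by rewrite oppA; apply: (C0D); [exact: (he _).1|apply: (C0D); exact: (he _).1].
  have -> : e (x + y) - (e x + e y) = e (x + y) - (x + y) - ((e x - x) + (e y - y)).
    by rewrite [in RHS]addrACA -opprD opprB addrA subrK.
  apply: B_closed.2; first exact: (he _).2.
  by apply: BD; exact: (he _).2.
apply: (C0B _ (he x).1); rewrite -[e x](subrK x); exact: BD (he x).2 xB.
Qed.
End Complement.

(** * Squares and sums symmetric under i -> n - i *)

Section SymmetricSums.
Variable A : comNzRingType.
Implicit Types (u : int -> A) (F : {fset int}).

Definition sym_closure (n : int) F : {fset int} := (F `|` [fset n - i | i in F])%fset.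

Lemma sym_closureP n F i : i \in sym_closure n F -> n - i \in sym_closure n F.
Proof.
rewrite !inE => /orP[iF|/imfsetP[j /= jF ->]]; apply/orP.
  by right; apply/imfsetP; exists i.
by left; rewrite subKr.
Qed.

(** Off-diagonal terms come in equal pairs. Hence the sum reduces to its diagonal in characteristic
    two, and modulo 2 over the integers of [K]. *)
Lemma sym_sum u n F : (forall i, i \in F -> n - i \in F) ->
  \sum_(i <- F) u i * u (n - i) =
  (\sum_(i <- F | i < n - i) u i * u (n - i)) *+ 2 + \sum_(i <- F | i == n - i) u i * u i.
Proof.
move=> hF; rewrite (bigID (fun i => i < n - i))/= mulr2n -addrA; congr (_ + _).
rewrite (bigID (fun i => i == n - i))/= addrC; congr (_ + _); last first.
  rewrite [LHS]big_mkcond [RHS]big_mkcond /=; apply: eq_bigr => i _.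
  case: (i =P n - i) => [<-|_]; first by rewrite ltxx.
  by rewrite andbF.
have FE : F = [fset n - i | i in F]%fset.
  apply/fsetP => i; apply/idP/imfsetP => [iF|[j /= jF ->]]; last exact: hF.
  by exists (n - i); rewrite ?hF//= subKr.
rewrite [in LHS]big_mkcond [in LHS]FE big_imfset/=; last by move=> i j _ _ /addrI/oppr_inj.
rewrite [RHS]big_mkcond; apply: eq_bigr => i _; rewrite subKr mulrC.
have -> : ~~ (n - i < i) && (n - i != i) = (i < n - i) by lia.
by [].
Qed.

Lemma sym_diag u m F : \sum_(i <- F | i == m *+ 2 - i) u i * u i = (u m * u m) *+ (m \in F).
Proof.
have E i : (i == m *+ 2 - i) = (i == m) by lia.
under eq_bigl do rewrite E.
have [mF|mF] := boolP (m \in F).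
  rewrite big_mkcond (big_fsetD1 m)//= eqxx big_seq big1 ?addr0// => i.
  by rewrite !inE => /andP[/negPf ->].
rewrite big_seq_cond big1 ?mulr0n// => i /andP[iF /eqP iE].
by rewrite iE (negPf mF) in iF.
Qed.

Lemma sym_diag_odd u m F : \sum_(i <- F | i == m *+ 2 + 1 - i) u i * u i = 0.
Proof. by rewrite big1// => i; lia. Qed.

End SymmetricSums.

Section CharacteristicTwo.
Variable k : fieldType.
Hypothesis k2 : forall x : k, x + x = 0.
Implicit Types (f g h w c : laurent k) (n : int).

Lemma lcoefB f g n : (f - g) n = f n - g n.
Proof. by []. Qed.

Lemma lcoefD f g n : (f + g) n = f n + g n.
Proof. by []. Qed.

Lemma laurent_ext f g : (forall n, f n = g n) -> f = g.
Proof. by move=> fg; apply/val_inj/funext. Qed.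

Lemma lcoef_sqr f n : exists F : {fset int},
  (f ^+ 2) n = \sum_(i <- F | i == n - i) f i * f i /\ (forall i, i == n - i -> f i != 0 -> i \in F).
Proof.
have [N hN] := laurentP f.
pose F := sym_closure n (int_ball (N + `|n|)).
have hF : forall i, i \in F -> n - i \in F by move=> i; exact: sym_closureP.
have inF (i : int) : - N%:Z <= i -> i <= n + N%:Z -> i \in F.
  by move=> h1 h2; rewrite inE in_int_ball; apply/orP; left; lia.
exists F; split; last first.
  move=> i /eqP iE fi; apply: inF; rewrite leNgt; apply/negP => h; move: fi.
    by rewrite hN ?eqxx.
  by rewrite hN ?eqxx//; lia.
rewrite expr2 [LHS](lconv0 hN hN inF) (sym_sum _ hF).
by rewrite mulr2n k2 add0r.
Qed.

Lemma lcoef_sqr_even f n : (f ^+ 2) (n *+ 2) = f n ^+ 2.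
Proof.
have [F [-> hF]] := lcoef_sqr f (n *+ 2); rewrite sym_diag expr2.
case: (boolP (n \in F)) => [//|nF]; have [->|fn] := eqVneq (f n) 0; first by rewrite mul0r mul0rn.
by rewrite hF// in nF; lia.
Qed.

Lemma lcoef_sqr_odd f n : (f ^+ 2) (n *+ 2 + 1) = 0.
Proof. by have [F [-> _]] := lcoef_sqr f (n *+ 2 + 1); rewrite sym_diag_odd. Qed.

End CharacteristicTwo.

(** * From polar parts to full Laurent series *)

Section ArtinSchreierShift.
Variable k : fieldType.
Hypothesis k2 : forall x : k, x + x = 0.
Implicit Types (f g h w c : laurent k) (n : int) (m : nat).

Definition mk_laurent (a : int -> k) (la : is_laurent a) : laurent k :=
  Laurent (introT (laurent_predP _) la).

Lemma mk_laurentE (a : int -> k) (la : is_laurent a) n : mk_laurent la n = a n.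
Proof. by []. Qed.

Definition as_pred : {pred k} := [pred x | `[< exists y, x = y ^+ 2 - y >]].

Lemma oppk (x : k) : - x = x.
Proof. by apply/eqP; rewrite eq_sym -addr_eq0 k2. Qed.

Lemma sqrB2 (x y : k) : (x - y) ^+ 2 = x ^+ 2 - y ^+ 2.
Proof.
by rewrite sqrrB mulr2n k2 subr0 -[in RHS](oppk (y ^+ 2)) opprK.
Qed.

Lemma as_pred_closed : zmod_closed as_pred.
Proof.
split; first by apply/asboolP; exists 0; rewrite expr0n subrr.
move=> x y /asboolP[a ->] /asboolP[b ->]; apply/asboolP; exists (a - b).
by rewrite sqrB2; ring.
Qed.

Variable e : k -> k.
Hypothesis eD : {morph e : x y / x + y}.
Hypothesis e_as : forall x, x \in as_pred -> e x = 0.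
Hypothesis e_id : forall x, e x - x \in as_pred.

Lemma e0 : e 0 = 0.
Proof. exact: e_as as_pred_closed.1. Qed.

Lemma eB x y : e (x - y) = e x - e y.
Proof. by rewrite oppk eD -[in RHS](oppk (e y)) opprK. Qed.

Lemma e_sqr x : e (x ^+ 2) = e x.
Proof.
apply/eqP; rewrite -subr_eq0 -eB; apply/eqP/e_as/asboolP.
by exists x.
Qed.

Lemma ee x : e (e x) = e x.
Proof. by apply/eqP; rewrite -subr_eq0 -eB; apply/eqP/e_as. Qed.

Definition lbound f : nat := sval (cid (laurentP f)).

Lemma lboundP f n : n < - (lbound f)%:Z -> f n = 0.
Proof. exact: svalP (cid (laurentP f)) n. Qed.

(* Sums over an orbit of degree doubling, which the relation y^2 = y of the
   quotient by the y^2 - y makes well defined there. *)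
Definition ytrace m h : k := \sum_(j < lbound h) e (h (- (m * 2 ^ j)%:Z)).

Lemma ytraceE m h N : (0 < m)%N -> (forall n, n < - N%:Z -> h n = 0) ->
  ytrace m h = \sum_(j < N) e (h (- (m * 2 ^ j)%:Z)).
Proof.
move=> m0 hN.
have big M j : (M <= j)%N -> - (m * 2 ^ j)%:Z < - M%:Z.
  move=> Mj; have : (j < 2 ^ j)%N by rewrite ltn_expl.
  by rewrite ltrN2 ltz_nat; nia.
have step M M' : (M <= M')%N -> (forall n, n < - M%:Z -> h n = 0) ->
    \sum_(j < M') e (h (- (m * 2 ^ j)%:Z)) = \sum_(j < M) e (h (- (m * 2 ^ j)%:Z)).
  move=> MM' hM; rewrite [RHS](big_ord_widen M' (fun j => e (h (- (m * 2 ^ j)%:Z))))//.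
  rewrite [RHS]big_mkcond; apply: eq_bigr => -[j /= jM'] _.
  by case: ltnP => // Mj; rewrite hM ?e0//; exact: big.
rewrite /ytrace -(step _ (maxn N (lbound h)) (leq_maxr _ _) (@lboundP h)).
exact: step (leq_maxl _ _) hN.
Qed.

Lemma ytraceB m f g : (0 < m)%N -> ytrace m (f - g) = ytrace m f - ytrace m g.
Proof.
move=> m0; pose N := maxn (lbound f) (lbound g).
have fN n : n < - N%:Z -> f n = 0 by move=> h; apply: lboundP; rewrite /N in h; lia.
have gN n : n < - N%:Z -> g n = 0 by move=> h; apply: lboundP; rewrite /N in h; lia.
rewrite (@ytraceE _ _ N)// ?(@ytraceE _ f N)// ?(@ytraceE _ g N)//.
  by rewrite -sumrB; apply: eq_bigr => j _; rewrite lcoefB eB.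
by move=> n h; rewrite lcoefB fN ?gN ?subr0.
Qed.

Lemma ytrace_e m h : e (ytrace m h) = ytrace m h.
Proof.
by rewrite /ytrace (big_morph e eD e0); apply: eq_bigr => j _; rewrite ee.
Qed.

Lemma ytrace_shift m f g (a : k) : (0 < m)%N ->
  f (- m%:Z) = g (- m%:Z) + a ->
  (forall j, (0 < j)%N -> f (- (m * 2 ^ j)%:Z) = g (- (m * 2 ^ j)%:Z)) ->
  ytrace m f = ytrace m g + e a.
Proof.
move=> m0 fa fg; pose N := (maxn (lbound f) (lbound g)).+1.
have fN n : n < - N%:Z -> f n = 0 by move=> h; apply: lboundP; rewrite /N in h; lia.
have gN n : n < - N%:Z -> g n = 0 by move=> h; apply: lboundP; rewrite /N in h; lia.
rewrite (@ytraceE _ f N)// (@ytraceE _ g N)// !big_ord_recl/= expn0 muln1 fa eD.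
rewrite addrAC; congr (_ + _ + _); apply: eq_bigr => j _.
by rewrite fg.
Qed.

Definition polar_as c := exists w, forall n, n < 0 -> c n = (w ^+ 2 - w) n.

(** Since [e] is invariant under squaring, the sum telescopes. It starts without a square because m
    is odd, and its last term lies beyond the poles of w. *)
Lemma ytrace_as m c : odd m -> polar_as c -> ytrace m c = 0.
Proof.
move=> om [w hw]; have m0 : (0 < m)%N by case: m om.
pose N := maxn (lbound c) (lbound w).
have cN n : n < - N%:Z -> c n = 0 by move=> h; apply: lboundP; rewrite /N in h; lia.
have wN n : n < - N%:Z -> w n = 0 by move=> h; apply: lboundP; rewrite /N in h; lia.
pose x j := w (- (m * 2 ^ j)%:Z).
have cE j : e (c (- (m * 2 ^ j)%:Z)) = (if j is i.+1 then e (x i) else 0) - e (x j).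
  rewrite hw; last by rewrite oppr_lt0 ltz_nat muln_gt0 m0 expn_gt0.
  rewrite lcoefB eB; congr (_ - _); case: j => [|j].
    have -> : - (m * 2 ^ 0)%:Z = (- (m./2).+1%:Z) *+ 2 + 1.
      have := odd_double_half m; rewrite om; lia.
    by rewrite lcoef_sqr_odd// e0.
  have -> : - (m * 2 ^ j.+1)%:Z = (- (m * 2 ^ j)%:Z) *+ 2 by rewrite expnS; lia.
  by rewrite lcoef_sqr_even// e_sqr.
have sumE M : \sum_(j < M.+1) e (c (- (m * 2 ^ j)%:Z)) = - e (x M).
  elim: M => [|M IH]; first by rewrite big_ord1 cE sub0r.
  by rewrite big_ord_recr/= IH cE addrA addNr sub0r.
rewrite (@ytraceE _ _ N.+1)//; last by move=> n h; apply: cN; lia.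
rewrite sumE /x wN ?e0 ?oppr0//.
have : (N < 2 ^ N)%N by rewrite ltn_expl.
by move=> h; rewrite ltrN2 ltz_nat; nia.
Qed.

(** The trace in the preceding odd degree; the class of the constant term stands before degree 1. *)
Definition ytrace_prev m h : k := if m == 1%N then e (h 0) else ytrace (m - 2) h.

(** A Hilbert hotel: only odd degrees are corrected, so that the trace in degree m becomes the
    preceding one and the class of [h 0] is stored in degree -1. Even degrees carry no correction,
    as each doubling orbit has a single odd member. *)
Definition tau_coef h n : k :=
  if n < 0 then h n + (if odd `|n| then ytrace_prev `|n| h - ytrace `|n| h else 0) else 0.

Lemma ytrace_eq0 m h : (lbound h < m)%N -> ytrace m h = 0.
Proof.
move=> hm; rewrite /ytrace big1// => j _; rewrite lboundP ?e0//.
have : (0 < 2 ^ j)%N by rewrite expn_gt0.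
by rewrite ltrN2 ltz_nat; nia.
Qed.

Lemma is_laurent_tau h : is_laurent (tau_coef h).
Proof.
exists (lbound h).+2 => n nh; rewrite /tau_coef; case: ifP => // n0.
rewrite lboundP; last lia.
rewrite /ytrace_prev (_ : `|n|%N == 1%N = false); last by lia.
by rewrite !ytrace_eq0; [rewrite subrr if_same addr0|lia|lia].
Qed.

Definition tau h : laurent k := mk_laurent (is_laurent_tau h).

Lemma tauE h m : (0 < m)%N ->
  tau h (- m%:Z) = h (- m%:Z) + (if odd m then ytrace_prev m h - ytrace m h else 0).
Proof.
move=> m0; rewrite mk_laurentE /tau_coef oppr_lt0 ltz_nat m0.
by rewrite abszN absz_nat.
Qed.

Lemma tau_nonneg h n : 0 <= n -> tau h n = 0.
Proof. by move=> n0; rewrite mk_laurentE /tau_coef ltNge n0. Qed.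

Lemma ytrace_prevB m f g : odd m -> ytrace_prev m (f - g) = ytrace_prev m f - ytrace_prev m g.
Proof.
move=> om; rewrite /ytrace_prev; case: eqP => [_|m1]; first by rewrite lcoefB eB.
by rewrite ytraceB//; case: m om m1 => [|[|[|]]].
Qed.

Lemma tauB f g : tau (f - g) = tau f - tau g.
Proof.
apply: laurent_ext => n; rewrite lcoefB.
have [n0|n0] := leP 0 n; first by rewrite !tau_nonneg// subrr.
have [m [m0 ->]] : exists m, (0 < m)%N /\ n = - m%:Z by exists `|n|%N; lia.
rewrite !tauE// lcoefB; case: ifP => om; last by rewrite !addr0.
by rewrite ytraceB// ytrace_prevB//; ring.
Qed.

Lemma ytrace_tau m h : odd m -> ytrace m (tau h) = ytrace_prev m h.
Proof.
move=> om; have m0 : (0 < m)%N by case: m om.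
rewrite (@ytrace_shift _ _ h (ytrace_prev m h - ytrace m h))//.
- rewrite eB ytrace_e (_ : e (ytrace_prev m h) = ytrace_prev m h); first by rewrite addrC subrK.
  by rewrite /ytrace_prev; case: ifP => _; [exact: ee|exact: ytrace_e].
- by rewrite tauE// om.
- move=> [//|j] _; rewrite tauE ?muln_gt0 ?m0 ?expn_gt0//.
  by rewrite expnS mulnCA oddM addr0.
Qed.

(** All traces of w^2 - w vanish, and so does the class of its constant term; hence [tau] leaves its
    polar part unchanged. *)
Lemma tau_kernel1 w : polar_as (tau (w ^+ 2 - w)).
Proof.
set h := w ^+ 2 - w; have hh : polar_as h by exists w.
exists w => n n0; have [m [m0 ->]] : exists m, (0 < m)%N /\ n = - m%:Z by exists `|n|%N; lia.
rewrite tauE//; case: ifP => [om|]; last by rewrite addr0.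
rewrite ytrace_as// /ytrace_prev; case: eqP => [_|m1]; last first.
  rewrite ytrace_as ?subrr ?addr0//.
  have m2 : (2 <= m)%N by case: m om m1 {m0} => [|[|]].
  by rewrite oddB// om.
rewrite e_as ?subrr ?addr0//; apply/asboolP; exists (w 0).
by rewrite /h lcoefB -lcoef_sqr_even.
Qed.

Section PositivePart.
Variables (h : laurent k) (y : k).

(** Solves w^2 - w = h in nonnegative degrees: the constant term is the given root y, and then w_n
    is the square of w_(n/2), or 0 for odd n, minus h_n. The fuel N makes the recursion on n/2
    structural. *)
Fixpoint as_root_fuel (N n : nat) : k :=
  if n is 0 then y else
  if N is N'.+1 then (if odd n then 0 else as_root_fuel N' n./2 ^+ 2) - h n else 0.

Lemma as_root_fuelE (N n : nat) : (n <= N)%N -> as_root_fuel N n = as_root_fuel n n.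
Proof.
elim/ltn_ind: n N => -[|n] IH [|N]//= nN.
congr (_ - _); case: ifP => // on; congr (_ ^+ 2).
have un : (uphalf n <= n)%N by rewrite uphalf_half; have := odd_double_half n; case: odd; lia.
by rewrite IH 1?[RHS]IH//; lia.
Qed.

Definition as_root (n : nat) := as_root_fuel n n.

Lemma as_root_fuelS N (n : nat) : as_root_fuel N.+1 n.+1 =
  (if odd n.+1 then 0 else as_root_fuel N (n.+1)./2 ^+ 2) - h n.+1.
Proof. by []. Qed.

Lemma as_root_even (n : nat) : (0 < n)%N -> as_root n.*2 = as_root n ^+ 2 - h n.*2.
Proof.
case: n => // n _; rewrite /as_root [in LHS]doubleS as_root_fuelS -doubleS odd_double doubleK.
by rewrite as_root_fuelE//; lia.
Qed.

Lemma as_root_odd (n : nat) : as_root n.*2.+1 = - h n.*2.+1.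
Proof. by rewrite /as_root /= odd_double sub0r. Qed.

End PositivePart.

Lemma int_parity n : exists m : int, n = m *+ 2 \/ n = m *+ 2 + 1.
Proof.
case: n => n; have := odd_double_half n; case: (odd n) => /= nE.
- by exists n./2; right; lia.
- by exists n./2; left; lia.
- by exists (- (n./2).+1%:Z); left; lia.
- by exists (- (n./2).+1%:Z); right; lia.
Qed.

Lemma as_glue h : polar_as h -> h 0 \in as_pred -> exists w, h = w ^+ 2 - w.
Proof.
move=> [w hw] /asboolP[y hy].
pose a n := if n < 0 then w n else as_root h y `|n|.
have la : is_laurent a.
  exists (lbound w) => n nw; rewrite /a ifT; last by lia.
  exact: lboundP.
pose v := mk_laurent la.
have vneg n : n < 0 -> v n = w n by move=> n0; rewrite mk_laurentE /a n0.
have vpos (j : nat) : v j%:Z = as_root h y j by rewrite mk_laurentE /a.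
exists v; apply: laurent_ext => n; rewrite lcoefB.
have [n0|n0] := ltP n 0.
  rewrite hw// lcoefB vneg//; congr (_ - _).
  have [m [nE|nE]] := int_parity n.
    by rewrite nE !lcoef_sqr_even// vneg//; lia.
  by rewrite nE !lcoef_sqr_odd.
case: n n0 => [[|n]|]// _.
  by have := lcoef_sqr_even k2 v 0; rewrite mul0rn vpos => ->; rewrite hy.
have := odd_double_half n.+1; case: (odd n.+1) => nE.
  have -> : (v ^+ 2) n.+1 = 0.
    have -> : n.+1%:Z = (n.+1./2)%:Z *+ 2 + 1 by rewrite -{1}nE; lia.
    exact: lcoef_sqr_odd.
  by rewrite vpos -nE add1n as_root_odd sub0r opprK.
have n20 : (0 < n.+1./2)%N by rewrite lt0n; apply/eqP => E; rewrite E in nE.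
have -> : (v ^+ 2) n.+1 = as_root h y n.+1./2 ^+ 2.
  have -> : n.+1%:Z = (n.+1./2)%:Z *+ 2 by rewrite -{1}nE; lia.
  by rewrite lcoef_sqr_even// vpos.
move: nE n20; rewrite add0n; set q := _./2 => nE q0.
by rewrite vpos -nE as_root_even// subKr.
Qed.

(** The traces of [tau h] are those of [h] one step earlier. If they all vanish, then [tau h] and
    [h] have the same polar part, and [e (h 0) = 0] solves the equation in degree 0. *)
Lemma tau_kernel2 h : polar_as (tau h) -> exists w, h = w ^+ 2 - w.
Proof.
move=> ht; have yp m : odd m -> ytrace_prev m h = 0.
  by move=> om; rewrite -ytrace_tau// ytrace_as.
have y0 m : odd m -> ytrace m h = 0.
  by move=> om; have := yp m.+2; rewrite /= negbK => /(_ om); rewrite /ytrace_prev/= subn2.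
apply: as_glue.
  case: ht => w hw; exists w => n n0; rewrite -hw//.
  have [m [m0 ->]] : exists m, (0 < m)%N /\ n = - m%:Z by exists `|n|%N; lia.
  by rewrite tauE//; case: ifP => om; rewrite ?yp ?y0 ?subrr ?addr0.
have := yp 1%N isT; rewrite /ytrace_prev/= => h0.
by have := e_id (h 0); rewrite h0 sub0r oppk.
Qed.

(** The inverse shift: degree -m receives the trace of degree m + 2, and the constant term receives
    the trace of degree 1. *)
Lemma tau_surj c : exists h, forall n, n < 0 -> tau h n = c n.
Proof.
pose a n := if n < 0 then c n + (if odd `|n| then ytrace (`|n| + 2) c - ytrace `|n| c else 0)
            else if n == 0 then ytrace 1 c else 0.
have la : is_laurent a.
  exists (lbound c) => n nc; rewrite /a ifT; last by lia.
  by rewrite lboundP// !ytrace_eq0; [rewrite subrr if_same addr0|lia|lia].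
pose h := mk_laurent la; exists h => n n0.
have hE m : (0 < m)%N -> h (- m%:Z) = c (- m%:Z) +
    (if odd m then ytrace (m + 2) c - ytrace m c else 0).
  by move=> m0; rewrite mk_laurentE /a oppr_lt0 ltz_nat m0 abszN absz_nat.
have yh m : odd m -> ytrace m h = ytrace (m + 2) c.
  move=> om; have m0 : (0 < m)%N by case: m om.
  rewrite (@ytrace_shift _ _ c (ytrace (m + 2) c - ytrace m c))//.
  - by rewrite eB !ytrace_e addrC subrK.
  - by rewrite hE// om.
  - move=> [//|j] _; rewrite hE ?muln_gt0 ?m0 ?expn_gt0//.
    by rewrite expnS mulnCA oddM addr0.
have yph m : odd m -> ytrace_prev m h = ytrace m c.
  move=> om; rewrite /ytrace_prev; case: eqP => [->|m1].
    by rewrite mk_laurentE /a/= ytrace_e.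
  have m2 : (2 <= m)%N by case: m om m1 => [|[|]].
  by rewrite yh ?subnK// oddB// om.
have [m [m0 ->]] : exists m, (0 < m)%N /\ n = - m%:Z by exists `|n|%N; lia.
rewrite tauE// hE//; case: ifP => om; last by rewrite !addr0.
by rewrite yph// yh//; ring.
Qed.

End ArtinSchreierShift.

(** * Artin-Schreier modules for p = 2 *)

Section Reduction.
Context {R : realType} {K : completeUltrametricFieldType R}.
Implicit Types (x y : K) (c d : residue K).

(** Elements of norm above 1 get the default value of 0; all properties below assume norm at most
    1. *)
Definition red x : residue K := residue_class (insubd 0 x).

(* Zero is lifted to zero, so that finite support is preserved. *)
Definition lift_res c : K := if c == 0 then 0 else val (repr c).

Lemma lift_res_le1 c : unorm (lift_res c) <= 1.
Proof. by rewrite /lift_res; case: eqP => _; [rewrite unorm0|exact: valP (repr c)]. Qed.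

Lemma lift_res0 : lift_res 0 = 0.
Proof. by rewrite /lift_res eqxx. Qed.

Lemma val_insubd_le1 x : unorm x <= 1 -> val (insubd (0 : valring K) x) = x.
Proof. by move=> x1; rewrite insubdK. Qed.

Lemma residue_class_eq (a b : valring K) :
  (residue_class a == residue_class b) = (unorm (val a - val b) < 1).
Proof. by rewrite -[LHS]Quotient.idealrBE inE. Qed.

Lemma red_eq x y : unorm x <= 1 -> unorm y <= 1 -> (red x == red y) = (unorm (x - y) < 1).
Proof. by move=> x1 y1; rewrite residue_class_eq !val_insubd_le1. Qed.

Lemma redB x y : unorm x <= 1 -> unorm y <= 1 -> red (x - y) = red x - red y.
Proof.
move=> x1 y1; rewrite /red /residue_class.
have <- := raddfB (\pi_(residue K)) (insubd 0 x : valring K) (insubd 0 y : valring K).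
congr (\pi_(residue K) _); apply: val_inj.
by rewrite val_insubd_le1 ?unormB_le// raddfB/= !val_insubd_le1.
Qed.

Lemma redM x y : unorm x <= 1 -> unorm y <= 1 -> red (x * y) = red x * red y.
Proof.
move=> x1 y1; rewrite /red /residue_class.
have <- := rmorphM (\pi_(residue K)) (insubd 0 x : valring K) (insubd 0 y : valring K).
congr (\pi_(residue K) _); apply: val_inj.
by rewrite val_insubd_le1 ?rmorphM/= ?val_insubd_le1// unormM mulr_ile1 ?unorm_ge0.
Qed.

Lemma red0 x : unorm x <= 1 -> (red x == 0) = (unorm x < 1).
Proof.
move=> x1; have -> : 0 = red 0.
  by rewrite -[in RHS](subrr 0) redB ?unorm0// subrr.
by rewrite red_eq ?unorm0// subr0.
Qed.

Lemma red_lift c : red (lift_res c) = c.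
Proof.
rewrite /lift_res; case: eqP => [->|_]; last by rewrite /red valKd /residue_class reprK.
by apply/eqP; rewrite red0 ?unorm0.
Qed.

End Reduction.

Section ArtinSchreierModules.
Context {R : realType} {K : completeUltrametricFieldType R}.
Hypothesis K_padic : contains_Qp 2 K.
Hypothesis K_unram : unramified 2 K.
Implicit Types (g u : robba K) (h w : laurent (residue K)) (m n : nat).

Let two_prime : prime 2. Proof. by []. Qed.
Let natK := natK_neq0 two_prime K_padic.
Let t := unorm (2 : K).
Let t0 : 0 < t. Proof. exact: unorm_p_gt0 two_prime K_padic. Qed.
Let t1 : t < 1. Proof. exact: unorm_p_lt1 two_prime K_padic. Qed.
Let two0 : (2 : K) != 0. Proof. exact: (natK 1). Qed.

Lemma omega2 : @omega R K 2 = t.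
Proof. by have := omegaX two_prime K_padic; rewrite expr1. Qed.

Lemma unorm_lt1_two x : unorm (x : K) < 1 -> unorm x <= t.
Proof. exact: unorm_lt1_le two_prime K_padic K_unram x. Qed.

Lemma residue2 (c : residue K) : c + c = 0.
Proof.
have l1 := lift_res_le1 c.
rewrite -[c]red_lift; set x := lift_res c in l1 *.
have -> : red x + red x = red (x - (0 - x)).
  by rewrite !redB ?unormB_le ?unorm0// [red 0](eqP (_ : red 0 == 0)) ?red0 ?unorm0// sub0r opprK.
apply/eqP; rewrite red0 ?sub0r ?opprK ?unormD_le//.
by rewrite -mulr2n -mulr_natl unormM (le_lt_trans _ t1)// ler_piMr// ltW.
Qed.

Lemma red_close x y : unorm (x : K) <= 1 -> unorm y <= 1 -> red x = red y ->
  unorm (x - y) <= t.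
Proof. by move=> x1 y1 /eqP; rewrite red_eq// => /unorm_lt1_two. Qed.

Lemma lpolar_zero h : exists N, forall m, (N <= m)%N -> h (- m%:Z) = 0.
Proof. by have [N hN] := laurentP h; exists N.+1 => m mN; apply: hN; lia. Qed.

Definition as_coef h m : K := (sg true m)%:~R * (2 * lift_res (h (- m%:Z))).

Lemma is_robba_as h : is_robba (side_coef true (as_coef h)).
Proof.
have [N hN] := lpolar_zero h; apply: (@is_robba_side_fin _ _ _ _ N) => m mN.
by rewrite /as_coef hN// lift_res0 !mulr0.
Qed.

(* theta applied to 2 sum_(n < 0) lift (h n) T^n. *)
Definition as_robba h : robba K := mk_robba (is_robba_as h).

Lemma as_robbaE h m : as_robba h (- m%:Z) = (sg true m)%:~R * (2 * lift_res (h (- m%:Z))).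
Proof. by rewrite -[- m%:Z]/(sg true m) mk_robbaE side_coefE. Qed.

Lemma as_robba_supp h : rsupp (strict_side true) (as_robba h).
Proof.
move=> n; rewrite /strict_side -leNgt le_eqVlt => /predU1P[<-|n0].
  by rewrite -[0 : int]/(- 0%:Z) as_robbaE mul0r.
by rewrite mk_robbaE /side_coef /on_side leNgt n0.
Qed.

Lemma as_robba_log h m : side_log true (as_robba h) m.+1 = 2 * lift_res (h (- m.+1%:Z)).
Proof. by rewrite /side_log as_robbaE mulKf// intK_sg. Qed.

Lemma side_logB s (g u : robba K) m : side_log s (g - u) m = side_log s g m - side_log s u m.
Proof. by rewrite /side_log rcoefB mulrBr. Qed.

Lemma rsuppB (P : pred int) (g u : robba K) : rsupp P g -> rsupp P u -> rsupp P (g - u).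
Proof. by move=> hg hu n nP; rewrite rcoefB hg// hu// subr0. Qed.

(** For p = 2 one has omega = |2|, so divisibility by 4 gives the strict inequality required by
    [trivial_neg]. *)
Lemma trivial_mod4 g : rsupp (strict_side true) g ->
  (forall m, unorm (side_log true g m.+1) <= t * t) -> pic_class g = 0.
Proof.
move=> hg hl; apply/pic_class0; apply: (trivial_neg two_prime K_padic hg _ hl).
by rewrite omega2 gtr_pMr.
Qed.

Lemma pic_class_as g h (s : nat -> K) : rsupp (strict_side true) g ->
  (forall m, unorm (s m) <= 1) -> (forall m, red (s m) = h (- m.+1%:Z)) ->
  (forall m, side_log true g m.+1 = 2 * s m) -> pic_class g = pic_class (as_robba h).
Proof.
move=> hg s1 sh gs; apply/eqP; rewrite -subr_eq0 -raddfB; apply/eqP/trivial_mod4.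
  by apply: rsuppB => //; exact: as_robba_supp.
move=> m; rewrite side_logB as_robba_log gs -mulrBr unormM ler_wpM2l ?(ltW t0)//.
by apply: red_close; rewrite ?lift_res_le1// red_lift sh.
Qed.

Definition as_class h : picard K := pic_class (as_robba h).

(** The lift from the residue field is additive only modulo 2, but the factor 2 in [as_coef] turns
    the defect into a multiple of 4. *)
Lemma as_class_is_zmod : zmod_morphism as_class.
Proof.
move=> f h; rewrite /as_class -raddfB; apply/esym.
apply: (@pic_class_as _ _ (fun m => lift_res (f (- m.+1%:Z)) - lift_res (h (- m.+1%:Z)))).
- by apply: rsuppB; exact: as_robba_supp.
- by move=> m; rewrite unormB_le ?lift_res_le1.
- by move=> m; rewrite redB ?lift_res_le1// !red_lift.
- by move=> m; rewrite side_logB !as_robba_log mulrBr.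
Qed.

HB.instance Definition _ :=
  GRing.isZmodMorphism.Build (laurent (residue K)) (picard K) as_class as_class_is_zmod.

Lemma as_class_polar h w : (forall n : int, n < 0 -> h n = w n) -> as_class h = as_class w.
Proof.
move=> hw; congr pic_class; apply: robba_ext => n.
have [n0|n0] := ltP n 0; last first.
  by rewrite !as_robba_supp// /strict_side -leNgt.
by rewrite (_ : n = - `|n|%N%:Z) ?as_robbaE ?hw//; lia.
Qed.

Lemma is_laurent_monom (c : residue K) m :
  is_laurent (fun n : int => if n == - m%:Z then c else 0).
Proof. by exists m => n nm; case: eqP => // nE; move: nm; rewrite nE ltxx. Qed.

Definition lmonom c m : laurent (residue K) := mk_laurent (is_laurent_monom c m).

Lemma lmonomE c m (n : int) : lmonom c m n = if n == - m%:Z then c else 0.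
Proof. by []. Qed.

(** For n >= 3 the term (2 x)^n / n of the logarithm of 1 - 2 x is divisible by 4, so only the
    linear and quadratic terms matter. *)
Lemma pow2_norm q : (0 < q)%N -> unorm (q.+2%:R^-1 : K) * t ^+ q.+2 <= t * t.
Proof.
move=> q0; rewrite unormV (unorm_nat_p two_prime K_padic (ltn0Sn _)) -/t.
rewrite mulrC ler_pdivrMr ?exprn_gt0// -expr2 -exprD ler_wiXn2l ?(ltW t0) ?(ltW t1)//.
rewrite add2n !ltnS.
have : (2 ^ logn 2 q.+2 <= q.+2)%N by rewrite dvdn_leq// pfactor_dvdnn.
have [//|lq] := leqP (logn 2 q.+2) q.
have : (2 ^ q.+1 <= 2 ^ logn 2 q.+2)%N by rewrite leq_pexp2l.
have : (q < 2 ^ q)%N by rewrite ltn_expl.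
by rewrite expnS; lia.
Qed.

Lemma lmonom_sqr c m (n : int) :
  (lmonom c m ^+ 2) n = if n == - (m.*2)%:Z then c ^+ 2 else 0.
Proof.
have [l [->|->]] := int_parity n.
  rewrite (lcoef_sqr_even residue2) lmonomE.
  have -> : (l *+ 2 == - (m.*2)%:Z) = (l == - m%:Z) by lia.
  by case: ifP; rewrite ?expr0n.
rewrite (lcoef_sqr_odd residue2); have -> : (l *+ 2 + 1 == - (m.*2)%:Z) = false by lia.
by [].
Qed.

(** * The unit 1 - 2 x T^-m *)

Section Monomial.
Variables (c : residue K) (m : nat).
Hypothesis m0 : (0 < m)%N.

Let x := lift_res c.
Let b := 2 * x.

Let x1 : unorm x <= 1. Proof. exact: lift_res_le1. Qed.

Let b1 : unorm b <= t.
Proof. by rewrite unormM ler_piMr ?(ltW t0). Qed.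

Let bX q : unorm (b ^+ q) <= t ^+ q.
Proof.
elim: q => [|q IH]; first by rewrite !expr0 unorm1.
by rewrite !exprS unormM ler_pM ?unorm_ge0.
Qed.

Let v n := if (m %| n)%N then b ^+ (n %/ m) else 0.

Lemma is_robba_geom_series : is_robba (side_coef true v).
Proof.
(* A ratio k < 1 with |2| < k^m, so that |b|^(n/m) <= k^n and the geometric series converges for |T|
   > k. *)
have [|k k01 hk] := @shrink_factor R t^-1 m; first by rewrite invf_gt1.
have tk : t < k ^+ m by move: hk; rewrite mulrC ltr_pdivlMr// mul1r.
apply: (@is_robba_side_geo _ _ _ _ 1 k k01) => n; rewrite mul1r /v.
have k0 : 0 <= k by case/andP: k01 => /ltW.
case: ifP => [mn|_]; last by rewrite unorm0 exprn_ge0.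
apply: (le_trans (bX _)); rewrite -[in leRHS](divnK mn) mulnC exprM.
by rewrite lerXn2r ?nnegrE ?exprn_ge0 ?(ltW t0) ?(ltW tk).
Qed.

Let V := mk_robba is_robba_geom_series.
Let u : robba K := 1 - robba_monom b (- m%:Z).
Let g := robba_theta u * V.

Let V_neg (n : nat) : V (- n%:Z) = v n.
Proof. by rewrite -[- n%:Z]/(sg true n) mk_robbaE side_coefE. Qed.

Let V_pos (n : int) : 0 < n -> V n = 0.
Proof. by move=> n0; rewrite mk_robbaE /side_coef /on_side leNgt n0. Qed.

Lemma geom_series_inv : u * V = 1.
Proof.
apply: robba_ext => n; rewrite mulrBl mul1r rcoefB rcoef_monomM opprK rcoef1.
have [n0|n0] := ltP 0 n.
  by rewrite !V_pos ?mulr0 ?subrr ?gt_eqF// addr_gt0.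
have [j ->] : exists j : nat, n = - j%:Z by exists `|n|%N; lia.
rewrite V_neg /v oppr_eq0.
have [jm|mj] := ltnP j m.
  rewrite V_pos ?mulr0 ?subr0; last by lia.
  case: j jm {n0} => [|j] jm; first by rewrite dvdn0 div0n expr0.
  by rewrite gtnNdvd.
have -> : - j%:Z + m%:Z = - (j - m)%N%:Z by lia.
rewrite V_neg /v dvdn_subl// (_ : (j%:Z == 0) = false); last by lia.
have [/dvdnP[q jE]|_] := boolP (m %| j)%N; last by rewrite mulr0 subrr.
case: q jE => [|q] jE; first by rewrite jE leqNgt m0 in mj.
by rewrite jE mulSn addKn -mulSn !mulnK// -exprS subrr.
Qed.

Let gE (n : int) : g n = m%:R * b * V (n + m%:Z).
Proof.
rewrite /g /u (raddfB (@robba_theta R K)) [X in X - _]robba_theta1 sub0r.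
rewrite [X in - X]robba_theta_monom.
have -> : - (robba_const (- m%:Z)%:~R * robba_monom b (- m%:Z)) =
    robba_monom (m%:R * b) (- m%:Z).
  by apply: robba_ext => j; rewrite rcoefN rcoefZ !rcoef_monom mulrNz mulNr opprK mulrnAr.
by rewrite rcoef_monomM opprK.
Qed.
Let g_log n : side_log true g n.+1 =
  if (m %| n.+1)%N then - (b ^+ (n.+1 %/ m) / (n.+1 %/ m)%:R) else 0.
Proof.
rewrite /side_log gE {1}/sg mulrNz invrN mulNr.
have [nm|mn] := ltnP n.+1 m.
  by rewrite V_pos ?mulr0 ?oppr0 ?gtnNdvd// /sg; lia.
have -> : sg true n.+1 + m%:Z = - (n.+1 - m)%N%:Z by rewrite /sg; lia.
rewrite V_neg /v dvdn_subl//; case: ifP => [|_]; last by rewrite !mulr0 oppr0.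
move=> /dvdnP[q nE]; case: q nE => // q nE.
rewrite nE mulSn addKn -mulSn !mulnK// exprS; congr (- _).
have mK : m%:R != 0 :> K by case: (m) m0 => // j _; exact: natK.
rewrite -[(_ * m)%N%:~R]/((q.+1 * m)%:R) natrM invfM.
have -> : q.+1%:R^-1 / m%:R * (m%:R * b * b ^+ q) =
    (m%:R^-1 * m%:R) * (b * b ^+ q / q.+1%:R) by ring.
by rewrite mulVf// mul1r.
Qed.

(** The logarithmic derivative [g] of the unit u defines a trivial module. Half of log (1 - 2 x
    T^-m) is - x T^-m - x^2 T^-2m modulo 2, which in characteristic two reduces to the stated
    difference. *)
Lemma as_class_monom : as_class (lmonom c m ^+ 2 - lmonom c m) = 0.
Proof.
have hg : rsupp (strict_side true) g.
  by move=> n; rewrite /strict_side -leNgt => n0; rewrite gE V_pos ?mulr0//; lia.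
have <- : pic_class g = 0.
  apply/pic_class0/pic_rel0; exists u, V; split; first exact: geom_series_inv.
  by rewrite /g -mulrA [V * u]mulrC geom_series_inv mulr1.
apply/esym; pose s n := side_log true g n.+1 / 2.
have x2 : b ^+ 2 / 2%:R = 2 * x ^+ 2 by rewrite /b exprMn expr2 -mulrA mulrC mulKf.
have sE n : s n = if n.+1 == m then - x else if n.+1 == m.*2 then - x ^+ 2 else
    if (m %| n.+1)%N then - (b ^+ (n.+1 %/ m) / (n.+1 %/ m)%:R) / 2 else 0.
  rewrite /s g_log; case: eqP => [->|nm].
    by rewrite dvdnn divnn m0 expr1 divr1 /b mulrC mulrN mulKf.
  case: eqP => [->|nm2].
    rewrite -muln2 dvdn_mulr// mulKn// x2 mulrC mulrN mulKf//.
  by case: ifP; rewrite ?mul0r.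
have big n : n.+1 != m -> n.+1 != m.*2 -> (m %| n.+1)%N ->
    unorm (- (b ^+ (n.+1 %/ m) / (n.+1 %/ m)%:R) / 2) <= t.
  move=> nm nm2 /dvdnP[q nE]; rewrite nE mulnK//.
  case: q nE => [|[|[|q]]] nE; rewrite ?mul1n ?mul2n in nE *.
  - by [].
  - by rewrite nE eqxx in nm.
  - by rewrite nE eqxx in nm2.
  rewrite mulNr unormN unormM (unormV 2) -/t ler_pdivrMr// unormM mulrC.
  apply: le_trans (pow2_norm (ltn0Sn q)); rewrite ler_wpM2l ?unorm_ge0//.
have s1 n : unorm (s n) <= 1.
  rewrite sE; case: eqP => [_|/eqP nm]; first by rewrite unormN.
  case: eqP => [_|/eqP nm2]; first by rewrite unormN unormM mulr_ile1 ?unorm_ge0.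
  by case: ifP => [/(big _ nm nm2)/le_trans|_]; [apply; exact: ltW|rewrite unorm0].
apply: (@pic_class_as _ _ s) => // n; last by rewrite /s mulrC divfK.
rewrite lcoefB lmonom_sqr lmonomE !eqr_opp !eqz_nat.
have redN (y : K) : unorm y <= 1 -> red (- y) = red y.
  by move=> y1; apply/eqP; rewrite red_eq ?unormN// -opprD unormN -mulr2n -mulr_natl unormM;
    rewrite (le_lt_trans _ t1)// ler_piMr// ltW.
rewrite sE; case: eqP => [nm|/eqP nm].
  rewrite redN// red_lift (_ : (n.+1 == m.*2) = false) ?sub0r; last by lia.
  by rewrite (oppk residue2).
case: eqP => [nm2|/eqP nm2].
  by rewrite redN ?unormM ?mulr_ile1 ?unorm_ge0// expr2 redM// red_lift subr0 expr2.
rewrite subr0; apply/eqP; case: ifP => [mn|_]; last by rewrite red0 ?unorm0.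
by rewrite red0 ?(le_lt_trans (big _ nm nm2 mn))// (le_trans (big _ nm nm2 mn))// ltW.
Qed.

End Monomial.

Lemma lcoef_sum (I : Type) (r : seq I) (P : pred I) (F : I -> laurent (residue K)) (n : int) :
  (\sum_(i <- r | P i) F i) n = \sum_(i <- r | P i) F i n.
Proof.
by elim/big_ind2: _ => // x1 x2 y1 y2 <- <-; exact: lcoefD.
Qed.

Lemma lsqrB f h : (f - h) ^+ 2 = f ^+ 2 - h ^+ 2.
Proof.
apply: laurent_ext => n; rewrite lcoefB.
have [m [->|->]] := int_parity n.
  by rewrite !(lcoef_sqr_even residue2) lcoefB (sqrB2 residue2).
by rewrite !(lcoef_sqr_odd residue2) subr0.
Qed.

(** The map sending w to the class of w^2 - w is additive, and w is a finite sum of polar monomials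
    plus a series without polar part, whose image has no polar part either. *)
Lemma as_class_sqr w : as_class (w ^+ 2 - w) = 0.
Proof.
pose psi (f : laurent (residue K)) := as_class (f ^+ 2 - f).
have psiB f h : psi (f - h) = psi f - psi h.
  rewrite /psi -raddfB lsqrB; congr as_class; ring.
have psi0 : psi 0 = 0 by rewrite /psi expr0n subrr raddf0.
have psiD f h : psi (f + h) = psi f + psi h.
  by rewrite -[h in LHS]opprK psiB -[- h]sub0r psiB psi0 sub0r opprK.
have [N hN] := lpolar_zero w.
pose z := \sum_(m < N) lmonom (w (- m.+1%:Z)) m.+1.
have -> : w = z + (w - z) by rewrite addrC subrK.
rewrite -/(psi _) psiD {1}/z (big_morph psi psiD psi0) big1 ?add0r; last first.
  by move=> i _; exact: as_class_monom.
have wz (n : int) : n < 0 -> (w - z) n = 0.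
  move=> n0; rewrite lcoefB /z lcoef_sum.
  have [m ->] : exists m : nat, n = - m.+1%:Z by exists (`|n|.-1)%N; lia.
  under eq_bigr do rewrite lmonomE eqr_opp eqz_nat.
  have [mN|Nm] := ltnP m N.
    rewrite (bigD1 (Ordinal mN))//= eqxx big1 ?addr0 ?subrr// => i.
    by rewrite -val_eqE/= eqSS eq_sym => /negPf ->.
  rewrite hN; last by apply: leqW.
  rewrite big1 ?subrr// => i _; case: eqP => // - [mi].
  by have := ltn_ord i; rewrite -mi ltnNge Nm.
rewrite /psi (@as_class_polar _ 0) ?raddf0// => n n0.
rewrite lcoefB wz// subr0; have [l nE] := int_parity n; case: nE n0 => -> n0.
  by rewrite (lcoef_sqr_even residue2) wz ?expr0n//; lia.
by rewrite (lcoef_sqr_odd residue2).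
Qed.

Lemma as_class_polar_as h : polar_as h -> as_class h = 0.
Proof. by move=> [w hw]; rewrite (as_class_polar hw) as_class_sqr. Qed.

End ArtinSchreierModules.

(** * Triviality of Artin-Schreier modules *)

Section SideTaylorBounds.
Context {R : realType} {K : completeUltrametricFieldType R}.
Hypothesis natK_neq0 : forall n, n.+1%:R != 0 :> K.
Implicit Types (g u : robba K) (s : bool).

(** If the solution f is 1 up to coefficients of norm at most d, so is f(T(1 + x)) / f(T). The
    identity of [zt_solution] isolates each coefficient in terms of those of smaller degree. *)
Lemma side_zt_bound s g (d : R) i : rsupp (strict_side s) g -> 0 <= d <= 1 ->
  (forall n, unorm (expc (inv_succ K) (side_log s g) n.+1) <= d) ->
  forall n, unorm (zt g i.+1 n) <= d.
Proof.
move=> hg /andP[d0 d1] hf n.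
have hz : rsupp (strict_side s) (zt g i.+1).
  by apply: (zt_supp natK_neq0) => //; exact: strict_sideD.
have hz' := rsuppW (@strict_side_on s) hz.
have [sn|/hz->] := boolP (strict_side s n); last by rewrite unorm0.
have [m ->] : exists m, n = sg s m.+1.
  by exists (`|n|.-1)%N; move: sn; rewrite /strict_side /sg; case: (s); lia.
elim/ltn_ind: m {n sn} => m IH.
set e := expc _ _ in hf.
have ra : is_robba (side_coef s (fun j => if (j <= m.+1)%N then e j else 0)).
  by apply: (@is_robba_side_fin _ _ _ _ m.+2) => j; case: ifP => // h1 h2; lia.
pose u := mk_robba ra.
have hu : rsupp (on_side s) u by exact: rsupp_side.
have uE j : (j <= m.+1)%N -> u (sg s j) = e j by move=> jn; rewrite mk_robbaE side_coefE jn.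
clearbody u.
have hsol := side_theta_upto natK_neq0 hg hu uE.
have hg' := rsuppW (@strict_side_on s) hg.
have h : (zt g i.+1 * u) (sg s m.+1) = (ibin (sg s m.+1) i.+1)%:~R * u (sg s m.+1).
  apply: (@zt_solution _ _ natK_neq0 (on_side s) _ g u _ _ _ hg' hsol).
  - exact: on_sideD.
  - by rewrite /on_side; case: (s).
  - by move=> a b; rewrite /on_side; case: (s); lia.
  - by rewrite on_side_sg abs_sg ltnn.
have {h} -> : zt g i.+1 (sg s m.+1) = (ibin (sg s m.+1) i.+1)%:~R * u (sg s m.+1) -
    \sum_(j < m.+1) zt g i.+1 (sg s j) * u (sg s (m.+1 - j)).
  rewrite -h side_mul// big_ord_recr subnn uE// /e expc0 mulr1.
  by rewrite addrC addKr.
apply: unormB_le.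
  by rewrite unormM uE// (le_trans _ (hf m))// ler_piMl ?unorm_ge0 ?unorm_int_le1.
apply: unorm_sum_le => //= -[j /= jm] _ _; rewrite uE ?leq_subr//.
rewrite unormM (_ : (m.+1 - j)%N = (m - j).+1) ?subSn//.
apply: le_trans (hf (m - j)%N); rewrite ler_piMl ?unorm_ge0//.
case: j jm => [|j] jm; last by apply: (le_trans (IH j _)).
by rewrite hz ?unorm0// /strict_side /sg; case: (s).
Qed.

Lemma zt_lower (N : nat) g i : (forall n : int, n < - N%:Z -> g n = 0) ->
  forall n : int, n < - (N * i)%N%:Z -> zt g i n = 0.
Proof.
move=> hg n nN; suff : rsupp (fun m : int => - (N * i)%N%:Z <= m) (zt g i).
  by apply; rewrite -ltNge.
have hg' : rsupp (fun m : int => - N%:Z <= m) g by move=> m; rewrite -ltNge => /hg.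
elim: i {n nN} => [|i IH].
  by move=> n; rewrite muln0 oppr0 -ltNge => n0; rewrite zt0 rcoef1 lt_eqF.
have IH' : rsupp (fun m : int => - (N * i.+1)%N%:Z <= m) (zt g i).
  by apply: rsuppW IH => m; lia.
rewrite zt_succ; apply/rsuppZ/rsuppD; first exact: rsupp_theta.
rewrite mulrBl -mulNr -[i%:R](rmorph_nat (@robba_const R K)) -rmorphN.
apply: rsuppD; last exact: rsuppZ.
by apply: (rsuppM hg' IH) => a b; lia.
Qed.

End SideTaylorBounds.

Section TruncatedLogarithm.
Context {R : realType} {K : completeUltrametricFieldType R}.
Hypothesis natK_neq0 : forall n, n.+1%:R != 0 :> K.
Implicit Types (g u w : robba K).

(** The logarithm of 1 + w, truncated to avoid any question of convergence; the defect of its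
    derivative is the explicit term in (- w)^M. *)
Definition tlog (M : nat) w : robba K :=
  \sum_(i < M) robba_const ((-1) ^+ i / i.+1%:R) * w ^+ i.+1.

Lemma robba_theta_exp w i : robba_theta (w ^+ i.+1) = i.+1%:R * w ^+ i * robba_theta w.
Proof.
elim: i => [|i IH]; first by rewrite expr1 expr0 mulr1 mul1r.
by rewrite exprS robba_thetaM IH -[i.+2%:R]natr1 exprS; ring.
Qed.

Lemma robba_theta_tlog M w g : robba_theta w = g * (1 + w) ->
  robba_theta (tlog M w) = g * (1 - (- w) ^+ M).
Proof.
move=> hw; have -> : robba_theta (tlog M w) = (\sum_(i < M) (- w) ^+ i) * robba_theta w.
  rewrite /tlog robba_theta_sum mulr_suml; apply: eq_bigr => i _.
  rewrite robba_thetaZ robba_theta_exp mulrA; congr (_ * _).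
  rewrite mulrA -(rmorph_nat (@robba_const R K)) -rmorphM divfK// rmorphXn rmorphN1.
  by rewrite -exprMn mulN1r.
rewrite hw mulrCA [_ * (1 + w)]mulrC; congr (_ * _).
have := subrX1 (- w) M => h.
by rewrite -opprB h -mulNr; congr (_ * _); ring.
Qed.

End TruncatedLogarithm.

(** * Dominant monomials of units *)

Section UnitDominance.
Context {R : realType} {K : completeUltrametricFieldType R}.
Implicit Types (g u v : robba K).

(* Dominant indices add up in a product, so for u v = 1 the largest and the
   smallest dominant index of u coincide. *)
Lemma unit_dominant u v : u * v = 1 -> exists2 d : R, 0 < d < 1 &
  forall rho, 1 - d < rho < 1 -> exists n0 : int,
    forall n, n != n0 -> unorm (u n) * rho ^ n < unorm (u n0) * rho ^ n0.
Proof.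
move=> uv; have [d d01 hd] := is_robba2 (robbaP u) (robbaP v).
exists d => // rho rho1; have rho0 : 0 < rho by lra.
have [C [th [C0 th01 hu hv]]] := hd rho rho1.
(* A single series viewed as the row 0 of a double series, so that the dominance lemmas apply. *)
pose fam (f : robba K) (i : nat) : robba K := if i is 0 then f else 0.
have famb (f : robba K) : (forall i, unorm (f i) * rho ^ i <= C * th ^+ `|i|) ->
    forall i n, wnorm rho 1 (fam f) i n <= C * th ^+ (i + `|n|).
  move=> hf [|i] n; rewrite /wnorm expr1n mulr1; first exact: hf.
  by rewrite rcoef0 unorm0 mul0r mulr_ge0 ?exprn_ge0//; case/andP: th01 => /ltW.
have [nu un] := robba_unit_neq0 uv.
have [nv vn] : exists n, v n != 0 by apply: (robba_unit_neq0 (v := u)); rewrite mulrC.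
have key s : exists n0 m0 : int, [/\ n0 + m0 = 0,
    (forall n, unorm (u n) * rho ^ n <= unorm (u n0) * rho ^ n0),
    (forall n, (if s then n0 < n else n < n0) -> unorm (u n) * rho ^ n < unorm (u n0) * rho ^ n0),
    (forall n, unorm (v n) * rho ^ n <= unorm (v m0) * rho ^ m0) &
    (forall n, (if s then m0 < n else n < m0) -> unorm (v n) * rho ^ n < unorm (v m0) * rho ^ m0)].
  have dom (f : robba K) nf : (forall i, unorm (f i) * rho ^ i <= C * th ^+ `|i|) -> f nf != 0 ->
      exists M n0, 0 < M /\ dominated rho 1 s (fam f) M 0 n0.
    move=> hf fn.
    have [M [[|i0] [n0 [M0 hM]]]] := dominated_exists rho0 ltr01 s C0 th01 (famb f hf)
      (fn : fam f 0 nf != 0); first by exists M, n0.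
    by case: hM => _ + _; rewrite /wnorm rcoef0 unorm0 !mul0r => ME; rewrite -ME ltxx in M0.
  have wE (f : robba K) n : wnorm rho 1 (fam f) 0 n = unorm (f n) * rho ^ n by rewrite /wnorm expr0 mulr1.
  have [M [n0 [M0 hM]]] := dom u nu hu un.
  have [M' [m0 [M'0 hM']]] := dom v nv hv vn.
  have [_ + _] := dominated_cauchy rho0 ltr01 M0 M'0 hM hM'.
  have fE : cauchy (fam u) (fam v) 0 = 1 by rewrite /cauchy big_ord1 -uv.
  rewrite addn0 /wnorm fE expr0 mulr1 rcoef1 => h.
  have {h} nm : n0 + m0 = 0.
    case: eqP h => // _; rewrite unorm0 mul0r => /esym/eqP.
    by rewrite mulf_eq0 !gt_eqF.
  case: hM => u1 u2 u3; case: hM' => v1 v2 v3.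
  rewrite wE in u2; rewrite wE in v2.
  exists n0, m0; rewrite u2 v2; split; first exact: nm.
  - by move=> n; rewrite -wE.
  - by move=> n hn; rewrite -wE; apply: u3; rewrite /lexlt/= hn.
  - by move=> n; rewrite -wE.
  - by move=> n hn; rewrite -wE; apply: v3; rewrite /lexlt/= hn.
have [n0 [m0 [nm u1 u2 v1 v2]]] := key true.
have [n1 [m1 [nm' u1' u2' v1' v2']]] := key false.
have le_n : n1 <= n0.
  rewrite leNgt; apply/negP => /u2; rewrite ltNge => /negP; apply; exact: u1'.
have le_m : m1 <= m0.
  rewrite leNgt; apply/negP => /v2; rewrite ltNge => /negP; apply; exact: v1'.
have E : n1 = n0 by lia.
exists n0 => n nn0; have [h|h|h] := ltgtP n n0.
- by rewrite -E; apply: u2'; rewrite E.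
- exact: u2.
- by rewrite h eqxx in nn0.
Qed.

Lemma robba_decay_lt (u : robba K) (e rho : R) : 0 < e ->
  (exists C th, [/\ 0 <= C, 0 < th < 1 & forall i, unorm (u i) * rho ^ i <= C * th ^+ `|i|]) ->
  (forall n, unorm (u n) * rho ^ n < e) -> exists2 d, 0 <= d < e & gbound rho u d.
Proof.
move=> e0 [C [th [C0 th01 hC]]] hu; have e20 : 0 < e / 2 by rewrite divr_gt0.
have [N hN] := geo_small C0 th01 e20.
have [d [d0 hd]] : exists d, 0 <= d < e /\
    forall n : int, (`|n| < N)%N -> unorm (u n) * rho ^ n <= d.
  elim: N {hN} => [|N [d [d0 hd]]]; first by exists 0; rewrite lexx e0.
  exists (Num.max d (Num.max (unorm (u N) * rho ^ N%:Z) (unorm (u (- N%:Z)) * rho ^ (- N%:Z)))).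
  case/andP: d0 => d0 de; split; first by rewrite le_max d0 !gt_max de !hu.
  move=> n; rewrite ltnS leq_eqVlt => /predU1P[nN|/hd h]; last by rewrite le_max h.
  have [->|->] : n = N%:Z \/ n = - N%:Z by lia.
    by rewrite !le_max lexx orbT.
  by rewrite !le_max lexx !orbT.
exists (Num.max d (e / 2)).
  case/andP: d0 => d0 de; rewrite le_max d0/= gt_max de /=.
  by rewrite ltr_pdivrMr// ltr_pMr// ltr1n.
move=> n; rewrite le_max; have [/hd->//|Nn] := ltnP `|n| N.
by apply/orP; right; exact: le_trans (hC n) (hN _ Nn).
Qed.

End UnitDominance.

(** * Normal form of a trivialization *)

Section ArtinSchreierKernel.
Context {R : realType} {K : completeUltrametricFieldType R}.
Hypothesis K_padic : contains_Qp 2 K.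
Hypothesis K_unram : unramified 2 K.
Implicit Types (g u w : robba K) (h : laurent (residue K)) (a : K).

Let two_prime : prime 2. Proof. by []. Qed.
Let natK := natK_neq0 two_prime K_padic.
Let t := unorm (2 : K).
Let t0 : 0 < t. Proof. exact: unorm_p_gt0 two_prime K_padic. Qed.
Let t1 : t < 1. Proof. exact: unorm_p_lt1 two_prime K_padic. Qed.
Let two0 : (2 : K) != 0. Proof. exact: (natK 1). Qed.
Let G h := as_robba K_padic h.

Lemma as_log_norm h m : unorm (side_log true (G h) m.+1) <= t.
Proof. by rewrite as_robba_log unormM ler_piMr ?(ltW t0) ?lift_res_le1. Qed.

(** The boundary case eps = omega = |2| of [unorm_expc]: without geometric decay, the coefficients
    of the exponential are still at most |2| beyond degree 0. *)
Lemma as_zt_norm h i n : unorm (zt (G h) i.+1 n) <= t.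
Proof.
apply: (side_zt_bound natK (s := true)); first exact: as_robba_supp.
  by rewrite (ltW t0) (ltW t1).
move=> m; rewrite -[leRHS]mulr1 -(expr1n _ m.+1).
apply: (unorm_expc two_prime K_padic) => //; first by rewrite (ltW t0) (omega2 K_padic) lexx.
by move=> j; rewrite expr1n mulr1; exact: as_log_norm.
Qed.

Lemma as_robba_norm h n : unorm (G h n) <= t.
Proof. by rewrite -[G h](zt1 natK); exact: as_zt_norm. Qed.

Lemma as_robba_lower h : exists N : nat, forall n : int, n < - N%:Z -> G h n = 0.
Proof.
have [N hN] := lpolar_zero K_padic h; exists N => n nN.
rewrite (_ : n = - `|n|%N%:Z); last by lia.
by rewrite as_robbaE hN ?lift_res0 ?mulr0//; lia.
Qed.

Lemma as_solvable a h : a \in @padic_int_pred R K -> solvable_op 2 (robba_const a + G h).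
Proof.
move=> ha; have [N hN] := as_robba_lower h.
apply: (@integral_solvable _ _ _ two_prime K_padic _ N).
  apply: (zt_integralD natK).
    exact/(zt_const_integral two_prime K_padic)/(padic_int_fall_small two_prime K_padic).
  move=> [|i] n; last by apply: (le_trans (as_zt_norm h i n)); exact: ltW.
  by rewrite zt0 rcoef1; case: eqP; rewrite ?unorm1 ?unorm0.
move=> i n nN; apply: (zt_lower (N := N)) nN => m mN.
rewrite rcoefD rcoef_monom hN// lt_eqF ?mulr0n ?add0r//.
by apply: (lt_le_trans mN); lia.
Qed.

Lemma gbound_monom rho (c : K) (m : int) : 0 < rho ->
  gbound rho (robba_monom c m) (unorm c * rho ^ m).
Proof.
move=> r0 n; rewrite rcoef_monom; case: eqP => [->//|_].
by rewrite mulr0n unorm0 mul0r mulr_ge0 ?unorm_ge0 ?exprz_ge0 ?ltW.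
Qed.

Lemma gbound_as_robba h (rho : R) : 0 < rho < 1 -> exists c, gbound rho (G h) c.
Proof.
move=> /andP[r0 r1]; have [N hN] := as_robba_lower h.
exists (rho ^- N) => n; have [/hN->|nN] := ltP n (- N%:Z).
  by rewrite unorm0 mul0r invr_ge0 exprn_ge0 ?ltW.
have [j nE] : exists j : nat, n = - N%:Z + j%:Z by exists (absz (n + N%:Z)%R); lia.
have -> : rho ^ n = rho ^- N * rho ^+ j by rewrite nE expfzDr ?gt_eqF// exprnN.
rewrite mulrCA; apply: ler_piMr; first by rewrite invr_ge0 exprn_ge0 ?ltW.
apply: mulr_ile1; rewrite ?unorm_ge0 ?exprn_ge0 ?exprn_ile1 ?(ltW r0) ?(ltW r1)//.
by apply: (le_trans (as_robba_norm h n)); exact: ltW.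
Qed.

Let intK_inj (m n : int) : m%:~R = n%:~R :> K -> m = n.
Proof.
move=> /eqP; rewrite -subr_eq0 -intrB => /eqP h; apply/eqP; rewrite -subr_eq0; apply/eqP.
case: (m - n) h => [[|j]|j]//; first by move=> /eqP; rewrite (negPf (natK j)).
by move=> /eqP; rewrite NegzE mulrNz oppr_eq0 (negPf (natK j)).
Qed.

Definition dominant u (rho : R) (n0 : int) :=
  forall n, n != n0 -> unorm (u n) * rho ^ n < unorm (u n0) * rho ^ n0.

Lemma dominant_neq0 u rho n0 : 0 < rho -> dominant u rho n0 -> 0 < unorm (u n0).
Proof.
move=> r0 dom; have /dom h1 : n0 + 1 != n0 by lia.
rewrite -(pmulr_lgt0 _ (exprz_gt0 n0 r0)); apply: le_lt_trans h1.
by rewrite mulr_ge0 ?unorm_ge0 ?exprz_ge0 ?ltW.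
Qed.

(** Dividing by the dominant monomial shifts the exponent by n0 and leaves 1 + w, all terms of w
    being of norm below 1 at the radii where n0 dominates. *)
Lemma dominant_normalize g a u n0 : u n0 != 0 ->
  robba_theta u = (robba_const a + g) * u ->
  exists w, [/\ robba_theta w = (robba_const (a - n0%:~R) + g) * (1 + w),
    forall rho, 0 < rho -> dominant u rho n0 -> forall n, unorm (w n) * rho ^ n < 1 &
    forall rho c, 0 < rho -> gbound rho u c -> exists c', gbound rho w c'].
Proof.
move=> un0 tu; pose U := robba_monom (u n0)^-1 (- n0) * u.
have UE n : U n = (u n0)^-1 * u (n + n0) by rewrite rcoef_monomM opprK.
exists (U - 1); split.
- have tU : robba_theta U = (robba_const (a - n0%:~R) + g) * U.
    by rewrite /U robba_thetaM tu robba_theta_monom rmorphB intrN rmorphN; ring.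
  rewrite (raddfB (@robba_theta R K)) [X in _ - X]robba_theta1 subr0 [1 + _]addrC subrK.
  exact: tU.
- move=> rho r0 dom n; rewrite rcoefB rcoef1; have [->|nn0] := eqVneq n 0.
    by rewrite UE add0r mulVf// subrr unorm0 mul0r.
  rewrite subr0 UE unormM unormV.
  have := dom (n + n0); rewrite -subr_eq0 addrK => /(_ nn0).
  rewrite expfzDr ?gt_eqF// mulrA ltr_pM2r ?exprz_gt0// => hlt.
  by rewrite -mulrA ltr_pdivrMl ?mulr1// (dominant_neq0 r0).
- move=> r c r0 hc; exists (Num.max (unorm (u n0)^-1 * r ^ (- n0) * c) 1).
  apply: gboundD => //; last apply: gboundN.
    by apply: gbound_le (gboundM r0 (gbound_monom _ _ r0) hc) _; rewrite le_max lexx.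
  by apply: gbound_le (gbound1 r) _; rewrite le_max lexx orbT.
Qed.

(* The truncated logarithm of the normalized solution has derivative close to
   H, hence H has no constant term. *)
Lemma dominant_exponent h a u (e rho : R) (n0 : int) : 0 < e < 1 ->
  (forall rho, 1 - e < rho < 1 -> exists c, gbound rho u c) -> 1 - e < rho < 1 ->
  robba_theta u = (robba_const a + G h) * u -> dominant u rho n0 -> a = n0%:~R.
Proof.
move=> e01 hu rho1 tu dom; have rho0 : 0 < rho by lra.
have un0 : u n0 != 0 by rewrite -unorm_eq0 gt_eqF// (dominant_neq0 rho0 dom).
have [w [tw w1 hw]] := dominant_normalize un0 tu.
set H := robba_const (a - n0%:~R) + G h in tw.
have {}hw r : 1 - e < r < 1 -> exists c, gbound r w c.
  by move=> r1; have [c hc] := hu r r1; apply: hw hc; lra.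
have [d /andP[d0 d1] hd] := robba_decay_lt ltr01 (is_robba_geo e01 hw rho1) (w1 _ rho0 dom).
have [c hc] : exists c, gbound rho H c.
  have [|c hc] := @gbound_as_robba h rho; first lra.
  exists (Num.max (unorm (a - n0%:~R) * rho ^ 0) c).
  apply: gboundD => //; last by apply: gbound_le hc _; rewrite le_max lexx orbT.
  by apply: gbound_le (gbound_monom _ _ rho0) _; rewrite le_max lexx.
have c0 := gbound_ge0 rho0 hc.
have H0 : H 0 = a - n0%:~R.
  by rewrite rcoefD rcoef_monom eqxx mulr1n as_robba_supp ?addr0.
apply/eqP; rewrite -subr_eq0 -H0; apply/eqP/unorm_small => eps eps0.
have d'01 : 0 < Num.max d (1 / 2) < 1 by rewrite lt_max gt_max d1; apply/andP; split; lra.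
have [M hM] := geo_small c0 d'01 eps0.
have := robba_theta_tlog natK M tw => /(congr1 (fun f : robba K => f 0)).
rewrite robba_thetaE mul0r mulrBr mulr1 rcoefB => /esym/eqP; rewrite subr_eq0 => /eqP ->.
have := gboundM rho0 hc (gbound_exp M rho0 (gboundN hd)) 0; rewrite expr0z mulr1.
move=> /le_trans; apply; apply: le_trans (hM M (leqnn _)); rewrite ler_wpM2l//.
by rewrite lerXn2r ?nnegrE ?le_max ?d0 ?lexx.
Qed.

(** A priori the dominant degree depends on the radius. As it always equals [a], one normalization
    works on a whole annulus. *)
Lemma trivial_normal_form h a : pic_rel (robba_const a + G h) 0 ->
  exists n0 : int, a = n0%:~R /\ exists w, robba_theta w = G h * (1 + w) /\
  exists2 d : R, 0 < d < 1 & forall rho, 1 - d < rho < 1 -> forall n, unorm (w n) * rho ^ n < 1.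
Proof.
move=> /pic_rel0[u [v [uv tu]]].
have [d d01 hd] := unit_dominant uv; have [e e01 he] := robba_radius u.
have md : Num.min d e <= d by rewrite ge_min lexx.
have me : Num.min d e <= e by rewrite ge_min lexx orbT.
have f01 : 0 < Num.min d e < 1 by rewrite lt_min; apply/andP; split; lra.
set f := Num.min d e in md me f01.
have dom rho : 1 - f < rho < 1 -> exists n0 : int, a = n0%:~R /\ dominant u rho n0.
  move=> rho1; have [|n0 hn0] := hd rho; first lra.
  by exists n0; split=> //; apply: (dominant_exponent e01 he) (tu) (hn0); lra.
have [|n0 [an0 h0]] := dom (1 - f / 2); first lra.
have {}dom rho : 1 - f < rho < 1 -> dominant u rho n0.
  by move=> /dom[n1 [an1]]; have -> : n1 = n0 by apply: intK_inj; rewrite -an0 -an1.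
have un0 : u n0 != 0 by rewrite -unorm_eq0 gt_eqF// (dominant_neq0 _ h0)//; lra.
have [w [tw w1 _]] := dominant_normalize un0 tu.
exists n0; split=> //; exists w; split.
  by rewrite tw an0 subrr rmorph0 add0r.
by exists f => // rho rho1; apply: w1; [lra|exact: dom].
Qed.

End ArtinSchreierKernel.

(** * Reduction of a normalized solution modulo 2 *)

Section ArtinSchreierInjectivity.
Context {R : realType} {K : completeUltrametricFieldType R}.
Hypothesis K_padic : contains_Qp 2 K.
Hypothesis K_unram : unramified 2 K.
Implicit Types (w : robba K) (h : laurent (residue K)) (a : K).

Let two_prime : prime 2. Proof. by []. Qed.
Let natK := natK_neq0 two_prime K_padic.
Let t := unorm (2 : K).
Let t0 : 0 < t. Proof. exact: unorm_p_gt0 two_prime K_padic. Qed.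
Let t1 : t < 1. Proof. exact: unorm_p_lt1 two_prime K_padic. Qed.
Let two0 : (2 : K) != 0. Proof. exact: (natK 1). Qed.
Let G h := as_robba K_padic h.

Section NormalForm.
Variables (h : laurent (residue K)) (w : robba K) (d : R).
Hypothesis tw : robba_theta w = G h * (1 + w).
Hypothesis d01 : 0 < d < 1.
Hypothesis hw : forall rho, 1 - d < rho < 1 -> forall n, unorm (w n) * rho ^ n < 1.

Let d2 : 1 - d < 1 - d / 2 < 1.
Proof. by have := d01; lra. Qed.

Let d2_ge0 : 0 <= 1 - d / 2.
Proof. by have := d01; lra. Qed.

Lemma nf_neg m : unorm (w (- m%:Z)) < (1 - d / 2) ^+ m.
Proof.
have r0 : 0 < 1 - d / 2 by have := d01; lra.
have := hw d2 (- m%:Z); rewrite -exprnN ltr_pdivrMr ?mul1r//.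
exact: exprn_gt0.
Qed.

Lemma nf_le1 n : unorm (w n) <= 1.
Proof.
case: n => m; last first.
  rewrite NegzE; apply: (le_trans (ltW (nf_neg _))).
  by apply: exprn_ile1; case/andP: d2 => _ /ltW.
rewrite leNgt; apply/negP => w1.
have [k k01 wk] := @shrink_factor R _ m w1.
pose r := Num.max k (1 - d / 2).
have kr : k <= r by rewrite le_max lexx.
have r1 : 1 - d < r < 1.
  by rewrite lt_max gt_max; case/andP: d2 => -> ->; case/andP: k01 => _ ->; rewrite orbT.
have := hw r1 m; rewrite ltNge => /negP; apply.
apply: (le_trans (ltW wk)); rewrite ler_wpM2l ?unorm_ge0// -exprnP.
by have /andP[k0 _] := k01; rewrite lerXn2r ?nnegrE ?(ltW k0)// (le_trans _ kr)// ltW.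
Qed.

(** In degrees n <= 0 the coefficient has norm strictly below 1, and the gap gives |2|. In degrees n
    > 0 the limit rho -> 1 only gives 1; there the n-th binomial coefficient of n is 1, so w_n is a
    coefficient of [zt (G h) n * (1 + w)], where the first factor has norm at most |2|. *)
Lemma nf_norm n : unorm (w n) <= t.
Proof.
case: n => [[|m]|m].
- apply: (unorm_lt1_le two_prime K_padic K_unram).
  by have := nf_neg 0; rewrite oppr0 expr0.
- have hth : robba_theta (1 + w) = G h * (1 + w).
    by rewrite -tw (raddfD (@robba_theta R K)) [X in X + _]robba_theta1 add0r.
  have := zt_solution_exact natK hth m.+1 m.+1.
  rewrite ibinnn mul1r rcoefD rcoef1 add0r => <-.
  apply: rcoefM_le (ltW t0) _ => i; rewrite unormM -[leRHS]mulr1.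
  apply: ler_pM; rewrite ?unorm_ge0 ?as_zt_norm//.
  rewrite rcoefD unormD_le ?nf_le1// rcoef1; case: eqP; rewrite ?unorm1 ?unorm0//.
- apply: (unorm_lt1_le two_prime K_padic K_unram); rewrite NegzE.
  by apply: (lt_le_trans (nf_neg _)); apply: exprn_ile1; case/andP: d2 => _ /ltW.
Qed.

Let y n := w n / 2.

Lemma nf_half_le1 n : unorm (y n) <= 1.
Proof. by rewrite unormM unormV ler_pdivrMr// mul1r nf_norm. Qed.

Lemma nf_laurent : is_laurent (fun n => red (y n)).
Proof.
have [|N hN] := @geo_small R 1 (1 - d / 2) t ler01 _ t0.
  by have := d01; lra.
exists N => n nN; apply/eqP; rewrite red0 ?nf_half_le1//.
rewrite unormM unormV ltr_pdivrMr// mul1r (_ : n = - `|n|%N%:Z); last by lia.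
by apply: (lt_le_trans (nf_neg _)); rewrite -[leLHS]mul1r; apply: hN; lia.
Qed.

(** Modulo 4 the logarithm of 1 + w reduces to w - w^2 / 2, while its derivative is that of the
    series with coefficients 2 [lift_res (h n)] up to a small error. *)
Lemma nf_log n : n < 0 ->
  unorm (w n - (w ^+ 2) n / 2 - 2 * lift_res (h n)) <= t * t.
Proof.
move=> n0; have nK : n%:~R != 0 :> K.
  by rewrite (_ : n = sg true `|n|.-1.+1) ?(intK_sg natK)// /sg; lia.
have un0 : 0 < unorm (n%:~R : K) by rewrite lt_def unorm_eq0 nK unorm_ge0.
have e0 : 0 < unorm (n%:~R : K) * (t * t) by rewrite !mulr_gt0.
(* N is large enough that the error |2|^(N+2) stays below |4| after division by n. *)
have [|N hN] := @geo_small R 1 t _ ler01 _ e0; first by rewrite t0.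
pose M := N.+2.
have wb : gbound 1 w t by apply/gbound1E; exact: nf_norm.
have tailb : unorm (tlog M w n - 2 * lift_res (h n)) <= t * t.
  rewrite -(ler_pM2l un0) -unormM mulrBr.
  have -> : n%:~R * (2 * lift_res (h n)) = G h n.
    rewrite [in RHS](_ : n = - `|n|%N%:Z) ?as_robbaE; last by lia.
    by congr (_%:~R * (2 * lift_res (h _))); rewrite /sg; lia.
  rewrite -robba_thetaE (robba_theta_tlog natK M tw) mulrBr mulr1 rcoefB addrAC subrr add0r unormN.
  have Gb : gbound 1 (G h) 1.
    by apply/gbound1E => j; apply: (le_trans (as_robba_norm K_padic h j)); exact: ltW.
  have := (gbound1E _ _).1 (gboundM ltr01 Gb (gbound_exp M ltr01 (gboundN wb))) n.
  by move=> /le_trans; apply; apply: hN; rewrite /M; lia.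
have tlogE : tlog M w = w - robba_const 2^-1 * w ^+ 2 +
    \sum_(i < N) robba_const ((-1) ^+ i.+2 / i.+3%:R) * w ^+ i.+3.
  rewrite /tlog /M 2!big_ord_recl addrA; congr (_ + _ + _).
  - by rewrite expr0 mul1r invr1 rmorph1 mul1r expr1.
  - by rewrite expr1 mulN1r rmorphN mulNr.
have -> : w n - (w ^+ 2) n / 2 - 2 * lift_res (h n) = tlog M w n - 2 * lift_res (h n) -
    (\sum_(i < N) robba_const ((-1) ^+ i.+2 / i.+3%:R) * w ^+ i.+3) n.
  by rewrite tlogE rcoefD rcoefB rcoefZ; ring.
apply: unormB_le => //; move: n {n0 nK un0 e0 hN tailb}; apply/gbound1E.
apply: gbound_sum => [//||i _]; first by rewrite mulr_ge0 ?ltW.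
apply: gbound_le (gboundZ _ (gbound_exp _ ltr01 wb)) _.
rewrite unormM (_ : unorm ((-1) ^+ i.+2) = 1) ?mul1r.
  exact: (pow2_norm K_padic (ltn0Sn i)).
by elim: (i.+2) => [|j IH]; rewrite ?expr0 ?unorm1// exprS unormM unormN unorm1 mul1r.
Qed.

(** With w = 2 y, [nf_log] says that y - y^2 agrees with the lift of h modulo 2. The n-th
    coefficient of y^2 reduces to its diagonal term, the other terms being paired, so it is the
    coefficient of the square of the reduction W. *)
Lemma nf_polar_as : polar_as h.
Proof.
pose W := mk_laurent nf_laurent.
exists W => n n0.
have hs : has_sum (fun i => y i * y (n - i)) ((w ^+ 2) n / 4).
  have := has_sumM (4^-1) (rcoefM_sum w w n).
  rewrite mulrC -expr2; congr has_sum; apply/funext => i.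
  by rewrite /y [in RHS]mulrACA -invfM -natrM mulrC.
have yy1 i : unorm (y i * y (n - i)) <= 1.
  by rewrite unormM mulr_ile1 ?unorm_ge0 ?nf_half_le1.
have Y1 := has_sum_le ler01 hs yy1.
have logn : unorm (y n - (w ^+ 2) n / 4 - lift_res (h n)) < 1.
  apply: le_lt_trans t1; rewrite -(ler_pM2l t0) -unormM.
  apply: le_trans (nf_log n0); rewrite le_eqVlt; apply/orP; left; apply/eqP; congr unorm.
  have -> : (4 : K)^-1 = 2^-1 * 2^-1 by rewrite -invfM -natrM.
  rewrite !mulrBr /y [2 * (w n / 2)]mulrC divfK//; congr (_ - _ - _).
  by rewrite mulrCA mulVKf.
have {logn} hE : h n = red (y n) - red ((w ^+ 2) n / 4).
  rewrite -redB ?nf_half_le1// -[h n]red_lift; apply/eqP.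
  by rewrite eq_sym red_eq ?lift_res_le1 ?unormB_le ?nf_half_le1.
suff -> : (W ^+ 2 - W) n = red (y n) - red ((w ^+ 2) n / 4) by [].
rewrite lcoefB -[W n]/(red (y n)) -[LHS](oppk (residue2 K_padic)) opprB; congr (_ - _).
have [F0 hF0] := hs t t0.
have [m nE] := int_parity n.
(* A finite set approximating the infinite sum modulo 2, symmetric so that the pairs occur, and
   containing the diagonal index m. *)
pose F := sym_closure n (m |` F0)%fset.
have F0F : (F0 `<=` F)%fset.
  by apply/fsubsetP => i iF; rewrite !inE iF orbT.
have mF : m \in F by rewrite !inE eqxx.
have hF : forall i, i \in F -> n - i \in F by move=> i; exact: sym_closureP.
have := hF0 F F0F; rewrite (sym_sum _ hF).
set D := \sum_(i <- F | i == n - i) _ => hD.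
have {hD} YD : unorm (D - (w ^+ 2) n / 4) < 1.
  apply: le_lt_trans t1; rewrite unormB.
  rewrite -[D]addr0 -(subrr ((\sum_(i <- F | i < n - i) y i * y (n - i)) *+ 2)).
  rewrite [D + _]addrA [D + _]addrC opprB addrA addrAC; apply: unormD_le => //.
  rewrite -mulr_natl unormM ler_piMr ?(ltW t0)//.
  by apply: unorm_sum_le => // i _ _; exact: yy1.
have D1 : unorm D <= 1.
  apply: unorm_sum_le => // i _ _.
  by rewrite unormM mulr_ile1 ?unorm_ge0 ?nf_half_le1.
have <- : red D = red ((w ^+ 2) n / 4) by apply/eqP; rewrite red_eq.
case: nE => nE.
  rewrite nE (lcoef_sqr_even (residue2 K_padic)) /D nE sym_diag mF mulr1n redM ?nf_half_le1//.
rewrite nE (lcoef_sqr_odd (residue2 K_padic)) /D nE sym_diag_odd.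
by apply/esym/eqP; rewrite red0 ?unorm0.
Qed.

End NormalForm.

Lemma as_injective h a : pic_rel (robba_const a + G h) 0 ->
  (exists n : int, a = n%:~R) /\ polar_as h.
Proof.
move=> /trivial_normal_form[n0 [an0 [w [tw [d d01 hw]]]]].
by split; [exists n0|exact: nf_polar_as tw d01 hw].
Qed.

End ArtinSchreierInjectivity.

(** * The Picard group for p = 2 *)

Section PicardTwo.
Context {R : realType} {K : completeUltrametricFieldType R}.
Hypothesis K_padic : contains_Qp 2 K.
Hypothesis K_unram : unramified 2 K.
Implicit Types (g : robba K) (h w : laurent (residue K)).

Let two_prime : prime 2. Proof. by []. Qed.
Let t := unorm (2 : K).
Let t0 : 0 < t. Proof. exact: unorm_p_gt0 two_prime K_padic. Qed.
Let two0 : (2 : K) != 0. Proof. exact: (natK_neq0 two_prime K_padic 1). Qed.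

(** The quotients l_n / 2 are integral and tend to 0, so their reductions form a polar part with
    finitely many terms. *)
Lemma negpart_as_class g : (forall n, unorm (side_log true (negpart g) n.+1) <= t) ->
  exists c : laurent (residue K), pic_class (negpart g) = as_class K_padic c.
Proof.
move=> hl; pose s m := side_log true (negpart g) m.+1 / 2.
have s1 m : unorm (s m) <= 1 by rewrite unormM unormV ler_pdivrMr// mul1r.
pose a (n : int) : residue K := if n < 0 then red (s `|n|.-1) else 0.
have la : is_laurent a.
  have [D [r [D0 r01 hD]]] := robba_geo_neg (negpart g).
  have [B [q [B0 rq hB]]] := nat_geo_shift r01.
  have DB0 : 0 <= D * B by rewrite mulr_ge0.
  have q01 : 0 < q < 1 by lra.
  have t20 : 0 < t / 2 by rewrite divr_gt0.
  have [N hN] := geo_small DB0 q01 t20.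
  exists N => n nN; rewrite /a; case: ifP => // n0; apply/eqP; rewrite red0//.
  rewrite unormM unormV ltr_pdivrMr// mul1r.
  have nE : (`|n|.-1.+1 = `|n|)%N by lia.
  rewrite nE; apply: (le_lt_trans (side_log_norm K_padic _ _)).
  apply: (@le_lt_trans _ _ (t / 2)); last by rewrite ltr_pdivrMr// ltr_pMr// ltr1n.
  apply: le_trans (hN `|n|%N _); last by lia.
  rewrite -mulrA; apply: le_trans (ler_wpM2l D0 (hB _)).
  by rewrite mulrCA ler_wpM2l.
exists (mk_laurent la); apply: (pic_class_as K_padic K_unram _ s1).
- exact: rsupp_restrict.
- by move=> m; rewrite mk_laurentE /a oppr_lt0 abszN absz_nat.
- by move=> m; rewrite /s mulrC divfK.
Qed.

Lemma as_range_closed : zmod_closed (mem (range (fun f : laurent (residue K) => f ^+ 2 - f))).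
Proof.
split; first by rewrite inE; exists 0 => //; rewrite expr0n subrr.
move=> x y; rewrite !inE => -[f _ <-] [h _ <-]; exists (f - h) => //.
by rewrite (lsqrB K_padic); ring.
Qed.

(** Composing [as_class] with [tau] gives the second component: [tau_kernel1] makes it well defined
    on the quotient, [tau_kernel2] with [as_injective] gives injectivity, and [tau_surj] reaches
    every polar part. *)
Lemma pic_sol_two :
  exists Phi : {additive (padic_int_modZ K * artin_schreier_quot 2 K)%type -> picard K},
      [/\ injective Phi, range Phi = pic_sol 2 &
          forall a : padic_int K, Phi (zclass _ a, 0) = pic_class (robba_const (a : K))].
Proof.
have k2 := residue2 K_padic.
have [e [eD e_as e_id]] := complement_projection k2 (as_pred_closed k2).
pose f h := as_class K_padic (tau k2 e_as h).
have fB : zmod_morphism f by move=> x y; rewrite /f (tauB k2 eD e_as) raddfB.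
pose fA : {additive laurent (residue K) -> picard K} :=
  HB.pack f (GRing.isZmodMorphism.Build _ _ f fB).
have ker1 (x : padic_int K) : integers x -> padic_class x = 0 by move=> /padic_class_eq0.
have [Phi1 Phi1E] := zquot_factor integers_closed ker1.
have ker2 x : range (fun f : laurent (residue K) => f ^+ 2 - f) x -> fA x = 0.
  move=> [w _ <-]; apply: (as_class_polar_as K_padic K_unram).
  exact: (tau_kernel1 k2 eD e_as).
have [Phi2 Phi2E] := zquot_factor as_range_closed ker2.
pose F (x : (padic_int_modZ K * artin_schreier_quot 2 K)%type) := Phi1 x.1 + Phi2 x.2.
have FB : zmod_morphism F.
  by move=> x y; rewrite /F !raddfB/= addrACA opprD.
pose Phi : {additive (padic_int_modZ K * artin_schreier_quot 2 K)%type -> picard K} :=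
  HB.pack F (GRing.isZmodMorphism.Build _ _ F FB).
have FE a h : F (zclass integers a, zclass _ h) =
    pic_class (robba_const (a : K) + as_robba K_padic (tau k2 e_as h)).
  by rewrite /F/= Phi1E Phi2E [RHS]raddfD.
have reprE (x : (padic_int_modZ K * artin_schreier_quot 2 K)%type) :
  exists (a : padic_int K) (h : laurent (residue K)),
    x = (zclass integers a, zclass (range (fun f : laurent (residue K) => f ^+ 2 - f)) h).
  by case: x => x1 x2; exists (repr x1), (repr x2); rewrite !zclass_repr.
exists Phi; split.
- apply: raddf_inj => x /=; have [a [h ->]] := reprE x.
  rewrite FE => /pic_class0/(as_injective K_unram)[an /(tau_kernel2 eD e_id)[w hw]].
  congr pair; first exact/(zclass_eq0 integers_closed).
  by apply/(zclass_eq0 as_range_closed); exists w.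
- apply/seteqP; split=> [_ [x _ <-]|c [g [hg ->]]].
    have [a [h ->]] := reprE x; rewrite /= FE.
    eexists; split; last reflexivity.
    by apply/solvable_rank1/(as_solvable K_padic); case: a.
  have [g' hg' ->] := solvable_rank1_class hg.
  have [h0 hc hl] := solvable_decomp two_prime K_padic K_unram hg'.
  have [b hb] := negpart_as_class hl.
  have [h hh] := tau_surj k2 eD e_as e_id b.
  exists (zclass integers (PadicInt h0), zclass _ h) => //=.
  rewrite FE raddfD/= -/(as_class K_padic (tau k2 e_as h)) (as_class_polar K_padic hh) -hb.
  by rewrite -raddfD; apply/esym/pic_classE.
- move=> a /=; rewrite /F/= raddf0 addr0; exact: Phi1E.
Qed.

End PicardTwo.

Theorem corollary4p30 (R : realType) (p : nat)
  (K : completeUltrametricFieldType R)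
  (p_prime : prime p) (K_padic : contains_Qp p K) (K_unram : unramified p K) :
  ((2 < p)%N ->
    (forall M : diffmod K, solvable p M ->
       exists N : diffmod K, moderate p N /\ diffmod_iso M N) /\
    (exists Phi : {additive padic_int_modZ K -> picard K},
       [/\ injective Phi,
           range Phi = pic_sol p &
           forall a : padic_int K, Phi (zclass _ a) = pic_class (robba_const (a : K))]))
  /\
  (p = 2%N ->
    exists Phi : {additive (padic_int_modZ K * artin_schreier_quot p K)%type -> picard K},
      [/\ injective Phi,
          range Phi = pic_sol p &
          forall a : padic_int K, Phi (zclass _ a, 0) = pic_class (robba_const (a : K))]).
Proof.
split=> [p2|p2].
  split; last exact: pic_sol_odd.
  move=> M /(solvable_moderate p_prime K_padic K_unram p2) hM; exists M; split=> //.
  have [_ [a /defined_by_rank1 ha]] := hM.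
  exact: diffmod_iso_trans (diffmod_iso_sym ha) ha.
subst p; exact: pic_sol_two.
Qed.
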